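(* Let $s,z,w\in\mathbb{C}$ be such that $\Re s>-\tfrac12$, $z+\bar w=s$, and let $C_{z,w}(x,g)$ be the multiplier defined in the context. The following formula defines a unitary representation $\underline{T}_{z,w}$ of the group $G=U(\infty)\times U(\infty)$ in the Hilbert space $\underline{H}=L^2(\mathfrak{U},\mu^{(s)})$: $$(\underline{T}_{z,w}(g)f)(x)=f(x.g)\,C_{z,w}(x,g),\qquad g\in G,\ f\in\underline{H},\ x\in\mathfrak{U}.$$ Further, the constant function $\mathbf{1}\in L^2(\mathfrak{U},\mu^{(s)})$ is a unit $K$-invariant vector in $\underline{H}$, where $K$ is the diagonal subgroup of $G$.
   Context: $U(\infty)=\bigcup_NU(N)$ with the inductive limit topology, $U(N)\subset U(N+1)$ being the subgroup fixing the $(N+1)$st basis vector; $G=U(\infty)\times U(\infty)=\bigcup_NG(N)$, $G(N)=U(N)\times U(N)$; $K=\{(U,U):U\in U(\infty)\}$. For $N\ge2$ write $U\in U(N)$ as $\begin{bmatrix}A&B\\ C&D\end{bmatrix}$ with $A$ of size $(N-1)\times(N-1)$, $D=U_{NN}$; $p_N:U(N)\to U(N-1)$ is the Borel map $p_N(U)=A-B(1+D)^{-1}C$ if $D\ne-1$, $p_N(U)=A$ if $D=-1$; it commutes with left and right shifts by $U(N-1)$. The space of virtual unitary matrices is $\mathfrak{U}=\varprojlim U(N)$, the set of sequences $x=(x_N)$, $x_N\in U(N)$, $p_N(x_N)=x_{N-1}$ for $N\ge2$, with its natural Borel structure; $\pi_N(x)=x_N$. $G$ acts on $\mathfrak{U}$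 on the right by $\pi_N(x.g)=U_2^{-1}\pi_N(x)U_1$ for $g=(U_1,U_2)\in G$ and all $N$ with $g\in G(N)$. $U(N)'$ is the set of $U\in U(N)$ without eigenvalue $-1$; $p_N$ maps $U(N)'$ onto $U(N-1)'$, and $\mathfrak{U}'=\varprojlim U(N)'\subset\mathfrak{U}$. Powers $\zeta^z$ ($\Re\zeta>0$) are taken in the branch equal to $1$ at $\zeta=1$. For $U\in U(N)'$ with eigenvalues $u_1,\dots,u_N$ put $f_{z,w\mid N}(U)=\prod_{k=1}^N(1+u_k)^z(1+\bar u_k)^w$. For $g\in G$ and $x\in\mathfrak{U}'$ with $x.g\in\mathfrak{U}'$ the ratio $f_{z,w\mid N}(\pi_N(x.g))/f_{z,w\mid N}(\pi_N(x))$ does not depend on $N$ for large $N$; $C_{z,w}(x,g)$ denotes this stable value. For fixed $g$ it is defined for $\mu^{(s)}$-almost all $x$. For $\Re s>-\frac12$, $\mu^{(s)}_N$ is the probability measure on $U(N)$ with density (extended by $0$ to $U(N)\setminus U(N)'$) $\left(\prod_{k=1}^N\frac{\Gamma(k)\Gamma(k+s+\bar s)}{\Gamma(k+s)\Gamma(k+\bar s)}\right)^{-1}\left|\prod_{k=1}^N(1+u_k)^s\right|^2$ with respect to the normalized Haar measure $\mu_N$. The pushforward of $\mu_N^{(s)}$ under $p_N$ is $\mu^{(s)}_{N-1}$, and $\mu^{(s)}$ is the probability Borel measure on $\mathfrak{U}$ whose pushforward under $\pi_N$ is $\mu_N^{(s)}$ for every $N$. *)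

(* Defs.v *)
From HB Require Import structures.
From mathcomp Require Import all_boot all_order all_algebra.
From mathcomp Require Import spectral sesquilinear ring_quotient.
From mathcomp Require Import all_classical all_reals all_analysis.
From mathcomp Require Import measurable_realfun ring lra.
From mathcomp Require Import complex.

Set Implicit Arguments.
Unset Strict Implicit.
Unset Printing Implicit Defensive.

Import Order.TTheory GRing.Theory Num.Theory.
Import numFieldNormedType.Exports.
Import ComplexField.Normc.

Local Open Scope classical_set_scope.
Local Open Scope complex_scope.
Local Open Scope sesquilinear_scope.
Local Open Scope ring_scope.

Local Notation Re := complex.Re.
Local Notation Im := complex.Im.

HB.instance Definition _ (R : realType) :=
  PseudoPointedMetric.copy R[i] R[i]^o.

Definition unitary (R : realType) (N : nat) : Type :=
  {A : 'M[R[i]]_N | A \is unitarymx}.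

HB.instance Definition _ (R : realType) (N : nat) :=
  SubChoice.copy (unitary R N) {A : 'M[R[i]]_N | A \is unitarymx}.

Section UnitaryGroup.
Variables (R : realType) (N : nat).
Local Notation U := (unitary R N).
Implicit Types u v : U.

Lemma unitarymx1 : (1%:M : 'M[R[i]]_N) \is unitarymx.
Proof. by apply/unitarymxP; rewrite trmx1 map_mx1 mulmx1. Qed.

Lemma unitarymx_adj (A : 'M[R[i]]_N) : A \is unitarymx -> A^t* \is unitarymx.
Proof. by move=> uA; apply/unitarymxP; rewrite trmxCK; apply/mulmx1C/unitarymxP. Qed.

Definition unitary_one : U := exist _ 1%:M unitarymx1.
Definition unitary_mul u v : U :=
  exist _ (val u *m val v) (mul_unitarymx (valP u) (valP v)).
Definition unitary_inv u : U := exist _ ((val u)^t*) (unitarymx_adj (valP u)).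

Lemma unitary_mulA : associative unitary_mul.
Proof. by move=> u v w; apply/val_inj; rewrite /= mulmxA. Qed.
Lemma unitary_mul1 : left_id unitary_one unitary_mul.
Proof. by move=> u; apply/val_inj; rewrite /= mul1mx. Qed.
Lemma unitary_1mul : right_id unitary_one unitary_mul.
Proof. by move=> u; apply/val_inj; rewrite /= mulmx1. Qed.
Lemma unitary_mulV : right_inverse unitary_one unitary_inv unitary_mul.
Proof. by move=> u; apply/val_inj; rewrite /=; apply/unitarymxP/(valP u). Qed.
Lemma unitary_Vmul : left_inverse unitary_one unitary_inv unitary_mul.
Proof.
by move=> u; apply/val_inj; rewrite /=; apply/mulmx1C/unitarymxP/(valP u).
Qed.

HB.instance Definition _ := isGroup.Build U
  unitary_mulA unitary_mul1 unitary_1mul unitary_Vmul unitary_mulV.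
Lemma val_unitary1 : val (1%g : U) = 1%:M. Proof. by []. Qed.
Lemma val_unitaryM u v : val (u * v)%g = val u *m val v. Proof. by []. Qed.
Lemma val_unitaryV u : val (u^-1)%g = (val u)^t*. Proof. by []. Qed.

HB.instance Definition _ := isPointed.Build U 1%g.
HB.instance Definition _ :=
  Topological.copy U (initial_topology (val : U -> 'M[R[i]]_N)).
HB.instance Definition _ :=
  Measurable.copy U (g_sigma_algebraType (@open U)).

End UnitaryGroup.


Section Projection.
Variables (R : realType) (N : nat).
Implicit Types X Y : 'M[R[i]]_N.+1.

Definition proj_mx_last X : 'M[R[i]]_N :=
  let A := row' ord_max (col' ord_max X) in
  let B := row' ord_max (col ord_max X) in
  let C := col' ord_max (row ord_max X) in
  let D := X ord_max ord_max in
  if D == -1 then A else A - (1 + D)^-1 *: (B *m C).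

Lemma big_lift_last (F : 'I_N.+1 -> R[i]) :
  \sum_i F i = \sum_(i < N) F (lift ord_max i) + F ord_max.
Proof.
rewrite big_ord_recr /=; congr (_ + _); apply: eq_bigr => i _.
by congr F; apply/ord_inj; rewrite lift_max.
Qed.

Lemma proj_mx_lastE X i j : proj_mx_last X i j =
  X (lift ord_max i) (lift ord_max j) -
  (if X ord_max ord_max == -1 then 0 else
   (1 + X ord_max ord_max)^-1 *
   (X (lift ord_max i) ord_max * X ord_max (lift ord_max j))).
Proof.
rewrite /proj_mx_last; case: ifP => _; rewrite !mxE ?subr0//.
by rewrite big_ord1 !mxE.
Qed.

Lemma proj_unitarymx X : X \is unitarymx -> proj_mx_last X \is unitarymx.
Proof.
move=> /unitarymxP uX.
have eX i k : \sum_(j < N) X i (lift ord_max j) * (X k (lift ord_max j))^* +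
    X i ord_max * (X k ord_max)^* = (i == k)%:R.
  move/matrixP: uX => /(_ i k); rewrite !mxE big_lift_last => <-.
  by congr (_ + _); rewrite ?mxE//; apply: eq_bigr => j _; rewrite !mxE.
have MN k : (ord_max == lift ord_max k :> 'I_N.+1) = false.
  exact/negbTE/neq_lift.
have NM k : (lift ord_max k == ord_max :> 'I_N.+1) = false by rewrite eq_sym.
apply/unitarymxP/matrixP => i k; rewrite mxE [RHS]mxE.
set d := X ord_max ord_max; set l := (lift ord_max : 'I_N -> 'I_N.+1).
have -> : (i == k) = (l i == l k) by rewrite (inj_eq lift_inj).
rewrite -[RHS]eX -/l.
have [dN1|dN1] := eqVneq d (-1).
  have : X (l i) ord_max = 0.
    (* the last row has norm one, hence so does its last entry *)
    have /eqP := eX ord_max ord_max; rewrite -/d dN1 eqxx rmorphN rmorph1.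
    rewrite mulrNN mulr1 addrC -subr_eq0 addrAC subrr add0r => /eqP s0.
    have z j : X ord_max (l j) = 0.
      have := s0; move=> /eqP; rewrite psumr_eq0 => [/allP /(_ j)|m _].
        by rewrite mem_index_enum => /(_ isT); rewrite /= -normCK expf_eq0 normr_eq0
          => /eqP.
      by rewrite mul_conjC_ge0.
    have := eX (l i) ord_max; rewrite NM -/d dN1 rmorphN rmorph1 mulrN1.
    rewrite big1 ?add0r => [/eqP|j _]; last by rewrite z rmorph0 mulr0.
    by rewrite oppr_eq0 => /eqP.
  move=> ->; rewrite mul0r addr0; apply: eq_bigr => j _.
  by rewrite !mxE !proj_mx_lastE -/d dN1 eqxx !subr0.
have h : 1 + d != 0 by rewrite addrC addr_eq0.
pose e := (1 + d)^-1.
pose a (r : 'I_N.+1) := X r ord_max.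
pose S (r t : 'I_N.+1) := \sum_(j < N) X r (l j) * (X t (l j))^*.
have SE r t : S r t = (r == t)%:R - a r * (a t)^*.
  by rewrite -[(r == t)%:R]eX addrK.
have step : \sum_j proj_mx_last X i j * (proj_mx_last X)^t* j k =
   S (l i) (l k) - e^* * (a (l k))^* * S (l i) ord_max
   - e * a (l i) * S ord_max (l k)
   + e * e^* * a (l i) * (a (l k))^* * S ord_max ord_max.
  rewrite /S !mulr_sumr -!sumrB -big_split/=; apply: eq_bigr => j _.
  rewrite !mxE !proj_mx_lastE -/d (negbTE dN1) -/e -/l rmorphB !rmorphM /a.
  ring.
have lM r : (l r == ord_max) = false := NM r.
have Ml r : (ord_max == l r) = false := MN r.
rewrite step !SE eqxx lM Ml -/(a _) -/(a _).
have -> : a ord_max = d by [].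
have eE : e * (1 + d) = 1 by rewrite mulVf.
have ecE : e^* * (1 + d^*) = 1 by rewrite -[1 + d^*]/(1 + Num.conj d) -[1 in LHS](rmorph1 Num.conj) -rmorphD -rmorphM eE rmorph1.
have -> : d = (1 + d) - 1 by rewrite addrAC subrr add0r.
rewrite rmorphB rmorphD rmorph1.
set x := 1 + d in eE *; set y := 1 + d^* in ecE *.
rewrite eX mulr0n mulr1n.
suff : e * e^* * (x * y) = 1.
  move=> q; transitivity ((l i == l k)%:R + a (l i) * (a (l k))^* *
    (- 1 + e^* * (y - 1) + e * (x - 1) + e * e^* * (1 - (x-1) * (y - 1)))).
    by rewrite /=; ring.
  have -> : e^* * (y - 1) = 1 - e^* by rewrite mulrBr ecE mulr1.
  have -> : e * (x - 1) = 1 - e by rewrite mulrBr eE mulr1.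
  have -> : e * e^* * (1 - (x - 1) * (y - 1)) = e * e^* * (x + y) - e * e^* * (x * y).
    by ring.
  have -> : e * e^* * (x + y) = e^* * (e * x) + e * (e^* * y) by ring.
  by rewrite q eE ecE; ring.
by rewrite mulrACA eE ecE mulr1.
Qed.

Definition proj_unitary (u : unitary R N.+1) : unitary R N :=
  exist _ (proj_mx_last (val u)) (proj_unitarymx (valP u)).

End Projection.

Section StableMatrices.
Local Open Scope nat_scope.
Variable R : realType.
Local Notation C := R[i].

(* The infinite block-diagonal matrix diag(A, 1). *)
Definition stab (N : nat) (A : 'M[C]_N) (i j : nat) : C :=
  match insub i : option 'I_N, insub j : option 'I_N with
  | Some i', Some j' => A i' j'
  | _, _ => (i == j)%:R
  end.

Lemma stab_ord N (A : 'M[C]_N) (i j : 'I_N) : stab A i j = A i j.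
Proof. by rewrite /stab !valK. Qed.

Lemma stabl N (A : 'M[C]_N) i j : N <= i -> stab A i j = (i == j)%:R.
Proof. by move=> Ni; rewrite /stab insubF// ltnNge Ni. Qed.

Lemma stabr N (A : 'M[C]_N) i j : N <= j -> stab A i j = (i == j)%:R.
Proof. by move=> Nj; rewrite /stab [insub j]insubF ?ltnNge ?Nj//; case: insub. Qed.

Definition corner (N : nat) (a : nat -> nat -> C) : 'M[C]_N :=
  \matrix_(i, j) a i j.

Lemma stabK N (A : 'M[C]_N) : corner N (stab A) = A.
Proof. by apply/matrixP => i j; rewrite mxE stab_ord. Qed.

Lemma stab_corner N M (A : 'M[C]_N) : N <= M -> stab (corner M (stab A)) = stab A.
Proof.
move=> NM; apply/funext => i; apply/funext => j.
have [Mi|iM] := leqP M i; first by rewrite !stabl// (leq_trans NM).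
have [Mj|jM] := leqP M j; first by rewrite !stabr// (leq_trans NM).
by rewrite (stab_ord _ (Ordinal iM) (Ordinal jM)) mxE.
Qed.

Lemma corner_stabM N M (A B : 'M[C]_N) : N <= M ->
  corner M (stab (A *m B)) = corner M (stab A) *m corner M (stab B).
Proof.
move=> NM; apply/matrixP => i j; rewrite !mxE.
under eq_bigr do rewrite !mxE.
have [Ni|iN] := leqP N i.
  rewrite stabl// (bigD1 i)//= stabl// eqxx mul1r big1 ?addr0 ?stabl// => k ki.
  by rewrite stabl// eq_sym [(k == i :> nat)](negbTE ki) mul0r.
have [Nj|jN] := leqP N j.
  rewrite stabr// (bigD1 j)//= [stab B _ _]stabr// eqxx mulr1 big1 ?addr0 ?stabr//.
  by move=> k kj; rewrite [stab B _ _]stabr// [(k == j :> nat)](negbTE kj) mulr0.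
rewrite (stab_ord _ (Ordinal iN) (Ordinal jN)) mxE.
rewrite -(big_mkord xpredT (fun k => (stab A i k * stab B k j)%R)).
rewrite (@big_cat_nat _ _ _ N)//= [X in (_ + X)%R]big_nat_cond [X in (_ + X)%R]big1 ?addr0.
  rewrite big_mkord. apply: eq_bigr => k _.
  by rewrite (stab_ord A (Ordinal iN) k) (stab_ord B k (Ordinal jN)).
move=> k /andP[/andP[Nk _] _]; rewrite stabr//.
have /negbTE -> : (i != k :> nat) by rewrite neq_ltn (leq_trans iN).
by rewrite mul0r.
Qed.

Lemma corner_stab_adj N M (A : 'M[C]_N) :
  corner M (stab (A^t*)) = (corner M (stab A))^t*.
Proof.
apply/matrixP => i j; rewrite !mxE /stab.
by case: insub => [i'|]; case: insub => [j'|]; rewrite ?mxE// eq_sym conjC_nat.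
Qed.

Lemma corner_stab1 N M : corner M (stab (1%:M : 'M[C]_N)) = 1%:M.
Proof.
apply/matrixP => i j; rewrite !mxE.
have [Ni|iN] := leqP N i; first by rewrite stabl.
have [Nj|jN] := leqP N j; first by rewrite stabr.
by rewrite (stab_ord _ (Ordinal iN) (Ordinal jN)) mxE.
Qed.

Lemma corner_unitary N M (A : 'M[C]_N) : N <= M ->
  A \is unitarymx -> corner M (stab A) \is unitarymx.
Proof.
move=> NM /unitarymxP uA; apply/unitarymxP.
by rewrite -corner_stab_adj -corner_stabM// uA corner_stab1.
Qed.

(* U(infinity), realised inside the infinite matrices as the union of the U(N). *)
Record unitary_inf := UnitaryInf {
  umx :> nat -> nat -> C;
  umxP : exists N (u : unitary R N), umx = stab (val u)
}.

HB.instance Definition _ := gen_eqMixin unitary_inf.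
HB.instance Definition _ := gen_choiceMixin unitary_inf.

Lemma unitary_inf_inj (u v : unitary_inf) : umx u = umx v -> u = v.
Proof.
by case: u v => [a ap] [b bp] /= ab; subst b; congr UnitaryInf; exact: Prop_irrelevance.
Qed.

Definition uembed N (u : unitary R N) : unitary_inf :=
  UnitaryInf (ex_intro _ N (ex_intro _ u erefl)).

End StableMatrices.

(* The N x N corner of u; the default value 1 is never used for u in U(N).
   Locked because unification would otherwise unfold it. *)
HB.lock Definition ucorner (R : realType) (N : nat) (u : unitary_inf R) :
  unitary R N := insubd (1%g : unitary R N) (corner N u).
Canonical ucorner_unlock := Unlockable ucorner.unlock.

Section InfiniteUnitary.
Variable R : realType.
Local Open Scope nat_scope.
Local Notation C := R[i].
Local Notation unitary_inf := (unitary_inf R).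
Implicit Types u v w : unitary_inf.

Definition in_level N : set unitary_inf := range (@uembed R N).

Lemma uembedK N : cancel (@uembed R N) (@ucorner R N).
Proof.
by move=> u; rewrite unlock /= stabK valKd.
Qed.

Lemma ucornerK N u : in_level N u -> uembed (ucorner N u) = u.
Proof. by case=> v _ <-; rewrite uembedK. Qed.

Lemma val_ucorner N M (u : unitary R N) : N <= M ->
  val (ucorner M (uembed u)) = corner M (stab (val u)).
Proof. by move=> NM; rewrite unlock val_insubd ifT//; exact: corner_unitary NM (valP u). Qed.

Lemma in_level_mono N M u : N <= M -> in_level N u -> in_level M u.
Proof.
move=> NM [v _ <-]; exists (ucorner M (uembed v)) => //.
by apply/unitary_inf_inj; rewrite /= val_ucorner// stab_corner.
Qed.

Lemma in_level_ex u : exists N, `[< in_level N u >].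
Proof.
by case: (umxP u) => N [v uv]; exists N; apply/asboolP; exists v => //; exact: unitary_inf_inj.
Qed.

Definition level u : nat := ex_minn (in_level_ex u).

Lemma in_levelE N u : in_level N u <-> level u <= N.
Proof.
rewrite /level; case: ex_minnP => n /asboolP un nmin; split.
  by move=> /asboolP; exact: nmin.
by move=> nN; exact: in_level_mono un.
Qed.

Lemma ucornerM N M (u v : unitary R N) : N <= M ->
  ucorner M (uembed (u * v)%g) = (ucorner M (uembed u) * ucorner M (uembed v))%g.
Proof.
move=> NM; apply/val_inj.
etransitivity; first exact: val_ucorner NM.
etransitivity; first exact: corner_stabM NM.
by apply: esym; congr (_ *m _); exact: val_ucorner NM.
Qed.

Lemma ucornerV N M (u : unitary R N) : N <= M ->
  ucorner M (uembed u^-1%g) = (ucorner M (uembed u))^-1%g.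
Proof. by move=> NM; apply/val_inj; rewrite !(val_unitaryV, val_ucorner _ NM) corner_stab_adj. Qed.

Definition umul u v : unitary_inf :=
  uembed (ucorner (maxn (level u) (level v)) u *
          ucorner (maxn (level u) (level v)) v)%g.
Definition uinv u : unitary_inf := uembed (ucorner (level u) u)^-1%g.
Definition uone : unitary_inf := uembed (1%g : unitary R 0).

Lemma uembed_corner N M (u : unitary R N) : N <= M ->
  uembed (ucorner M (uembed u)) = uembed u.
Proof. by move=> NM; rewrite ucornerK//; apply: in_level_mono NM _; exists u. Qed.

Lemma umulE N u v : in_level N u -> in_level N v ->
  umul u v = uembed (ucorner N u * ucorner N v)%g.
Proof.
move=> /in_levelE uN /in_levelE vN; rewrite /umul.
have MN : maxn (level u) (level v) <= N by rewrite geq_max uN.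
have uM : in_level (maxn (level u) (level v)) u by apply/in_levelE/leq_maxl.
have vM : in_level (maxn (level u) (level v)) v by apply/in_levelE/leq_maxr.
rewrite -[LHS](uembed_corner _ MN); apply: (congr1 (@uembed R N)).
have Eu := congr1 (@ucorner R N) (ucornerK uM).
have Ev := congr1 (@ucorner R N) (ucornerK vM).
etransitivity; first exact: ucornerM MN.
by rewrite Eu Ev.
Qed.

Lemma uinvE N u : in_level N u -> uinv u = uembed (ucorner N u)^-1%g.
Proof.
move=> /in_levelE uN; rewrite /uinv.
have uM : in_level (level u) u by apply/in_levelE.
rewrite -[LHS](uembed_corner _ uN); apply: (congr1 (@uembed R N)).
have Eu := congr1 (@ucorner R N) (ucornerK uM).
etransitivity; first exact: ucornerV uN.
by rewrite Eu.
Qed.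

Lemma uoneE N : uone = uembed (1%g : unitary R N).
Proof.
rewrite /uone -(uembed_corner _ (leq0n N)); apply: (congr1 (@uembed R N)); apply/val_inj.
by rewrite val_ucorner// !val_unitary1 corner_stab1.
Qed.

Lemma ucorner_umul N u v : in_level N u -> in_level N v ->
  ucorner N (umul u v) = (ucorner N u * ucorner N v)%g.
Proof. by move=> uN vN; rewrite (umulE uN vN) uembedK. Qed.

Lemma umul_level N u v : in_level N u -> in_level N v -> in_level N (umul u v).
Proof. by move=> uN vN; rewrite (umulE uN vN); eexists. Qed.

Lemma in_level_leq u N : level u <= N -> in_level N u.
Proof. by move=> ?; exact/in_levelE. Qed.

Lemma umulA : associative umul.
Proof.
move=> u v w; pose N := maxn (level u) (maxn (level v) (level w)).
have uN : in_level N u by apply: in_level_leq; rewrite leq_maxl.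
have vN : in_level N v by apply: in_level_leq; rewrite leq_max leq_maxl orbT.
have wN : in_level N w by apply: in_level_leq; rewrite !leq_max leqnn !orbT.
rewrite (umulE uN (umul_level vN wN)) (umulE (umul_level uN vN) wN).
by rewrite !ucorner_umul// mulgA.
Qed.

Lemma umul1 : left_id uone umul.
Proof.
move=> u; have uN := @in_level_leq u _ (leqnn _).
have oN : in_level (level u) uone by rewrite (uoneE (level u)); eexists.
by rewrite (umulE oN uN) (uoneE (level u)) uembedK mul1g ucornerK.
Qed.

Lemma u1mul : right_id uone umul.
Proof.
move=> u; have uN := @in_level_leq u _ (leqnn _).
have oN : in_level (level u) uone by rewrite (uoneE (level u)); eexists.
by rewrite (umulE uN oN) (uoneE (level u)) uembedK mulg1 ucornerK.
Qed.

Lemma uVmul : left_inverse uone uinv umul.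
Proof.
move=> u; have uN := @in_level_leq u _ (leqnn _).
have vN : in_level (level u) (uinv u) by eexists.
by rewrite (umulE vN uN) uembedK mulVg -uoneE.
Qed.

Lemma umulV : right_inverse uone uinv umul.
Proof.
move=> u; have uN := @in_level_leq u _ (leqnn _).
have vN : in_level (level u) (uinv u) by eexists.
by rewrite (umulE uN vN) uembedK mulgV -uoneE.
Qed.

HB.instance Definition _ := isGroup.Build unitary_inf
  umulA umul1 u1mul uVmul umulV.

(* The inductive limit topology. *)
Definition uinf_open : set_system unitary_inf :=
  [set A | forall N, open (@uembed R N @^-1` A)].

Lemma uinf_openT : uinf_open setT.
Proof. by move=> N; rewrite preimage_setT; exact: openT. Qed.

Lemma uinf_openI : setI_closed uinf_open.
Proof. by move=> A B oA oB N; rewrite preimage_setI; apply: openI. Qed.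

Lemma uinf_open_bigU (I : Type) (f : I -> set unitary_inf) :
  (forall i, uinf_open (f i)) -> uinf_open (\bigcup_i f i).
Proof.
by move=> of_ N; rewrite preimage_bigcup; apply: bigcup_open => i _; exact: of_.
Qed.

HB.instance Definition _ := isOpenTopological.Build unitary_inf
  uinf_openT uinf_openI uinf_open_bigU.

(* With the product topology. *)
Definition Ginf : Type := (unitary_inf * unitary_inf)%type.
HB.instance Definition _ := Group.on Ginf.
HB.instance Definition _ := Topological.on Ginf.

End InfiniteUnitary.

(* Sequences are indexed from N = 0; as U(0) is a point, this is the same as
   indexing from N = 1. *)
Record virtual_unitary (R : realType) := VirtualUnitary {
  vseq :> forall N, unitary R N;
  vseqP : forall N, proj_unitary (vseq N.+1) = vseq N
}.

Section VirtualUnitary.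
Variable R : realType.
Local Notation V := (virtual_unitary R).
Implicit Types (x y : V) (g : Ginf R).

Lemma virtual_unitary_inj x y : (forall N, x N = y N) -> x = y.
Proof.
case: x y => [a ap] [b bp] /= ab.
have {}ab : a = b by apply: functional_extensionality_dep.
by subst b; congr VirtualUnitary; exact: Prop_irrelevance.
Qed.

Lemma proj_unitary1 N : proj_unitary (1%g : unitary R N.+1) = 1%g.
Proof.
apply/val_inj/matrixP => i j; rewrite [LHS]proj_mx_lastE !mxE.
rewrite (negbTE (neq_lift ord_max j)) !mulr0 (inj_eq lift_inj).
by case: ifP => _; rewrite subr0.
Qed.

Definition pi_ (N : nat) : V -> unitary R N := fun x => x N.

HB.instance Definition _ := gen_eqMixin V.
HB.instance Definition _ := gen_choiceMixin V.
HB.instance Definition _ := isPointed.Build V (VirtualUnitary proj_unitary1).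

Definition virtual_cylinder : set (set V) :=
  [set A | exists N, exists2 B, measurable B & A = pi_ N @^-1` B].

HB.instance Definition _ :=
  Measurable.copy V (g_sigma_algebraType virtual_cylinder).

Lemma proj_unitaryM N (u v : unitary R N) (X : unitary R N.+1) :
  proj_unitary (ucorner N.+1 (uembed u) * X * ucorner N.+1 (uembed v))%g =
  (u * proj_unitary X * v)%g.
Proof.
apply/val_inj.
rewrite [LHS]/(proj_mx_last (val (ucorner N.+1 (uembed u)) *m val X *m
  val (ucorner N.+1 (uembed v)))) !val_ucorner//.
rewrite [RHS]/(val u *m proj_mx_last (val X) *m val v).
set a := val u; set b := val v; set Y := val X.
have stl (i k : 'I_N) : stab a (lift ord_max i : 'I_N.+1) (lift ord_max k : 'I_N.+1) = a i k.
  by rewrite !lift_max stab_ord.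
have str (i k : 'I_N) : stab b (lift ord_max i : 'I_N.+1) (lift ord_max k : 'I_N.+1) = b i k.
  by rewrite !lift_max stab_ord.
have lt (i : 'I_N) : (i == N :> nat) = false by rewrite ltn_eqF.
have E (r t : 'I_N.+1) : (corner N.+1 (stab a) *m Y *m corner N.+1 (stab b)) r t =
  \sum_(k < N.+1) (\sum_(l < N.+1) stab a r l * Y l k) * stab b k t.
  rewrite mxE; apply: eq_bigr => k _; rewrite !mxE; congr (_ * _).
  by apply: eq_bigr => l _; rewrite mxE.
have al (r : 'I_N) (k : 'I_N.+1) : \sum_(l < N.+1) stab a (lift ord_max r : 'I_N.+1) l * Y l k =
    \sum_(l < N) a r l * Y (lift ord_max l) k.
  rewrite big_lift_last [in X in _ + X]stabr// lift_max lt mul0r addr0.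
  by apply: eq_bigr => l _; rewrite -[in RHS]stl !lift_max.
have am (k : 'I_N.+1) : \sum_(l < N.+1) stab a (ord_max : 'I_N.+1) l * Y l k = Y ord_max k.
  rewrite big_lift_last stabl ?leqnn// eqxx mul1r big1 ?add0r// => l _.
  by rewrite stabl ?leqnn// lift_max eq_sym lt mul0r.
have bl (F : 'I_N.+1 -> R[i]) (t : 'I_N) :
    \sum_(k < N.+1) F k * stab b k (lift ord_max t : 'I_N.+1) =
    \sum_(k < N) F (lift ord_max k) * b k t.
  rewrite big_lift_last [in X in _ + X]stabl// lift_max eq_sym lt mulr0 addr0.
  by apply: eq_bigr => l _; rewrite -[in RHS]str !lift_max.
have bm (F : 'I_N.+1 -> R[i]) : \sum_(k < N.+1) F k * stab b k (ord_max : 'I_N.+1) = F ord_max.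
  rewrite big_lift_last [in X in _ + X]stabl ?leqnn// eqxx mulr1 big1 ?add0r// => l _.
  by rewrite stabr// lift_max lt mulr0.
apply/matrixP => i j; rewrite proj_mx_lastE !E.
rewrite bm am !bl bm al.
under eq_bigr do rewrite al.
under [X in _ - (if _ then _ else _ * (_ * X))]eq_bigr do rewrite am.
rewrite mxE; under [RHS]eq_bigr do rewrite mxE.
have [D|D] := eqVneq (Y ord_max ord_max) (-1).
  rewrite subr0; apply: eq_bigr => k _; congr (_ * _); apply: eq_bigr => l _.
  by rewrite proj_mx_lastE D eqxx subr0.
rewrite mulr_sumr mulr_sumr -sumrB; apply: eq_bigr => k _.
rewrite !mulr_suml mulr_sumr -sumrB; apply: eq_bigr => l _.
by rewrite proj_mx_lastE (negbTE D); ring.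
Qed.

Definition in_levelG N : set (Ginf R) := [set g | in_level N g.1 /\ in_level N g.2].

Definition levelG g : nat := maxn (level g.1) (level g.2).

Lemma in_levelGE N g : in_levelG N g <-> (levelG g <= N)%N.
Proof.
rewrite geq_max; split; first by move=> [/in_levelE -> /in_levelE ->].
by move=> /andP[? ?]; split; exact/in_levelE.
Qed.

Definition shift N g (X : unitary R N) : unitary R N :=
  ((ucorner N g.2)^-1 * X * ucorner N g.1)%g.

Lemma proj_shift N g (X : unitary R N.+1) : in_levelG N g ->
  proj_unitary (shift g X) = shift g (proj_unitary X).
Proof.
move=> [[u _ ug] [v _ vg]]; rewrite /shift -ug -vg.
by rewrite -(ucornerV _ (leqnSn N)) proj_unitaryM !uembedK.
Qed.

(* The terms of x.g below the level of g are forced by those above it. *)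
Fixpoint act_seq (d : nat) x g N : unitary R N :=
  if (levelG g <= N)%N then shift g (x N)
  else if d is d'.+1 then proj_unitary (act_seq d' x g N.+1) else 1%g.

Lemma act_seqE d x g N : (levelG g <= N)%N -> act_seq d x g N = shift g (x N).
Proof. by case: d => [|d] /= ->. Qed.

Lemma act_seqS d x g N : (levelG g <= N + d)%N ->
  act_seq d.+1 x g N = act_seq d x g N.
Proof.
elim: d N => [|d IHd] N; first by rewrite addn0 /= => ->.
move=> gN; rewrite [LHS]/= [RHS]/=; case: ifP => // _.
by congr proj_unitary; apply: IHd; rewrite addSnnS.
Qed.

Lemma act_seqP x g N :
  proj_unitary (act_seq (levelG g) x g N.+1) = act_seq (levelG g) x g N.
Proof.
have [gN|Ng] := leqP (levelG g) N.
  rewrite !act_seqE// 1?ltnW// proj_shift ?vseqP//; exact/in_levelGE.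
rewrite -[RHS]act_seqS ?leq_addl//.
by rewrite [RHS]/= leqNgt Ng.
Qed.

Definition act x g : V := VirtualUnitary (act_seqP x g).

Lemma pi_act x g N : in_levelG N g ->
  pi_ N (act x g) = ((ucorner N g.2)^-1 * pi_ N x * ucorner N g.1)%g.
Proof. by move=> /in_levelGE gN; rewrite /pi_ /act /= act_seqE. Qed.

Lemma actP x g y :
  (forall N, in_levelG N g ->
    pi_ N y = ((ucorner N g.2)^-1 * pi_ N x * ucorner N g.1)%g) -> y = act x g.
Proof.
move=> H; apply: virtual_unitary_inj => N.
have big M : (levelG g <= M)%N -> y M = act x g M.
  by move=> /in_levelGE gM; have := H M gM; rewrite -pi_act.
suff : forall d M, (levelG g <= M + d)%N -> y M = act x g M.
  by apply; exact: leq_addl.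
elim=> [|d IHd] M; first by rewrite addn0; exact: big.
by rewrite -addSnnS => gM; rewrite -[LHS]vseqP -[RHS]vseqP IHd.
Qed.

End VirtualUnitary.

Section ComplexFunctions.
Variable R : realType.
Implicit Types (zeta z : R[i]).

Definition cexp z : R[i] :=
  (expR (Re z) * cos (Im z)) +i* (expR (Re z) * sin (Im z)).

(* The branch of the logarithm on Re zeta > 0 that vanishes at 1. *)
Definition cln zeta : R[i] := ln (normc zeta) +i* atan (Im zeta / Re zeta).

Definition cpow zeta z : R[i] := cexp (z * cln zeta).

Definition cintegral d (T : measurableType d)
    (mu : {measure set T -> \bar R}) (D : set T) (f : T -> R[i]) : R[i] :=
  (\int[mu]_(x in D) Re (f x)) +i* (\int[mu]_(x in D) Im (f x)).

(* Euler's integral, valid for Re z > 0. *)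
Definition cGamma z : R[i] :=
  cintegral lebesgue_measure `]0, +oo[
    (fun t : R => cpow t%:C (z - 1) * (expR (- t))%:C).

End ComplexFunctions.

Section Measures.
Variables (R : realType) (N : nat).
Local Notation U := (unitary R N).
Implicit Types (u : U) (s z w : R[i]).

Definition is_haar (h : probability U R) : Prop :=
  forall (a b : U) (A : set U), measurable A ->
    h ((fun x => a * x * b)%g @^-1` A) = h A.

Definition unitary' : set U := [set u | ~~ eigenvalue (val u) (-1)].

(* Eigenvalues with multiplicity: the roots of the characteristic polynomial. *)
Definition eigenvalues u : seq R[i] :=
  sval (closed_field_poly_normal (char_poly (val u))).

Definition f_zw z w u : R[i] :=
  \prod_(e <- eigenvalues u) (cpow (1 + e) z * cpow (1 + e^*) w).

Definition norm_const s : R[i] :=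
  \prod_(1 <= k < N.+1)
    (cGamma k%:R * cGamma (k%:R + s + s^*) /
     (cGamma (k%:R + s) * cGamma (k%:R + s^*))).

(* norm_const s is a positive real number when Re s > -1/2, so taking its real
   part only changes the type. *)
Definition density s u : R :=
  if u \in unitary'
  then (Re (norm_const s))^-1 *
    normc (\prod_(e <- eigenvalues u) cpow (1 + e) s) ^+ 2
  else 0.

Definition mu_N (h : probability U R) s (A : set U) : \bar R :=
  (\int[h]_(u in A) (density s u)%:E)%E.

End Measures.

Definition is_mu_s (R : realType) (h : forall N, probability (unitary R N) R)
    (s : R[i]) (mu : probability (virtual_unitary R) R) : Prop :=
  forall N (A : set (unitary R N)), measurable A ->
    mu (@pi_ R N @^-1` A) = mu_N (h N) s A.


Section Multiplier.
Variable R : realType.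
Implicit Types (x : virtual_unitary R) (g : Ginf R) (z w c : R[i]).

Definition virtual_unitary' : set (virtual_unitary R) :=
  [set x | forall N, pi_ N x \in @unitary' R N].

Definition multiplier_ratio z w x g (N : nat) : R[i] :=
  f_zw z w (pi_ N (act x g)) / f_zw z w (pi_ N x).

(* The stable value of the ratio, and 0 outside of the domain of definition. *)
Definition multiplier z w x g : R[i] :=
  xget 0 [set c | [/\ virtual_unitary' x, virtual_unitary' (act x g) &
                      \forall N \near \oo, multiplier_ratio z w x g N = c]].

End Multiplier.

Section L2.
Context d (T : measurableType d) (R : realType).
Variable mu : {measure set T -> \bar R}.


Definition L2_pred : {pred T -> R[i]} := fun f : T -> R[i] =>
  `[< [/\ measurable_fun setT (fun x => Re (f x)),
          measurable_fun setT (fun x => Im (f x)) &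
          (\int[mu]_x (normc (f x) ^+ 2)%:E < +oo)%E ] >].

Lemma sqr_normc (c : R[i]) : normc c ^+ 2 = Re c ^+ 2 + Im c ^+ 2.
Proof. by case: c => a b /=; rewrite sqr_sqrtr// addr_ge0// sqr_ge0. Qed.

Lemma measurable_sqr_normc (f : T -> R[i]) : measurable_fun setT (fun x => Re (f x)) ->
  measurable_fun setT (fun x => Im (f x)) ->
  measurable_fun setT (fun x => (normc (f x) ^+ 2)%:E : \bar R).
Proof.
move=> mr mi; apply/measurable_EFinP; under eq_fun do rewrite sqr_normc.
by apply: measurable_funD; apply: measurable_funX.
Qed.

Lemma L2_pred_submod_closed : submod_closed L2_pred.
Proof.
split=> [|a f g /asboolP[rf if_ sf] /asboolP[rg ig sg]]; apply/asboolP.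
  split; [exact: measurable_cst|exact: measurable_cst|].
  under eq_integral do rewrite sqr_normc /= expr0n addr0.
  by rewrite integral0.
have eRe x : Re ((a *: f + g) x) = Re a * Re (f x) - Im a * Im (f x) + Re (g x).
  rewrite -[(a *: f + g) x]/(a * f x + g x).
  by case: (f x) (g x) a => ? ? [? ?] [? ?].
have eIm x : Im ((a *: f + g) x) = Re a * Im (f x) + Im a * Re (f x) + Im (g x).
  rewrite -[(a *: f + g) x]/(a * f x + g x).
  by case: (f x) (g x) a {eRe} => ? ? [? ?] [? ?].
have mr : measurable_fun setT (fun x => Re ((a *: f + g) x)).
  under eq_fun do rewrite eRe.
  apply: measurable_funD => //; apply: measurable_funB;
  by apply: measurable_funM => //; exact: measurable_cst.
have mi : measurable_fun setT (fun x => Im ((a *: f + g) x)).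
  under eq_fun do rewrite eIm.
  apply: measurable_funD => //; apply: measurable_funD;
  by apply: measurable_funM => //; exact: measurable_cst.
split=> //.
pose k : R := 2 * normc a ^+ 2.
have k0 : 0 <= k by rewrite mulr_ge0// sqr_ge0.
apply: (@le_lt_trans _ _ (\int[mu]_x (k%:E * (normc (f x) ^+ 2)%:E +
    2%:E * (normc (g x) ^+ 2)%:E))%E).
  apply: ge0_le_integral => //.
  - by move=> x _; rewrite lee_fin sqr_ge0.
  - exact: measurable_sqr_normc.
  - by apply: emeasurable_funD; apply: emeasurable_funM;
      [exact: measurable_cst|exact: measurable_sqr_normc|
       exact: measurable_cst|exact: measurable_sqr_normc].
  - move=> x _; rewrite -!EFinM -EFinD lee_fin !sqr_normc eRe eIm /k sqr_normc.
    have := sqr_ge0 (Re a * Re (f x) - Im a * Im (f x) - Re (g x)).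
    have := sqr_ge0 (Re a * Im (f x) + Im a * Re (f x) - Im (g x)).
    set p := Re a; set q := Im a; set u := Re (f x); set v := Im (f x).
    nra.
rewrite ge0_integralD//; last 4 first.
- by move=> x _; rewrite mule_ge0// lee_fin// sqr_ge0.
- by apply: emeasurable_funM; [exact: measurable_cst|exact: measurable_sqr_normc].
- by move=> x _; rewrite mule_ge0// lee_fin// sqr_ge0.
- by apply: emeasurable_funM; [exact: measurable_cst|exact: measurable_sqr_normc].
rewrite !ge0_integralZl//; do ?[exact: measurable_sqr_normc
  | by move=> x _; rewrite lee_fin sqr_ge0 | by rewrite lee_fin].
by apply: lte_add_pinfty; apply: lte_mul_pinfty; rewrite ?lee_fin.
Qed.

HB.instance Definition _ :=
  GRing.isSubmodClosed.Build _ _ L2_pred L2_pred_submod_closed.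

Definition L2fun : Type := {f : T -> R[i] | f \in L2_pred}.

HB.instance Definition _ := SubChoice.copy L2fun {f : T -> R[i] | f \in L2_pred}.
HB.instance Definition _ := [SubChoice_isSubLmodule of L2fun by <:].

Definition L2_null : {pred L2fun} := fun f : L2fun =>
  `[< {ae mu, forall x, val f x = 0} >].

Lemma L2_null_submod_closed : submod_closed L2_null.
Proof.
split=> [|a f g /asboolP f0 /asboolP g0]; apply/asboolP; first exact: aeW.
apply: filterS2 f0 g0 => x fx gx.
by rewrite linearP -[LHS]/(a * val f x + val g x) fx gx mulr0 addr0.
Qed.

HB.instance Definition _ :=
  GRing.isSubmodClosed.Build _ _ L2_null L2_null_submod_closed.

Definition L2 : Type := Quotient.quot L2_null.
HB.instance Definition _ := EqQuotient.on L2.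
HB.instance Definition _ := Choice.on L2.
HB.instance Definition _ := GRing.Zmodule.on L2.

Definition L2_class (f : L2fun) : L2 := (\pi_L2 f)%qT.
Definition L2_fun (f : L2) : T -> R[i] := val (repr f).

Lemma L2_classP (f g : L2fun) :
  L2_class f = L2_class g <-> {ae mu, forall x, val f x = val g x}.
Proof.
split=> [/eqP|h].
  rewrite -Quotient.idealrBE => /asboolP; apply: filterS => x.
  by rewrite raddfB -[_ x]/(val f x - val g x) => /eqP; rewrite subr_eq0 => /eqP.
apply/eqP; rewrite -Quotient.idealrBE; apply/asboolP; apply: filterS h => x fg.
by rewrite raddfB -[LHS]/(val f x - val g x) fg subrr.
Qed.

Lemma L2_classK (f : L2) : L2_class (repr f) = f.
Proof. exact: reprK. Qed.

Lemma L2_classD (f g : L2fun) : L2_class (f + g) = L2_class f + L2_class g.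
Proof. by rewrite /L2_class !piE. Qed.

Definition L2_scale (a : R[i]) (f : L2) : L2 := L2_class (a *: repr f).

Lemma L2_scale_class a (f : L2fun) : L2_scale a (L2_class f) = L2_class (a *: f).
Proof.
apply/L2_classP; have /L2_classP := L2_classK (L2_class f).
apply: filterS => x e.
by rewrite !linearZ -[LHS]/(a * val (repr (L2_class f)) x) e.
Qed.

Lemma L2_scaleA a b f : L2_scale a (L2_scale b f) = L2_scale (a * b) f.
Proof. by rewrite -[f]L2_classK !L2_scale_class scalerA. Qed.
Lemma L2_scale1 : left_id 1 L2_scale.
Proof. by move=> f; rewrite -[f]L2_classK L2_scale_class scale1r. Qed.
Lemma L2_scaleDr : right_distributive L2_scale +%R.
Proof.
move=> a f g; rewrite -[f]L2_classK -[g]L2_classK -L2_classD !L2_scale_class.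
by rewrite scalerDr L2_classD.
Qed.
Lemma L2_scaleDl f : {morph L2_scale^~ f : a b / a + b}.
Proof. by move=> a b; rewrite -[f]L2_classK !L2_scale_class scalerDl L2_classD. Qed.

HB.instance Definition _ := GRing.Zmodule_isLmodule.Build R[i] L2
  L2_scaleA L2_scale1 L2_scaleDr L2_scaleDl.

(* Linear in the first variable; complex conjugation is on the second one. *)
Definition L2_dot (f g : L2) : R[i] :=
  cintegral mu setT (fun x => L2_fun f x * (L2_fun g x)^*).

Definition L2_norm (f : L2) : R := Num.sqrt (Re (L2_dot f f)).

End L2.

Lemma L2_cst_subproof d (T : measurableType d) (R : realType)
  (mu : probability T R) (c : R[i]) : cst c \in L2_pred mu.
Proof.
apply/asboolP; split; [exact: measurable_cst|exact: measurable_cst|].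
have := integral_cst mu measurableT (normc c ^+ 2)%:E; rewrite /cst /= => ->.
by rewrite probability_setT mule1 ltry.
Qed.

Definition L2_cst d (T : measurableType d) (R : realType)
  (mu : probability T R) (c : R[i]) : L2 mu := 
  L2_class (exist (fun f : T -> R[i] => f \in L2_pred mu) _ (L2_cst_subproof mu c)).

Section UnitaryRepresentation.
Context d (X : measurableType d) (R : realType) (mu : {measure set X -> \bar R}).
Local Notation H := (L2 mu).

Definition is_unitary_operator (A : H -> H) : Prop :=
  [/\ linear A, forall f g, L2_dot (A f) (A g) = L2_dot f g
    & forall g, exists f, A f = g].

(* Unitary representations are required to be strongly continuous. *)
Definition is_unitary_representation (T : Ginf R -> H -> H) : Prop :=
  [/\ forall g, is_unitary_operator (T g),
      forall f, T 1%g f = f,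
      forall g h f, T (g * h)%g f = T g (T h f)
    & forall f g0, L2_norm (T g f - T g0 f) @[g --> g0] --> (0 : R)].

End UnitaryRepresentation.

(* Main.v *)
(* The last entry of a unitary matrix u and its projection p_N(u) are the pivot and
   the Schur complement of 1 + u, shifted by 1. Hence, for x in the space of virtual
   unitary matrices, det (1 + x_N) is the product of the factors 1 + (x_k)_kk for
   k <= N, and a deformation of x_N to 0 shows that the same holds for the chosen
   branches of the logarithm, so f_{z,w|N}(x_N) is the product over k <= N of
   (1 + d)^z (1 + conj d)^w at d = (x_k)_kk. The group G(N) does not move (x_k)_kk
   for k > N, so the ratios defining the multiplier stabilise. As |f_{z,w|N}|^2 is
   proportional to the density of mu^(s)_N, the measure lam_N = |f_{z,w|N}|^-2 mu^(s)
   on virtual unitary matrices is finite and, by invariance of the Haar measures,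
   G(N)-invariant; f |-> f * f_{z,w|N} carries T restricted to G(N) to the
   translation representation on L^2(lam_N). Unitarity follows, and so does strong
   continuity on G(N), because for every Borel set A the measure of A \ g^-1 A tends
   to 0 as g tends to 1: such sets A form a sigma-algebra and cylinders over open
   sets belong to it. *)
From HB Require Import structures.
Require Import Defs.
From mathcomp Require Import all_boot all_order all_algebra.
From mathcomp Require Import spectral sesquilinear.
From mathcomp Require Import all_classical all_reals all_analysis.
From mathcomp Require Import measurable_realfun ring lra.
From mathcomp Require Import complex.

Set Implicit Arguments.
Unset Strict Implicit.
Unset Printing Implicit Defensive.

Import Order.TTheory GRing.Theory Num.Theory.
Import numFieldNormedType.Exports.
Import ComplexField.Normc HBSimple HBNNSimple.

Local Open Scope classical_set_scope.
Local Open Scope complex_scope.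
Local Open Scope sesquilinear_scope.
Local Open Scope ring_scope.

Local Notation Re := complex.Re.
Local Notation Im := complex.Im.

(** * Complex exponentials and logarithms *)

(** The branch of the powers is fixed eigenvalue by eigenvalue, whereas only the pivots behave well
    under the projections, and an identity of determinants leaves an ambiguity of 2 pi i in the
    logarithms. What removes it is strict positivity of the real part of the quadratic form of 1 + t
    u for t in [0, 1]: it puts all eigenvalues and all pivots into the right half-plane, and it
    passes to Schur complements. The product [pf] over the pivots vanishes nowhere, even where the
    logarithm takes a default value, so one may always divide by it; the price is that its squared
    modulus is proportional to the density only off a set that has to be shown Haar null. Invariance
    of lam_N comes from comparing levels: at a level M >= N its density with respect to Haar measure
    is a constant times the squared modulus of the pivot factors of levels N + 1 to M, and these
    factors are fixed by G(N). The sign of the constant is read off from the total mass 1. Passing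
    from the groups G(N) to G needs care, as G carries the product of two inductive limit
    topologies; each factor is therefore treated by itself. *)

Section ComplexExp.
Variable R : realType.
Implicit Types x y z w : R[i].

Lemma ReM x y : Re (x * y) = Re x * Re y - Im x * Im y.
Proof. by case: x y => ? ? [? ?]. Qed.
Lemma ImM x y : Im (x * y) = Re x * Im y + Im x * Re y.
Proof. by case: x y => ? ? [? ?]. Qed.
Lemma ReD x y : Re (x + y) = Re x + Re y.
Proof. by case: x y => ? ? [? ?]. Qed.
Lemma ImD x y : Im (x + y) = Im x + Im y.
Proof. by case: x y => ? ? [? ?]. Qed.
Lemma ReN x : Re (- x) = - Re x. Proof. by case: x. Qed.
Lemma ImN x : Im (- x) = - Im x. Proof. by case: x. Qed.
Lemma conjcE x : Num.conj x = (Re x) -i* (Im x).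
Proof. by case: x. Qed.
Lemma ReJ x : Re (Num.conj x) = Re x. Proof. by rewrite conjcE. Qed.
Lemma ImJ x : Im (Num.conj x) = - Im x. Proof. by rewrite conjcE. Qed.
Lemma ReV x : Re x^-1 = Re x / (Re x ^+ 2 + Im x ^+ 2).
Proof. by case: x. Qed.
Lemma ImV x : Im x^-1 = - (Im x / (Re x ^+ 2 + Im x ^+ 2)).
Proof. by case: x. Qed.
Lemma eqC x y : Re x = Re y -> Im x = Im y -> x = y.
Proof. by case: x y => ? ? [? ?] /= -> ->. Qed.
Lemma Re_sum (I : Type) (r : seq I) (P : pred I) (F : I -> R[i]) :
  Re (\sum_(i <- r | P i) F i) = \sum_(i <- r | P i) Re (F i).
Proof. by elim/big_rec2: _ => //= i y1 y2 _ <-; rewrite ReD. Qed.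
Lemma Im_sum (I : Type) (r : seq I) (P : pred I) (F : I -> R[i]) :
  Im (\sum_(i <- r | P i) F i) = \sum_(i <- r | P i) Im (F i).
Proof. by elim/big_rec2: _ => //= i y1 y2 _ <-; rewrite ImD. Qed.
Lemma normcJ x : normc (Num.conj x) = normc x.
Proof. by rewrite conjcE; case: x => a b /=; rewrite sqrrN. Qed.

Lemma cexpD z w : cexp (z + w) = cexp z * cexp w.
Proof.
by apply: eqC; rewrite /cexp ?ReM ?ImM /= ReD ImD expRD ?cosD ?sinD; ring.
Qed.

Lemma cexp0 : cexp (0 : R[i]) = 1.
Proof. by apply: eqC; rewrite /cexp /= expR0 ?cos0 ?sin0 ?mulr1 ?mulr0. Qed.

Lemma cexp_sum (I : Type) (r : seq I) (F : I -> R[i]) :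
  cexp (\sum_(i <- r) F i) = \prod_(i <- r) cexp (F i).
Proof. exact: (big_morph _ cexpD cexp0). Qed.

Lemma normc_cexp z : normc (cexp z) = expR (Re z).
Proof.
rewrite /cexp /= !exprMn -mulrDr cos2Dsin2 mulr1 sqrtr_sqr ger0_norm// expR_ge0.
Qed.

Lemma cexp_neq0 z : cexp z != 0.
Proof.
apply/eqP => z0; have := expR_gt0 (Re z).
by rewrite -normc_cexp z0 normc0 ltxx.
Qed.

Lemma cexp_conj z : cexp (Num.conj z) = Num.conj (cexp z).
Proof. by rewrite [RHS]conjcE /cexp ReJ ImJ /= cosN sinN mulrN. Qed.

Lemma cln_conj z : cln (Num.conj z) = Num.conj (cln z).
Proof. by rewrite [RHS]conjcE /cln ReJ ImJ normcJ /= mulNr atanN. Qed.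

Lemma normc_gt0 x : x != 0 -> 0 < normc x.
Proof.
move=> x0; rewrite lt_def; apply/andP; split; last by case: (x) => a b /=; exact: sqrtr_ge0.
by apply: contraNneq x0 => /eq0_normc ->.
Qed.

Lemma normc_ge0 x : 0 <= normc x.
Proof. by case: x => a b /=; exact: sqrtr_ge0. Qed.

(** On the right half-plane the angle atan (Im z / Re z) has positive cosine, and |z| times this
    cosine equals Re z because both are nonnegative with the same square. *)
Lemma cexp_cln z : 0 < Re z -> cexp (cln z) = z.
Proof.
move=> z0; have nz : 0 < normc z.
  by apply: normc_gt0; apply: contraTneq z0 => ->; rewrite ltxx.
have r0 := lt0r_neq0 z0.
have h : 0 < cos (atan (Im z / Re z)) by rewrite cos_atan invr_gt0 sqrtr_gt0 ltr_pwDl ?sqr_ge0.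
have t := atanK (Im z / Re z).
have ts : sin (atan (Im z / Re z)) = cos (atan (Im z / Re z)) * (Im z / Re z).
  by move: t; rewrite /tan => /(canRL (divfK (lt0r_neq0 h))) {1}->; rewrite mulrC.
have e : normc z * cos (atan (Im z / Re z)) = Re z.
  apply/eqP; rewrite -(@eqrXn2 _ 2)//; last 2 first.
  - by rewrite mulr_ge0// ltW.
  - exact: ltW.
  have := cos2Dsin2 (atan (Im z / Re z)); rewrite ts !exprMn.
  rewrite (Defs.sqr_normc z) => c.
  have -> : Re z ^+ 2 + Im z ^+ 2 = Re z ^+ 2 * (1 + (Im z / Re z) ^+ 2) by field.
  apply/eqP; rewrite -mulrA [X in _ * X](_ : _ = 1) ?mulr1//.
  by rewrite -[RHS]c; rewrite exprMn; ring.
apply: eqC; rewrite /cexp /= lnK ?posrE//.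
by rewrite ts mulrA e mulrCA divff// mulr1.
Qed.

End ComplexExp.

(** * Schur complements and the logarithm of a determinant *)

Section Pivots.
Variable R : realType.
Local Notation C := R[i].

Definition schur N (M : 'M[C]_N.+1) : 'M[C]_N :=
  row' ord_max (col' ord_max M) - (M ord_max ord_max)^-1 *:
    (row' ord_max (col ord_max M) *m col' ord_max (row ord_max M)).

Lemma schurE N (M : 'M[C]_N.+1) i j : schur M i j =
  M (lift ord_max i) (lift ord_max j) -
  (M ord_max ord_max)^-1 * (M (lift ord_max i) ord_max * M ord_max (lift ord_max j)).
Proof. by rewrite !mxE big_ord1 !mxE. Qed.

Lemma schur_proj N (X : 'M[C]_N.+1) :
  schur (1%:M + X) = 1%:M + proj_mx_last X.
Proof.
apply/matrixP => i j; rewrite schurE [RHS]mxE proj_mx_lastE !mxE eqxx.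
have lm k : (ord_max == lift ord_max k :> 'I_N.+1) = false by exact/negbTE/neq_lift.
rewrite (inj_eq lift_inj) [_ == ord_max]eq_sym !lm !add0r.
have [->|_] := eqVneq (X ord_max ord_max) (-1); last by rewrite addrA.
(* The pivot is 0 here, and the convention [0^-1 = 0] agrees with the default value A of the
   projection. *)
by rewrite subrr invr0 mul0r addrA.
Qed.

Lemma det_schur N (M : 'M[C]_N.+1) : M ord_max ord_max != 0 ->
  \det M = M ord_max ord_max * \det (schur M).
Proof.
move=> d0.
(* Right multiplication by [E] subtracts from each other column the multiple of the last column that
   clears its entry in the last row; the remaining block is the Schur complement. *)
pose E := \matrix_(i < N.+1, j < N.+1) ((i == j)%:R -
  ((i == ord_max) && (j != ord_max))%:R * ((M ord_max ord_max)^-1 * M ord_max j)).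
have trE : is_trig_mx E.
  apply/is_trig_mxP => i j ij; rewrite mxE.
  have -> : (i == j) = false by apply/eqP => e; rewrite e ltnn in ij.
  have -> : (i == ord_max) = false.
    by apply/eqP => e; move: ij; rewrite e ltnNge -ltnS ltn_ord.
  by rewrite mul0r subrr.
have dE : \det E = 1.
  rewrite det_trig// big1// => i _; rewrite mxE eqxx.
  by case: eqP => [->|_]; rewrite ?eqxx ?andbF ?mul0r subr0.
have ME i j : (M *m E) i j =
    M i j - (j != ord_max)%:R * (M i ord_max * ((M ord_max ord_max)^-1 * M ord_max j)).
  rewrite mxE; under eq_bigr do rewrite mxE mulrBr.
  rewrite sumrB; congr (_ - _).
    rewrite (bigD1 j)//= eqxx mulr1 big1 ?addr0// => k kj.
    by rewrite (negbTE kj) mulr0.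
  rewrite (bigD1 ord_max)//= eqxx big1 ?addr0 => [|k kj]; last by rewrite (negbTE kj) mul0r mulr0.
  by rewrite mulrCA.
rewrite -[LHS]mulr1 -dE -det_mulmx (expand_det_row _ ord_max) (bigD1 ord_max)//=.
rewrite big1 ?addr0 => [|j jm]; last first.
  by rewrite ME jm mul1r mulVKf// subrr mul0r.
rewrite ME eqxx mul0r subr0; congr (_ * _).
rewrite /cofactor -signr_odd addnn odd_double mul1r; congr (\det _).
apply/matrixP => i j; rewrite mxE mxE ME schurE.
by rewrite eq_sym neq_lift mul1r mulrCA.
Qed.

(** Strict positivity of the Hermitian part. It forces the last pivot into the right half-plane and,
    unlike a condition on the determinant, survives elimination. *)
Definition accretive N (M : 'M[C]_N) : Prop :=
  forall v : 'rV[C]_N, v != 0 -> 0 < Re ((v *m M *m v^t*) 0 0).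

Lemma accretive_last N (M : 'M[C]_N.+1) : accretive M -> 0 < Re (M ord_max ord_max).
Proof.
move=> aM; pose v : 'rV[C]_N.+1 := delta_mx 0 ord_max.
have v0 : v != 0.
  by apply/eqP => /matrixP/(_ 0 ord_max)/eqP; rewrite !mxE !eqxx oner_eq0.
have := aM v v0; rewrite (_ : (_ *m _) 0 0 = M ord_max ord_max)//.
rewrite -rowE mxE (bigD1 ord_max)//= big1 ?addr0 => [|k kj].
  by rewrite !mxE !eqxx rmorph1 mulr1.
by rewrite !mxE (negbTE kj) andbF rmorph0 mulr0.
Qed.

(* The Schur complement is a compression of M to the graph of -B/d. *)
Lemma accretive_schur N (M : 'M[C]_N.+1) : accretive M -> accretive (schur M).
Proof.
move=> aM v v0; have d0 := accretive_last aM.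
have {}d0 : M ord_max ord_max != 0 by apply: contraTneq d0 => ->; rewrite ltxx.
pose y := - (\sum_i v 0 i * M (lift ord_max i) ord_max) / M ord_max ord_max.
pose x : 'rV[C]_N.+1 := \row_j (if unlift ord_max j is Some i then v 0 i else y).
have xl i : x 0 (lift ord_max i) = v 0 i by rewrite mxE liftK.
have xm : x 0 ord_max = y by rewrite mxE unlift_none.
have x0 : x != 0.
  apply: contraNneq v0 => x0; apply/eqP/matrixP => i j.
  by rewrite ord1 -xl x0 !mxE.
have xMm : (x *m M) 0 ord_max = 0.
  rewrite mxE big_lift_last xm /y divfK//.
  by under eq_bigr do rewrite xl; rewrite subrr.
have xMl j : (x *m M) 0 (lift ord_max j) = (v *m schur M) 0 j.
  rewrite !mxE big_lift_last xm /y -mulrA mulNr mulr_suml -sumrB.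
  by apply: eq_bigr => i _; rewrite xl schurE; ring.
have := aM x x0; congr (0 < Re _).
rewrite mxE [RHS]mxE big_lift_last xMm mul0r addr0; apply: eq_bigr => j _.
by rewrite xMl; congr (_ * _); rewrite !mxE liftK.
Qed.

(** A logarithm of the determinant, summed over the successive pivots. For 1 + u these pivots are 1
    plus the last entries of the successive projections of u. *)
Fixpoint plog N : 'M[C]_N -> C :=
  if N is N'.+1 then fun M => cln (M ord_max ord_max) + plog (schur M)
  else fun=> 0.

Lemma cexp_plog N (M : 'M[C]_N) : accretive M -> cexp (plog M) = \det M.
Proof.
elim: N M => [|N IH] M aM; first by rewrite cexp0 det_mx00.
have d0 := accretive_last aM.
rewrite /= cexpD cexp_cln// IH ?det_schur//; last exact: accretive_schur.
by apply: contraTneq d0 => ->; rewrite ltxx.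
Qed.

Lemma Re_mulmx_adj N (v : 'rV[C]_N) :
  Re ((v *m v^t*) 0 0) = \sum_j (Re (v 0 j) ^+ 2 + Im (v 0 j) ^+ 2).
Proof.
rewrite mxE Re_sum; apply: eq_bigr => j _.
by rewrite !mxE ReM ReJ ImJ; ring.
Qed.

Lemma accretive1 N : accretive (1%:M : 'M[C]_N).
Proof.
move=> v v0; rewrite mulmx1 Re_mulmx_adj lt_neqAle sumr_ge0 ?andbT; last first.
  by move=> j _; rewrite addr_ge0// sqr_ge0.
apply: contra v0; rewrite eq_sym psumr_eq0; last first.
  by move=> j _; rewrite addr_ge0// sqr_ge0.
move=> /allP h; apply/eqP/matrixP => i j; rewrite ord1 mxE.
have /= := h j (mem_index_enum _); rewrite paddr_eq0 ?sqr_ge0// !sqrf_eq0.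
by move=> /andP[/eqP r /eqP i']; exact: eqC.
Qed.

Lemma accretive_add1 N (u : unitary R N) (c : R) : u \in @unitary' R N ->
  0 <= c <= 1 -> accretive (1%:M + c%:C *: val u).
Proof.
move=> /set_mem u' /andP[c0 c1] v v0.
set U := val u; set q := v + v *m U.
have q0 : q != 0.
  apply: contra u' => /eqP q0; apply/eigenvalueP; exists v => //.
  by apply/eqP; rewrite scaleN1r -addr_eq0 addrC -/q q0.
have vv := accretive1 v0; have qq := accretive1 q0.
rewrite mulmx1 in vv; rewrite mulmx1 in qq.
have E : Re ((q *m q^t*) 0 0) = Re ((v *m v^t*) 0 0) *+ 2 + Re ((v *m U *m v^t*) 0 0) *+ 2.
  have -> : q *m q^t* = (v *m v^t*) + (v *m U *m v^t*) + (v *m U *m v^t*)^t* + v *m v^t*.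
    rewrite /q linearD/= map_mxD mulmxDr !mulmxDl !trmx_mul !map_mxM/= !trmxCK.
    rewrite (_ : v *m U *m (U^t* *m v^t*) = v *m v^t*) ?addrA ?mulmxA//.
    by rewrite -(mulmxA v U) (unitarymxP (valP u)) mulmx1.
  rewrite mxE ReD mxE ReD mxE ReD [in X in _ + _ + X + _]mxE [in X in _ + _ + X + _]mxE ReJ !mulr2n.
  by ring.
rewrite mulmxDr mulmxDl mulmx1 -scalemxAr -scalemxAl mxE ReD [in X in _ + X]mxE ReM /= mul0r subr0.
have [c1'|c1'] := eqVneq c 1; first by rewrite c1' mul1r; lra.
have : 0 <= c * (Re ((v *m v^t*) 0 0) + Re ((v *m U *m v^t*) 0 0)) by rewrite mulr_ge0//; lra.
have : 0 < (1 - c) * Re ((v *m v^t*) 0 0) by rewrite mulr_gt0// subr_gt0 lt_neqAle c1' c1.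
lra.
Qed.

Definition ccont (f : R -> C) :=
  continuous (fun t => Re (f t)) /\ continuous (fun t => Im (f t)).

Lemma ccont_cst c : ccont (fun=> c).
Proof. by split => t; exact: cvg_cst. Qed.
Lemma ccontD f g : ccont f -> ccont g -> ccont (fun t => f t + g t).
Proof.
move=> [fr fi] [gr gi]; split => t.
  by under eq_fun do rewrite ReD; exact: cvgD (fr t) (gr t).
by under eq_fun do rewrite ImD; exact: cvgD (fi t) (gi t).
Qed.
Lemma ccontN f : ccont f -> ccont (fun t => - f t).
Proof.
move=> [fr fi]; split => t.
  by under eq_fun do rewrite ReN; exact: cvgN (fr t).
by under eq_fun do rewrite ImN; exact: cvgN (fi t).
Qed.
Lemma ccontM f g : ccont f -> ccont g -> ccont (fun t => f t * g t).
Proof.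
move=> [fr fi] [gr gi]; split => t.
  by under eq_fun do rewrite ReM; exact: cvgB (cvgM (fr t) (gr t)) (cvgM (fi t) (gi t)).
by under eq_fun do rewrite ImM; exact: cvgD (cvgM (fr t) (gi t)) (cvgM (fi t) (gr t)).
Qed.

Lemma sqr_ReIm_gt0 (x : C) : 0 < Re x -> 0 < Re x ^+ 2 + Im x ^+ 2.
Proof. by move=> x0; rewrite ltr_pwDl ?sqr_ge0// exprn_gt0. Qed.

Lemma ccontV f : ccont f -> (forall t, 0 < Re (f t)) -> ccont (fun t => (f t)^-1).
Proof.
move=> [fr fi] f0.
have s t : (fun x => Re (f x) ^+ 2 + Im (f x) ^+ 2) x @[x --> t] -->
    Re (f t) ^+ 2 + Im (f t) ^+ 2.
  by apply: cvgD; under eq_fun do rewrite expr2; rewrite expr2; apply: cvgM; do ?[exact: fr|exact: fi].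
have s0 t := lt0r_neq0 (sqr_ReIm_gt0 (f0 t)).
split => t.
  by (under eq_fun do rewrite ReV); exact: cvgM (fr t) (cvgV (s0 t) (s t)).
by (under eq_fun do rewrite ImV); apply: cvgN; exact: cvgM (fi t) (cvgV (s0 t) (s t)).
Qed.

(** Only imaginary parts of logarithms are followed along the deformation: equality of the
    exponentials already determines the real parts. *)
Lemma Im_cln_continuous f : ccont f -> (forall t, 0 < Re (f t)) ->
  continuous (fun t => Im (cln (f t))).
Proof.
move=> [fr fi] f0 t.
apply: (@continuous_comp _ _ _ (fun t => Im (f t) / Re (f t)) (@atan R)).
  exact: cvgM (fi t) (cvgV (lt0r_neq0 (f0 t)) (fr t)).
exact: continuous_atan.
Qed.

Lemma Im_plog_continuous N (M : R -> 'M[C]_N) :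
  (forall i j, ccont (fun t => M t i j)) -> (forall t, accretive (M t)) ->
  continuous (fun t => Im (plog (M t))).
Proof.
elim: N M => [|N IH] M cM aM; first by move=> t; exact: cvg_cst.
move=> t; rewrite /=; (under eq_fun do rewrite ImD).
apply: cvgD.
  by apply: Im_cln_continuous => // t'; exact: accretive_last.
apply: IH => [i j|t']; last exact: accretive_schur.
have -> : (fun t => schur (M t) i j) = (fun t =>
  M t (lift ord_max i) (lift ord_max j) + - ((M t ord_max ord_max)^-1 *
   (M t (lift ord_max i) ord_max * M t ord_max (lift ord_max j)))).
  by apply/funext => x; rewrite schurE.
apply: ccontD => //; apply/ccontN/ccontM; last exact: ccontM.
by apply: ccontV => // t'; exact: accretive_last.
Qed.

End Pivots.

(** * Eigenvalue products as products over pivots *)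

Section LogDet.
Variable R : realType.
Local Notation C := R[i].

Lemma horner_char_poly (F : comNzRingType) n (A : 'M[F]_n) x :
  (char_poly A).[x] = \det (x%:M - A).
Proof.
rewrite -[LHS]/(horner_eval x (char_poly A)) -det_map_mx; congr (\det _).
apply/matrixP => i j; rewrite !mxE rmorphB/= /horner_eval !hornerE.
by rewrite hornerMn hornerX.
Qed.

Lemma unitary'E N (u : unitary R N) :
  @unitary' R N u <-> \det (1%:M + val u) != 0.
Proof.
rewrite /unitary' /= eigenvalue_root_char /root horner_char_poly.
rewrite (_ : _ - _ = - (1%:M + val u)); last by rewrite opprD raddfN.
by rewrite -scaleN1r detZ mulf_eq0 negb_or signr_eq0.
Qed.

Lemma char_poly_eigenvalues N (u : unitary R N) :
  char_poly (val u) = \prod_(e <- eigenvalues u) ('X - e%:P).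
Proof.
rewrite /eigenvalues; case: closed_field_poly_normal => r /= {1}->.
by rewrite (monicP (char_poly_monic _)) scale1r.
Qed.

Lemma size_eigenvalues N (u : unitary R N) : size (eigenvalues u) = N.
Proof.
have := size_char_poly (val u); rewrite char_poly_eigenvalues size_prod_XsubC.
by case.
Qed.

Lemma det_add1 N (u : unitary R N) (c : C) :
  \det (1%:M + c *: val u) = \prod_(e <- eigenvalues u) (1 + c * e).
Proof.
have [->|c0] := eqVneq c 0.
  by rewrite scale0r addr0 det1 big1// => e _; rewrite mul0r addr0.
have -> : 1%:M + c *: val u = (- c) *: ((- c^-1)%:M - val u).
  by rewrite scalerBr scale_scalar_mx mulrNN mulfV// scaleNr opprK.
rewrite detZ -horner_char_poly char_poly_eigenvalues horner_prod.
have -> : (- c) ^+ N = \prod_(e <- eigenvalues u) (- c).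
  by rewrite big_const_seq count_predT size_eigenvalues iter_mulr_1.
rewrite -big_split/=; apply: eq_bigr => e _; rewrite !hornerE.
by rewrite mulrBr mulrNN mulfV// mulNr opprK.
Qed.

(** At an eigenvector v for e the quadratic form of 1 + c u equals (1 + c e) |v|^2, and |v|^2 is
    real and positive. *)
Lemma accretive_eigenvalue N (u : unitary R N) (c : R) e :
  u \in @unitary' R N -> 0 <= c <= 1 -> e \in eigenvalues u -> 0 < Re (1 + c%:C * e).
Proof.
move=> u' c01 ee.
have : eigenvalue (val u) e.
  by rewrite eigenvalue_root_char char_poly_eigenvalues root_prod_XsubC.
move=> /eigenvalueP[v vu v0].
have := accretive_add1 u' c01 v0.
rewrite mulmxDr mulmx1 -scalemxAr vu scalerA -{1}[v]scale1r -scalerDl -scalemxAl.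
rewrite mxE ReM; have /= := accretive1 v0; rewrite mulmx1 => vv.
have -> : Im ((v *m v^t*) 0 0) = 0.
  rewrite mxE Im_sum big1// => j _.
  by rewrite !mxE ImM ReJ ImJ; ring.
by rewrite mulr0 subr0 pmulr_lgt0.
Qed.

(** The imaginary parts agree modulo 2 pi only; this is recorded as a cosine equal to 1, the form
    used by the continuity argument. *)
Lemma cexp_inj (x y : C) : cexp x = cexp y ->
  Re x = Re y /\ cos (Im x - Im y) = 1.
Proof.
move=> e; have r : Re x = Re y by apply: expR_inj; rewrite -!normc_cexp e.
split=> //; have : cexp (x - y) = 1.
  by rewrite cexpD e -cexpD subrr cexp0.
by move=> /(congr1 (@Re _)); rewrite /cexp /= ReD ReN r subrr expR0 mul1r ImD ImN.
Qed.

Lemma cos_eq1_continuous (f : R -> R) : continuous f ->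
  (forall t, cos (f t) = 1) -> f 0 = 0 -> f 1 = 0.
Proof.
move=> cf f1 f0; apply/eqP; apply: contrapT => /negP n0.
have h1 : 0 < `|f 1| by rewrite normr_gt0.
(* If f 1 were nonzero, |f| would take this value between 0 and 1, an interval on which cos is
   injective, although the cosine there is 1. *)
pose v : R := Num.min `|f 1| 1.
have v0 : 0 < v by rewrite lt_min h1 ltr01.
have [||c _ cv] := @IVT R (fun t => `|f t|) 0 1 v ler01.
- by apply: continuous_subspaceT => x; apply: continuous_comp; [exact: cf|exact: norm_continuous].
- by rewrite f0 normr0 (min_idPl (ltW h1)) (max_idPr (ltW h1)) (ltW v0) ge_min lexx.
have : cos v = 1.
  by rewrite -cv; case: (ger0P (f c)) => _; rewrite ?cosN f1.
have pi1 : 1 <= pi :> R by apply: le_trans (pi_ge2 _); rewrite ler1n.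
rewrite -cos0 => /cos_inj; rewrite !in_itv/= lexx pi_ge0 ltW//=.
rewrite ge_min pi1 orbT.
by move=> /(_ isT isT) vv; move: v0; rewrite vv ltxx.
Qed.

Lemma cln1 : cln (1 : C) = 0.
Proof. by rewrite /cln [normc _]normc1 ln1 mul0r atan0. Qed.

Lemma plog1 N : plog (1%:M : 'M[C]_N) = 0.
Proof.
elim: N => [//|N IH] /=; rewrite mxE eqxx cln1 add0r.
rewrite (_ : schur _ = 1%:M)//; apply/matrixP => i j; rewrite schurE !mxE.
by rewrite (negbTE (neq_lift _ _)) !mulr0 subr0 (inj_eq lift_inj).
Qed.

(* Both sides are logarithms of det (1 + u), and both deform continuously to 0
   along the determinants of 1 + t u. *)
Lemma sum_cln_eigenvalues N (u : unitary R N) : u \in @unitary' R N ->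
  \sum_(e <- eigenvalues u) cln (1 + e) = plog (1%:M + val u).
Proof.
move=> u'.
(* Clamping the parameter to [0, 1] makes both logarithms continuous on all of R, since positivity
   then holds for every t. *)
pose c (t : R) : R := Num.max 0 (Num.min t 1).
have c01 t : 0 <= c t <= 1 by rewrite le_max lexx/= ge_max ler01 ge_min lexx orbT.
have cc : continuous c.
  rewrite (_ : c = (fun t => 2^-1 * (1 + `|t| - `|t - 1|))).
    move=> t; apply: cvgMr; apply: cvgB.
      by apply: cvgD; [exact: cvg_cst|exact: norm_continuous].
    apply: (@continuous_comp _ _ _ (fun t : R => t - 1) (fun t : R => `|t|)).
      by apply: cvgB; [exact: cvg_id|exact: cvg_cst].
    exact: norm_continuous.
  apply/funext => t; rewrite /c; case: (leP t 1) => t1.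
    by rewrite [`|t - 1|]ler0_norm ?subr_le0//; case: (leP 0 t) => t0;
      [rewrite ger0_norm//|rewrite ltr0_norm//]; lra.
  by rewrite [`|t - 1|]ger0_norm ?subr_ge0 ?ltW// ger0_norm ?ltW ?(lt_trans _ t1)//
    (max_idPr ler01); lra.
pose L1 t : C := \sum_(e <- eigenvalues u) cln (1 + (c t)%:C * e).
pose L2 t : C := plog (1%:M + (c t)%:C *: val u).
have L12 t : cexp (L1 t) = cexp (L2 t).
  rewrite cexp_sum cexp_plog; last exact: accretive_add1.
  rewrite det_add1 big_seq [RHS]big_seq; apply: eq_bigr => e ee.
  by rewrite cexp_cln//; exact: (accretive_eigenvalue u' (c01 t) ee).
have cC : ccont (fun t => (c t)%:C) by split=> // t; exact: cvg_cst.
have L1c : continuous (fun t => Im (L1 t)).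
  rewrite (_ : (fun t => _) = (fun t => \sum_(e <- eigenvalues u | e \in eigenvalues u)
      Im (cln (1 + (c t)%:C * e)))).
    move=> t0; apply: cvg_big => [|e ee]; first exact: add_continuous.
    have : continuous (fun t => Im (cln (1 + (c t)%:C * e))); last exact.
    apply: Im_cln_continuous => [|t]; last exact: (accretive_eigenvalue u' (c01 t) ee).
    by apply: ccontD; [exact: ccont_cst|apply: ccontM => //; exact: ccont_cst].
  by apply/funext => t; rewrite Im_sum big_seq.
have L2c : continuous (fun t => Im (L2 t)).
  apply: Im_plog_continuous => [i j|t]; last exact: accretive_add1.
  under eq_fun do rewrite !mxE.
  by apply: ccontD; [exact: ccont_cst|apply: ccontM => //; exact: ccont_cst].
have c0 : c 0 = 0 by rewrite /c (min_idPl ler01) maxxx.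
have c1 : c 1 = 1 by rewrite /c minxx (max_idPr ler01).
have [r _] := cexp_inj (L12 1).
have i : Im (L1 1) - Im (L2 1) = 0.
  apply: (@cos_eq1_continuous (fun t => Im (L1 t) - Im (L2 t))) => [t|t|].
  - by apply: cvgB; [exact: L1c|exact: L2c].
  - by have [] := cexp_inj (L12 t).
  - rewrite /L1 /L2 c0 scale0r addr0 plog1 big1 ?subrr// => e _.
    by rewrite mul0r addr0 cln1.
have : L1 1 = L2 1 by apply: eqC => //; apply/eqP; rewrite -subr_eq0; exact/eqP.
rewrite /L1 /L2 c1 scale1r => <-.
by apply: eq_bigr => e _; rewrite mul1r.
Qed.

Definition lastc N (u : unitary R N.+1) : C := val u ord_max ord_max.

(** That the last entry differs from -1 follows from accretivity of 1 + u, whose last diagonal entry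
    has positive real part. The rest is the factorisation of det (1 + u) by its pivot. *)
Lemma unitary'S N (u : unitary R N.+1) : @unitary' R _ u <->
  lastc u != -1 /\ @unitary' R _ (proj_unitary u).
Proof.
rewrite !unitary'E.
have e : lastc u != -1 -> \det (1%:M + val u) =
    (1 + lastc u) * \det (1%:M + val (proj_unitary u)).
  move=> d; rewrite det_schur ?schur_proj; last by rewrite !mxE eqxx mulr1n addrC addr_eq0.
  by rewrite !mxE eqxx.
split=> [u'|[d]]; last by move=> p; rewrite e// mulf_eq0 negb_or [1 + _]addrC addr_eq0 d.
have d : lastc u != -1.
  have /accretive_last : accretive (1%:M + 1%:C *: val u).
    by apply: accretive_add1; [rewrite inE; exact/unitary'E|rewrite ler01 lexx].
  rewrite scale1r mxE mxE eqxx mulr1n ReD; apply: contraTneq; rewrite /lastc => ->.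
  by rewrite /= subrr ltxx.
by split=> //; move: u'; rewrite e// mulf_eq0 negb_or => /andP[].
Qed.

(** This is (1 + d)^z (1 + conj d)^w. Being written as an exponential it is nonzero for every d,
    including d = -1, where [cln 0] is a default value. *)
Definition cphi (z w d : C) : C := cexp (z * cln (1 + d) + w * Num.conj (cln (1 + d))).

(* The product of the functions cphi over the last entries of the projections of u
   is an everywhere defined, recursive substitute for f_zw. *)
Fixpoint pf (z w : C) N : unitary R N -> C :=
  if N is N'.+1 then fun u => cphi z w (lastc u) * pf z w (proj_unitary u)
  else fun=> 1.

Lemma pf_neq0 z w N (u : unitary R N) : pf z w u != 0.
Proof.
by elim: N u => [|N IH] u /=; rewrite ?oner_neq0// mulf_neq0// cexp_neq0.
Qed.

Lemma pfE z w N (u : unitary R N) :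
  pf z w u = cexp (z * plog (1%:M + val u) + w * Num.conj (plog (1%:M + val u))).
Proof.
elim: N u => [|N IH] u /=; first by rewrite rmorph0 !mulr0 addr0 cexp0.
rewrite IH -cexpD schur_proj !mxE eqxx !mulr1n rmorphD/= !mulrDr.
by congr cexp; rewrite addrACA.
Qed.

Lemma f_zw_pf z w N (u : unitary R N) : @unitary' R N u -> f_zw z w u = pf z w u.
Proof.
move=> u'; rewrite pfE -sum_cln_eigenvalues ?inE// rmorph_sum !mulr_sumr -big_split/=.
rewrite cexp_sum; apply: eq_bigr => e _.
by rewrite cexpD /cpow -cln_conj rmorphD rmorph1.
Qed.

(** For L = log det (1 + u), Re (z L + w conj L) = Re ((z + conj w) L) = Re (s L): this is where z +
    conj w = s enters. The indicator is needed because [pf] does not vanish off U(N)'. *)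
Lemma densityE z w s N (u : unitary R N) : z + Num.conj w = s ->
  density s u = (Re (norm_const N s))^-1 *
    normc (pf z w u) ^+ 2 * \1_(@unitary' R N) u.
Proof.
move=> <-; rewrite /density indicE; case: ifPn => u'; last by rewrite mulr0.
rewrite mulr1; congr (_ * _ ^+ 2).
rewrite pfE -sum_cln_eigenvalues// -cexp_sum -mulr_sumr.
rewrite !normc_cexp; congr expR.
by rewrite !ReD !ReM !ReD !ImD ReJ !ImJ ReJ; ring.
Qed.

(** The sequence [eigenvalues] is chosen from the characteristic polynomial alone, so conjugate
    matrices have the same sequence and not merely a permuted one. *)
Lemma f_zw_conj z w N (g u : unitary R N) : f_zw z w (g^-1 * u * g)%g = f_zw z w u.
Proof.
suff e : eigenvalues (g^-1 * u * g)%g = eigenvalues u by rewrite /f_zw e.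
rewrite /eigenvalues; congr (sval (closed_field_poly_normal _)).
have gV : val g \in unitmx by exact: unitarymx_unit (valP g).
rewrite !val_unitaryM val_unitaryV.
have -> : (val g)^t* = invmx (val g) by rewrite invmx_unitary// (valP g).
set G := val g; set A := val u.
rewrite /char_poly (_ : char_poly_mx _ = map_mx polyC (invmx G) *m char_poly_mx A *m map_mx polyC G).
  rewrite !det_mulmx mulrAC -det_mulmx -map_mxM mulVmx// map_mx1 det1 mul1r//.
rewrite /char_poly_mx mulmxBr mulmxBl -!map_mxM; congr (_ - _).
by rewrite scalar_mxC -mulmxA -map_mxM mulVmx// map_mx1 mulmx1.
Qed.

End LogDet.

(** * Topology and Borel structure of the unitary groups *)

Section UnitaryTopology.
Variable R : realType.
Local Notation C := R[i].

(** Balls of the matrix space over [R[i]] have radii in [R[i]]; these boxes have real radii. *)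
Definition ubox N (u : unitary R N) (e : R) : set (unitary R N) :=
  [set v : unitary R N | forall i j, normc (val u i j - val v i j) < e].

Lemma normcEn (x : C) : `|x| = (normc x)%:C.
Proof. by rewrite normc_def; case: x. Qed.

Lemma ball_ubox N (u v : unitary R N) (e : R) : 0 < e ->
  ball (val u) e%:C (val v) <-> ubox u e v.
Proof.
move=> e0; have e0' : 0 < e%:C by rewrite ltcR.
split=> [[_ h] i j|h].
  by have : `|val u i j - val v i j| < e%:C := h i j; rewrite normcEn ltcR.
split=> // i j.
suff : `|val u i j - val v i j| < e%:C by [].
by rewrite normcEn ltcR.
Qed.

Lemma open_unitaryP N (O : set (unitary R N)) :
  open O <-> forall u, O u -> exists2 e, 0 < e & ubox u e `<=` O.
Proof.
split=> [[V oV <-] u /= Vu|h].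
  have /nbhs_ballP[e /= e0 eV] := open_nbhs_nbhs (conj oV Vu).
  have ee : e = (Re e)%:C by apply: eqC => //=; move: e0; rewrite ltcE => /andP[/eqP].
  have e0' : 0 < Re e by move: e0; rewrite ltcE => /andP[].
  exists (Re e) => // v /(ball_ubox _ _ e0') uv; apply: eV; rewrite ee; exact: uv.
pose I := [set ue : unitary R N * R | 0 < ue.2 /\ ubox ue.1 ue.2 `<=` O].
exists (\bigcup_(ue in I) ((ball (val ue.1) (ue.2)%:C)°)).
  by apply: bigcup_open => ue _; exact: open_interior.
apply/seteqP; split=> v /=.
  move=> [ue [e0 eO]] /interior_subset b; apply: eO.
  exact/(ball_ubox _ _ e0).
move=> Ov; have [e e0 eO] := h v Ov; exists (v, e) => //.
by apply: nbhsx_ballx; rewrite ltcR.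
Qed.

Lemma normc_triangle (x y : C) : normc (x + y) <= normc x + normc y.
Proof. exact: le_normcD. Qed.

Lemma ubox_triangle N (u v : unitary R N) (e : R) :
  ubox u e v -> exists2 d, 0 < d & ubox v d `<=` ubox u e.
Proof.
move=> uv.
pose m := \big[Num.min/1]_(ij : 'I_N * 'I_N) (e - normc (val u ij.1 ij.2 - val v ij.1 ij.2)).
exists m => [|w vw i j].
  apply: lt_bigmin => // -[i j] _ /=; rewrite subr_gt0; exact: uv.
have -> : val u i j - val w i j = (val u i j - val v i j) + (val v i j - val w i j).
  by rewrite addrA subrK.
apply: le_lt_trans (normc_triangle _ _) _.
rewrite addrC -ltrBrDr; apply: lt_le_trans (vw i j) _.
exact: (@bigmin_le _ _ _ _ (i, j)).
Qed.

Lemma open_ubox N (u : unitary R N) e : open (ubox u e).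
Proof. by apply/open_unitaryP => v /ubox_triangle. Qed.

Lemma measurable_open_unitary N (O : set (unitary R N)) : open O -> measurable O.
Proof. exact: sub_sigma_algebra. Qed.

Lemma ubox_norm N (u v : unitary R N) e i j : ubox u e v ->
  `|Re (val u i j) - Re (val v i j)| < e /\ `|Im (val u i j) - Im (val v i j)| < e.
Proof.
move=> /(_ i j); case: (val u i j) (val v i j) => a b [c d] /= h.
split; apply: le_lt_trans h; rewrite -sqrtr_sqr ler_wsqrtr//.
  by rewrite lerDl sqr_ge0.
by rewrite lerDr sqr_ge0.
Qed.

Definition cmeas d (T : measurableType d) (f : T -> C) :=
  measurable_fun setT (fun t => Re (f t)) /\ measurable_fun setT (fun t => Im (f t)).

Lemma cmeas_entry N (i j : 'I_N) : cmeas (fun u : unitary R N => val u i j).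
Proof.
split; apply: (measurability _ (RGenOInfty.measurableE R)) => _ [_ [a ->] <-];
  rewrite setTI; apply: measurable_open_unitary; apply/open_unitaryP => u /=;
  rewrite in_itv/= andbT => au.
- exists (Re (val u i j) - a); first by rewrite subr_gt0.
  move=> v /(ubox_norm i j)[+ _] /=; rewrite in_itv/= andbT.
  by rewrite ltr_norml => /andP[_]; lra.
- exists (Im (val u i j) - a); first by rewrite subr_gt0.
  move=> v /(ubox_norm i j)[_ +] /=; rewrite in_itv/= andbT.
  by rewrite ltr_norml => /andP[_]; lra.
Qed.

Section Closure.
Context d (T : measurableType d).
Implicit Types f g : T -> C.

Lemma cmeas_cst (c : C) : cmeas (fun _ : T => c).
Proof. by split; exact: measurable_cst. Qed.
Lemma cmeasD f g : cmeas f -> cmeas g -> cmeas (fun t => f t + g t).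
Proof.
move=> [fr fi] [gr gi]; split.
  by under eq_fun do rewrite ReD; exact: measurable_funD.
by under eq_fun do rewrite ImD; exact: measurable_funD.
Qed.
Lemma cmeasN f : cmeas f -> cmeas (fun t => - f t).
Proof.
move=> [fr fi]; split.
  by under eq_fun do rewrite ReN; exact: measurableT_comp.
by under eq_fun do rewrite ImN; exact: measurableT_comp.
Qed.
Lemma cmeasM f g : cmeas f -> cmeas g -> cmeas (fun t => f t * g t).
Proof.
move=> [fr fi] [gr gi]; split.
  by under eq_fun do rewrite ReM; apply: measurable_funB; exact: measurable_funM.
by under eq_fun do rewrite ImM; apply: measurable_funD; exact: measurable_funM.
Qed.
Lemma cmeasJ f : cmeas f -> cmeas (fun t => Num.conj (f t)).
Proof.
move=> [fr fi]; split; first by under eq_fun do rewrite ReJ.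
by under eq_fun do rewrite ImJ; exact: measurableT_comp.
Qed.

Lemma measurable_funVr (f : T -> R) : measurable_fun setT f ->
  measurable_fun setT (fun t => (f t)^-1).
Proof.
move=> mf; apply: (measurableT_comp _ mf).
rewrite -(setvU [set 0 : R]); apply/measurable_funU => //; first exact: measurableC.
split; last exact: measurable_fun_set1.
apply: open_continuous_measurable_fun; first exact/closed_openC/accessible_closed_set1/hausdorff_accessible/Rhausdorff.
by move=> x /set_mem /= /eqP x0; exact: inv_continuous.
Qed.

Lemma cmeasV f : cmeas f -> cmeas (fun t => (f t)^-1).
Proof.
move=> [fr fi].
have m : measurable_fun setT (fun t => (Re (f t) ^+ 2 + Im (f t) ^+ 2)^-1).
  by apply: measurable_funVr; apply: measurable_funD; exact: measurable_funX.
split; first by under eq_fun do rewrite ReV; exact: measurable_funM.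
under eq_fun do rewrite ImV; apply: measurableT_comp => //; exact: measurable_funM.
Qed.

Lemma cmeas_sum (I : Type) (r : seq I) (P : pred I) (f : I -> T -> C) :
  (forall i, cmeas (f i)) -> cmeas (fun t => \sum_(i <- r | P i) f i t).
Proof.
move=> mf; elim: r => [|i r IH].
  by under eq_fun do rewrite big_nil; exact: cmeas_cst.
under eq_fun do rewrite big_cons.
by case: (P i) => //; exact: cmeasD.
Qed.

Lemma measurable_normc f : cmeas f -> measurable_fun setT (fun t => normc (f t)).
Proof.
move=> [fr fi]; rewrite (_ : (fun t => _) = (fun t => Num.sqrt (Re (f t) ^+ 2 + Im (f t) ^+ 2))).
  apply: measurableT_comp; first by apply: continuous_measurable_fun; exact: sqrt_continuous.
  by apply: measurable_funD; exact: measurable_funX.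
by apply/funext => t; case: (f t).
Qed.

Lemma cmeas_cexp f : cmeas f -> cmeas (fun t => cexp (f t)).
Proof.
move=> [fr fi]; split; apply: measurable_funM; apply: measurableT_comp => //.
- by apply: continuous_measurable_fun; exact: continuous_cos.
- by apply: continuous_measurable_fun; exact: continuous_sin.
Qed.

Lemma cmeas_cln f : cmeas f -> cmeas (fun t => cln (f t)).
Proof.
move=> mf; have [fr fi] := mf; split.
  by apply: measurableT_comp => //; exact: measurable_normc.
apply: measurableT_comp; last by apply: measurable_funM => //; exact: measurable_funVr.
by apply: continuous_measurable_fun => x; exact: continuous_atan.
Qed.

Lemma measurable_lt_normc f (a : R) : cmeas f -> measurable [set t | normc (f t) < a].
Proof.
move=> mf; have := measurable_normc mf measurableT (measurable_itv `]-oo, a[).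
by rewrite setTI; congr measurable; apply/seteqP; split=> t /=; rewrite in_itv.
Qed.

Lemma cmeas_neq f (a : C) : cmeas f -> measurable [set t | f t != a].
Proof.
move=> mf; have mg : cmeas (fun t => f t - a) by apply: cmeasD => //; exact: cmeas_cst.
have := measurable_normc mg measurableT (measurable_itv `]0, +oo[).
rewrite setTI; congr measurable; apply/seteqP; split=> t /=; rewrite in_itv/= andbT.
  by apply: contraTneq => ->; rewrite subrr normc0 ltxx.
by move=> h; rewrite normc_gt0// subr_eq0.
Qed.

Lemma cmeas_if (b : T -> bool) f g : measurable [set t | b t] ->
  cmeas f -> cmeas g -> cmeas (fun t => if b t then f t else g t).
Proof.
move=> mb [fr fi] [gr gi].
have mb' : measurable_fun setT b by apply: (measurable_fun_bool true); rewrite setTI.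
split.
  rewrite (_ : (fun t => _) = (fun t => if b t then Re (f t) else Re (g t))).
    by apply: measurable_fun_ifT.
  by apply/funext => t; case: ifP.
rewrite (_ : (fun t => _) = (fun t => if b t then Im (f t) else Im (g t))).
  by apply: measurable_fun_ifT.
by apply/funext => t; case: ifP.
Qed.

(* Rational boxes form a countable basis of the topology of U(N). *)
Lemma measurable_unitaryP N (F : T -> unitary R N) :
  (forall i j, cmeas (fun t => val (F t) i j)) -> measurable_fun setT F.
Proof.
move=> mF; apply: (@measurability _ _ _ _ _ _ (@open (unitary R N))); first by [].
move=> _ [ O oO <-].
rewrite setTI.
pose q2c (q : rat * rat) : C := ratr q.1 +i* ratr q.2.
pose B (qn : 'M[(rat * rat)%type]_N * nat) : set (unitary R N) :=
  [set v : unitary R N | forall i j, normc (val v i j - q2c (qn.1 i j)) < qn.2.+1%:R^-1].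
(* Boxes that are not inside [O] contribute the empty set, so the union runs over the whole
   countable index type. *)
pose F' qn := if `[< B qn `<=` O >] then F @^-1` B qn else set0.
have -> : F @^-1` O = \bigcup_qn F' qn.
  apply/seteqP; split=> [t /= Ot|t [qn _]]; last first.
    by rewrite /F'; case: asboolP => // h; exact: h.
  have [e e0 eO] := (open_unitaryP O).1 oO _ Ot.
  have [n ne] : exists n : nat, n.+1%:R^-1 < e / 2.
    have h : 0 < e / 2 by rewrite divr_gt0.
    near \oo => n; exists n; near: n; exact: near_infty_natSinv_lt (PosNum h).
  have n0 : 0 < (n.+1%:R^-1 : R) by rewrite invr_gt0.
  have qr' (x r : R) : 0 < r -> {q : rat | `|x - ratr q| < r / 2}.
    move=> r0; apply: cid; have xx : x - r / 2 < x + r / 2 by lra.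
    have [q] := rat_in_itvoo xx; rewrite in_itv/= => /andP[? ?].
    by exists q; rewrite ltr_norml; lra.
  have qr (x : R) := qr' x _ n0.
  pose M : 'M[(rat * rat)%type]_N :=
    \matrix_(i, j) (sval (qr (Re (val (F t) i j))), sval (qr (Im (val (F t) i j)))).
  have BF : B (M, n) (F t).
    move=> i j; rewrite mxE /q2c /=.
    case: (qr _) => a /= ha; case: (qr _) => b /= hb.
    move: ha hb; case: (val (F t) i j) => x y /= ha hb.
    have := normc_triangle ((x - ratr a)%:C) (0 +i* (y - ratr b)).
    rewrite /= !expr0n /= !addr0 !add0r !sqrtr_sqr => h.
    apply: le_lt_trans h _; apply: lt_le_trans (ltrD ha hb) _.
    by rewrite -splitr.
  exists (M, n) => //; rewrite /F' asboolT// => v Bv; apply: eO => i j.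
  have -> : val (F t) i j - val v i j =
    (val (F t) i j - q2c (M i j)) + - (val v i j - q2c (M i j)) by ring.
  apply: le_lt_trans (normc_triangle _ _) _; rewrite normcN.
  apply: lt_le_trans (ltrD (BF i j) (Bv i j)) _ => /=.
  by move: (n.+1%:R^-1) ne => r; lra.
apply: countable_bigcupT_measurable => [|qn]; first exact: countableP.
rewrite /F'; case: ifP => // _.
rewrite (_ : _ @^-1` _ = \bigcap_(ij in [set: 'I_N * 'I_N])
   [set t | normc (val (F t) ij.1 ij.2 - q2c (qn.1 ij.1 ij.2)) < qn.2.+1%:R^-1]).
  apply: fin_bigcap_measurable => // ij _; apply: measurable_lt_normc.
  by apply: cmeasD => //; exact: cmeas_cst.
apply/seteqP; split=> t /=; first by move=> h [i j] _; exact: h.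
by move=> h i j; exact: (h (i, j)).
Unshelve. all: by end_near. Qed.

End Closure.
End UnitaryTopology.

(** * Measurability of the maps between unitary groups *)

Section MeasurableMaps.
Variable R : realType.
Local Notation C := R[i].

Lemma measurable_negb d (T : measurableType d) (b : T -> bool) :
  measurable [set t | ~~ b t] -> measurable [set t | b t].
Proof.
move=> /measurableC; congr measurable; apply/seteqP; split=> t /=.
  by move/negP; rewrite negbK.
by move=> bt; apply/negP; rewrite negbK.
Qed.

Lemma cmeas_lastc N : cmeas (fun u : unitary R N.+1 => lastc u).
Proof. exact: cmeas_entry. Qed.

Lemma measurable_proj_unitary N : measurable_fun setT (@proj_unitary R N).
Proof.
apply: measurable_unitaryP => i j; under eq_fun do rewrite /= proj_mx_lastE.
apply: cmeasD; first exact: cmeas_entry.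
apply: cmeasN; apply: cmeas_if.
- by apply: measurable_negb; exact: (cmeas_neq _ (@cmeas_lastc N)).
- exact: cmeas_cst.
apply: cmeasM; last by apply: cmeasM; exact: cmeas_entry.
by apply: cmeasV; apply: cmeasD; [exact: cmeas_cst|exact: cmeas_entry].
Qed.

Lemma measurable_unitary_mul N (a b : unitary R N) :
  measurable_fun setT (fun u : unitary R N => (a * u * b)%g).
Proof.
apply: measurable_unitaryP => i j; under eq_fun do rewrite /= !mxE.
apply: cmeas_sum => k; apply: cmeasM; last exact: cmeas_cst.
under eq_fun do rewrite !mxE; apply: cmeas_sum => l.
by apply: cmeasM; [exact: cmeas_cst|exact: cmeas_entry].
Qed.

Lemma measurable_shift N (g : Ginf R) : measurable_fun setT (@Defs.shift R N g).
Proof. exact: measurable_unitary_mul. Qed.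

Lemma cmeas_comp d d' (T : measurableType d) (T' : measurableType d')
  (f : T -> T') (h : T' -> C) : measurable_fun setT f -> cmeas h -> cmeas (fun t => h (f t)).
Proof. by move=> mf [hr hi]; split; [exact: measurableT_comp hr mf|exact: measurableT_comp hi mf]. Qed.

Lemma measurable_unitary' N : measurable (@unitary' R N).
Proof.
elim: N => [|N IH].
  rewrite (_ : @unitary' R 0 = setT) ?seteqP//; split=> // u _.
  by apply/unitary'E; rewrite det_mx00 oner_neq0.
rewrite (_ : @unitary' R N.+1 = [set u | lastc u != -1] `&` proj_unitary (N:=N) @^-1` @unitary' R N).
  apply: measurableI; first exact: (cmeas_neq _ (@cmeas_lastc N)).
  by rewrite -[X in measurable X]setTI; exact: measurable_proj_unitary.
by apply/seteqP; split=> u /=; move=> /unitary'S.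
Qed.

Lemma cmeas_pf z w N : cmeas (fun u : unitary R N => pf z w u).
Proof.
elim: N => [|N IH] /=; first exact: cmeas_cst.
apply: cmeasM; last exact: (cmeas_comp (@measurable_proj_unitary N) IH).
have m : cmeas (fun u : unitary R N.+1 => cln (1 + lastc u)).
  by apply: cmeas_cln; apply: cmeasD; [exact: cmeas_cst|exact: cmeas_entry].
apply: cmeas_cexp; apply: cmeasD; (apply: cmeasM; first exact: cmeas_cst); first exact: m.
exact: cmeasJ.
Qed.

Lemma measurable_pi N : measurable_fun setT (@pi_ R N).
Proof.
move=> _ B mB; rewrite setTI; apply: sub_sigma_algebra.
by exists N; exists B.
Qed.

Lemma proj_pi N (x : virtual_unitary R) : proj_unitary (pi_ N.+1 x) = pi_ N x.
Proof. exact: vseqP. Qed.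

Lemma pi_act_shift x (g : Ginf R) N : in_levelG N g ->
  pi_ N (act x g) = Defs.shift g (pi_ N x).
Proof. exact: pi_act. Qed.

Lemma in_levelG_leq N M (g : Ginf R) : (N <= M)%N -> in_levelG N g -> in_levelG M g.
Proof. by move=> NM /in_levelGE gN; apply/in_levelGE; exact: leq_trans NM. Qed.

Lemma measurable_pi_act N (g : Ginf R) : measurable_fun setT (fun x => pi_ N (act x g)).
Proof.
suff : forall d M, (levelG g <= M + d)%N -> measurable_fun setT (fun x => pi_ M (act x g)).
  by apply; exact: leq_addl.
elim=> [|d IH] M.
  rewrite addn0 => /in_levelGE gM; under eq_fun do rewrite pi_act_shift//.
  by apply: measurableT_comp; [exact: measurable_shift|exact: measurable_pi].
rewrite -addSnnS => /IH mM; under eq_fun do rewrite -proj_pi.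
by apply: measurableT_comp mM; exact: measurable_proj_unitary.
Qed.

Lemma measurable_act (g : Ginf R) : measurable_fun setT (fun x => act x g).
Proof.
apply: (@measurability _ _ _ _ _ _ (@virtual_cylinder R)); first by [].
move=> _ [_ [N [B mB ->]] <-].
by rewrite -comp_preimage; exact: measurable_pi_act.
Qed.

End MeasurableMaps.

(** * The complement of U(N)' is Haar null *)

Lemma measure0_bounded_multiplicity d (T : measurableType d) (R : realType)
  (P : probability T R) (A : nat -> set T) (B : set T) (m : nat) :
  (forall k, measurable (A k)) -> (forall k, P (A k) = P B) ->
  (forall n t, \sum_(0 <= k < n) (\1_(A k) t : R) <= m%:R) -> P B = 0%E.
Proof.
move=> mA PA Am.
have fin : (P B \is a fin_num)%E.
  by rewrite -(PA 0%N); apply: fin_num_measure.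
(* Integrate the sum of the first n indicators: it is at most m, while each term contributes P B. *)
have le n : n%:R * fine (P B) <= m%:R.
  rewrite -lee_fin EFinM fineK//.
  have -> : (n%:R%:E * P B = \sum_(0 <= k < n) P (A k))%E.
    under eq_bigr do rewrite PA -(fineK fin).
    by rewrite sumEFin sumr_const_nat subn0 -[in LHS](fineK fin) -EFinM mulr_natl.
  have -> : (\sum_(0 <= k < n) P (A k) =
      \int[P]_t \sum_(0 <= k < n) (\1_(A k) t)%:E)%E.
    rewrite ge0_integral_sum//; last first.
      by move=> k; apply/measurable_EFinP; exact: measurable_indic.
    by apply: eq_bigr => k _; rewrite integral_indic// setIT.
  apply: (@le_trans _ _ (\int[P]_t (m%:R%:E)))%E.
    apply: ge0_le_integral => //.
    - by move=> t _; apply: sume_ge0 => k _; rewrite lee_fin.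
    - by apply: emeasurable_sum => k; apply/measurable_EFinP; exact: measurable_indic.
    - by move=> t _; rewrite sumEFin lee_fin.
  by rewrite integral_cst//= probability_setT mule1.
apply/eqP; rewrite eq_le measure_ge0 andbT -(fineK fin) lee_fin leNgt.
apply/negP => p0.
have := le (Num.truncn (m%:R / fine (P B))).+1.
rewrite leNgt -ltr_pdivrMr// => /negP; apply.
exact: truncnS_gt.
Qed.

Section HaarNull.
Variables (R : realType) (N : nat) (h : probability (unitary R N) R).
Hypothesis hh : is_haar h.
Local Notation C := R[i].

(** The quotients of x by its conjugate are infinitely many distinct points of the unit circle: the
    arguments of the points 1 + i k differ and lie in [0, pi / 2). *)
Let x (k : nat) : C := 1 +i* k%:R.
Let zeta (k : nat) : C := x k / Num.conj (x k).

Let x_neq0 k : x k != 0.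
Proof. by apply/eqP => /(congr1 (@Re _)) /= /eqP; rewrite oner_eq0. Qed.

Let zetaJ k : zeta k * Num.conj (zeta k) = 1.
Proof.
rewrite /zeta rmorphM fmorphV /= conjCK.
by field; rewrite conjC_eq0 x_neq0.
Qed.

Let zeta_inj : injective zeta.
Proof.
move=> k l /eqP; rewrite /zeta eqr_div ?conjC_eq0// => /eqP /(congr1 (@Im _)).
rewrite !conjcE /x /= => e; apply/eqP; rewrite -(eqr_nat R); apply/eqP; lra.
Qed.

Let zeta_neq0 k : zeta k != 0.
Proof. by rewrite mulf_neq0// invr_eq0 conjC_eq0. Qed.

Let zeta_unitary k : (zeta k)%:M \is @unitarymx C N N.
Proof.
apply/unitarymxP; rewrite tr_scalar_mx map_scalar_mx/= -scalar_mxM.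
by rewrite zetaJ.
Qed.

Let zu k : unitary R N :=
  exist (fun B : 'M[C]_N => B \is unitarymx) _ (zeta_unitary k).

(* Translates of the complement of U(N)' by the scalars zeta k; since u has N
   eigenvalues, it lies in at most N of them. *)
Let A k : set (unitary R N) :=
  (fun u => zu k * u * 1)%g @^-1` ~` @unitary' R N.

Let A_card n u : (\sum_(0 <= k < n) (\1_(A k) u : R) <= N%:R)%R.
Proof.
have Ak k : A k u -> - (zeta k)^-1 \in eigenvalues u.
  move=> /(contra_not (proj2 (unitary'E _))) /negP; rewrite negbK.
  rewrite !val_unitaryM val_unitary1 mulmx1 mul_scalar_mx det_add1.
  rewrite prodf_seq_eq0 => /hasP[e ee /= /eqP h1].
  suff -> : - (zeta k)^-1 = e by [].
  apply: (mulfI (zeta_neq0 k)); rewrite mulrN mulfV//.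
  by apply/eqP; rewrite -subr_eq0 -opprD oppr_eq0 h1.
pose s := [seq - (zeta k)^-1 | k <- index_iota 0 n & \1_(A k) u == 1 :> R].
have us : uniq s.
  rewrite map_inj_uniq ?filter_uniq ?iota_uniq// => k l /oppr_inj /invr_inj.
  exact: zeta_inj.
have : (size s <= N)%N.
  rewrite -[X in (_ <= X)%N](size_eigenvalues u); apply: uniq_leq_size => // e /mapP[k].
  rewrite mem_filter => /andP[+ _] ->; rewrite indicE pnatr_eq1.
  by case: (boolP (u \in A k)) => // /set_mem /Ak.
rewrite size_map size_filter -sum1_count /= -(ler_nat R); apply: le_trans.
rewrite natr_sum [leRHS]big_mkcond/=; apply: ler_sum => k _.
rewrite indicE; case: (_ \in _) => /=; first by rewrite eqxx.
by case: ifP.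
Qed.

(** The density vanishes off U(N)' while [pf] does not, so the two can be compared only up to this
    null set. *)
Lemma haar_unitary' : h (~` @unitary' R N) = 0%E.
Proof.
have mB : measurable (~` @unitary' R N).
  by apply: measurableC; exact: measurable_unitary'.
apply: (measure0_bounded_multiplicity _ _ A_card) => [k|k].
  by rewrite -[X in measurable X]setTI; exact: measurable_unitary_mul.
exact: hh.
Qed.

End HaarNull.

(** * Integration against a density *)

Lemma integral_density d (T : measurableType d) (R : realType)
  (m n : {measure set T -> \bar R}) (w : T -> R) :
  measurable_fun setT w -> (forall t, 0 <= w t) ->
  (forall A, measurable A -> m A = \int[n]_(t in A) (w t)%:E)%E ->
  forall K : T -> \bar R, measurable_fun setT K -> (forall t, 0 <= K t)%E ->
  (\int[m]_t K t = \int[n]_t (K t * (w t)%:E))%E.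
Proof.
move=> mw w0 mE K mK K0.
have mwE : measurable_fun setT (fun t => (w t)%:E) by apply/measurable_EFinP.
(* The identity for indicators extends to nonnegative simple functions by linearity, and then to [K]
   by monotone convergence. *)
have ind A : measurable A ->
    (\int[m]_t (\1_A t)%:E = \int[n]_t ((\1_A t)%:E * (w t)%:E))%E.
  move=> mA; rewrite integral_indic// setIT mE// integral_mkcond.
  by apply: eq_integral => t _; rewrite patchE indicE; case: ifPn; rewrite ?mul1e ?mul0e.
have simple (h : {nnsfun T >-> R}) :
    (\int[m]_t (h t)%:E = \int[n]_t ((h t)%:E * (w t)%:E))%E.
  have mh y : measurable_fun setT (fun t => (\1_(h @^-1` [set y]) t)%:E : \bar R).
    by apply/measurable_EFinP; exact: measurable_indic.
  have h0 y : y \in range h -> (0 <= y%:E :> \bar R)%E.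
    by rewrite inE => -[t _ <-]; rewrite lee_fin.
  have e t : (h t)%:E = (\sum_(y \in range h) (y%:E * (\1_(h @^-1` [set y]) t)%:E))%E.
    by rewrite fimfunE -fsumEFin.
  have p0 y t : (0 <= y%:E * (\1_(h @^-1` [set y]) t)%:E :> \bar R)%E.
    by rewrite -EFinM; exact: nnfun_muleindic_ge0.
  under eq_integral do rewrite e.
  rewrite ge0_integral_fsum//; last by move=> y; exact: emeasurable_funM.
  transitivity (\int[n]_t \sum_(y \in range h)
      (y%:E * (\1_(h @^-1` [set y]) t)%:E * (w t)%:E))%E; last first.
    apply: eq_integral => t _; rewrite -ge0_mule_fsuml//.
    by rewrite -e.
  rewrite ge0_integral_fsum//; last 2 first.
  - by move=> y; apply: emeasurable_funM => //; exact: emeasurable_funM.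
  - by move=> y t _; rewrite mule_ge0// lee_fin.
  apply: eq_fsbigr => y yh.
  rewrite ge0_integralZl//; last exact: h0.
  under [RHS]eq_integral do rewrite -muleA.
  rewrite [RHS]ge0_integralZl; [by rewrite ind|by []|exact: emeasurable_funM| |exact: h0].
  by move=> t _; rewrite mule_ge0// lee_fin.
pose h := nnsfun_approx measurableT mK.
have hK t : EFin \o h^~ t @ \oo --> K t by exact: cvg_nnsfun_approx.
have hn t : {homo (fun k => (h k t)%:E) : a b / (a <= b)%N >-> (a <= b)%E}.
  by move=> a b ab; rewrite lee_fin; exact/lefP/nd_nnsfun_approx.
have mh k : measurable_fun setT (fun t => (h k t)%:E) by exact/measurable_EFinP.
transitivity (limn (fun k => \int[m]_t (h k t)%:E))%E.
  rewrite -monotone_convergence//.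
  - by apply: eq_integral => t _; apply/esym/cvg_lim => //; exact: hK.
  - by move=> k t _; rewrite lee_fin.
transitivity (limn (fun k => \int[n]_t ((h k t)%:E * (w t)%:E)))%E.
  by congr (limn _); apply/funext => k; exact: simple.
rewrite -monotone_convergence//.
- apply: eq_integral => t _; apply/cvg_lim => //.
  by apply: cvgeZr => //; exact: hK.
- by move=> k; exact: emeasurable_funM.
- by move=> k t _; rewrite mule_ge0 ?lee_fin.
- by move=> t _ a b ab; rewrite lee_wpmul2r ?lee_fin//; exact: hn.
Qed.

(** * Cylinder sets *)

Section Cylinders.
Variable R : realType.

(** The projections are Borel, so a base can be pulled back to any higher level. This gives the
    stability of cylinders under intersection and reduces questions about G(N) to levels at least
    N. *)
Lemma cylinder_lift N M (B : set (unitary R N)) : (N <= M)%N -> measurable B ->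
  exists2 B', measurable B' & @pi_ R N @^-1` B = @pi_ R M @^-1` B'.
Proof.
move=> /subnK <-; move: (M - N)%N => k mB.
elim: k => [|k [B' mB' ->]]; first by exists B.
exists (@proj_unitary R _ @^-1` B'); last first.
  by rewrite -comp_preimage; apply/seteqP; split=> x /=; rewrite proj_pi.
by rewrite -[X in measurable X]setTI; exact: measurable_proj_unitary.
Qed.

Lemma virtual_cylinder_setI : setI_closed (@virtual_cylinder R).
Proof.
move=> _ _ [N [A mA ->]] [M [B mB ->]].
have [A' mA' ->] := cylinder_lift (leq_maxl N M) mA.
have [B' mB' ->] := cylinder_lift (leq_maxr N M) mB.
by exists (maxn N M); exists (A' `&` B'); [exact: measurableI|].
Qed.

End Cylinders.

(** * The invariant measures on virtual unitary matrices *)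

Section Jacobian.
Variables (R : realType) (z w : R[i]) (N : nat).

(* The modulus of the quotient of pf at u by pf at the projection of u to U(N). *)
Fixpoint jac (k : nat) : unitary R (k + N) -> R :=
  match k return unitary R (k + N) -> R with
  | 0%N => fun=> 1
  | k'.+1 => fun u : unitary R (k' + N).+1 =>
      normc (cphi z w (lastc u)) * jac (proj_unitary u)
  end.

Lemma normc_pf_pi k (x : virtual_unitary R) : normc (pf z w (pi_ (k + N) x)) =
  jac (pi_ (k + N) x) * normc (pf z w (pi_ N x)).
Proof.
elim: k => [|k IH] /=; first by rewrite mul1r.
by rewrite normcM -mulrA proj_pi -IH.
Qed.

Lemma ucorner_last (M : nat) (v : unitary_inf R) (i : 'I_M.+1) : in_level M v ->
  val (ucorner M.+1 v) i ord_max = (i == ord_max)%:R /\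
  val (ucorner M.+1 v) ord_max i = (i == ord_max)%:R.
Proof.
move=> [u _ <-]; rewrite val_ucorner// !mxE stabr// stabl//.
by split=> //; rewrite eq_sym.
Qed.

(** An element of G(M), read at size M + 1, has trivial last row and column, so multiplying by it on
    either side leaves the corner entry alone. *)
Lemma lastc_shift M (g : Ginf R) (u : unitary R M.+1) : in_levelG M g ->
  lastc (Defs.shift g u) = lastc u.
Proof.
move=> [g1 g2]; rewrite /lastc /Defs.shift val_unitaryM mxE (bigD1 ord_max)//=.
have e1 k : val (ucorner M.+1 g.1) k ord_max = (k == ord_max)%:R by have [] := ucorner_last k g1.
have e2 k : val (ucorner M.+1 g.2) k ord_max = (k == ord_max)%:R by have [] := ucorner_last k g2.
rewrite e1 eqxx mulr1 big1 ?addr0 => [|k kl]; last by rewrite e1 (negbTE kl) mulr0.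
rewrite mxE (bigD1 ord_max)//= !mxE e2 eqxx rmorph1 mul1r big1 ?addr0// => k kl.
by rewrite !mxE e2 (negbTE kl) rmorph0 mul0r.
Qed.

Lemma jac_shift (g : Ginf R) k (u : unitary R (k + N)) : in_levelG N g ->
  jac (Defs.shift g u) = jac u.
Proof.
move=> gN; elim: k u => [//|k IH] u /=.
have gM : in_levelG (k + N) g by apply: in_levelG_leq gN; exact: leq_addl.
by rewrite proj_shift// IH lastc_shift.
Qed.

Lemma measurable_jac k : measurable_fun setT (@jac k).
Proof.
elim: k => [|k IH]; first exact: measurable_cst.
apply: (@measurable_funM _ _ _ setT (fun u : unitary R (k + N).+1 => normc (cphi z w (lastc u)))
  (fun u => jac (proj_unitary u))); last by apply: measurableT_comp => //; exact: measurable_proj_unitary.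
apply: measurable_normc; apply: cmeas_cexp; have ml := @cmeas_lastc R (k + N).
have m : cmeas (fun u : unitary R (k + N).+1 => cln (1 + lastc u)).
  by apply: cmeas_cln; apply: cmeasD => //; exact: cmeas_cst.
apply: cmeasD; (apply: cmeasM; first exact: cmeas_cst); first exact: m.
exact: cmeasJ.
Qed.

End Jacobian.

Section Weighted.
Variables (R : realType) (s z w : R[i]).
Hypothesis hzw : z + Num.conj w = s.
Variable haar : forall N : nat, probability (unitary R N) R.
Hypothesis hhaar : forall N : nat, is_haar (haar N).
Variable mu : probability (virtual_unitary R) R.
Hypothesis hmu : is_mu_s haar s mu.
Local Notation V := (virtual_unitary R).
Local Notation cst N := (Re (norm_const N s))^-1.

Lemma measurable_sqr_pf N : measurable_fun setT (fun u : unitary R N => normc (pf z w u) ^+ 2).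
Proof. by apply: measurable_funX; apply: measurable_normc; exact: cmeas_pf. Qed.

Lemma measurable_density N : measurable_fun setT (@density R N s).
Proof.
rewrite (_ : density s = fun u : unitary R N => cst N *
    normc (pf z w u) ^+ 2 * \1_(@unitary' R N) u); last first.
  by apply/funext => u; rewrite (densityE _ hzw).
apply: measurable_funM; last by apply: measurable_indic; exact: measurable_unitary'.
by apply: measurable_funM => //; exact: measurable_sqr_pf.
Qed.

(** With a negative constant the density would be nonpositive, and its integral could not be the
    total mass 1. *)
Lemma norm_const_ge0 N : 0 <= cst N.
Proof.
rewrite leNgt; apply/negP => c0.
have : (\int[haar N]_u (density s u)%:E = 1)%E.
  by have := hmu measurableT (N := N); rewrite preimage_setT probability_setT => ->.
rewrite integralE (_ : _^\+%E = fun=> 0%E).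
  rewrite integral0 sub0e => h1.
  have : (0 <= - (1 : \bar R))%E by rewrite -h1 oppeK integral_ge0.
  by rewrite leeNr oppe0 lee_fin ler10.
apply/funext => u; rewrite funeposE; apply/max_idPr; rewrite lee_fin (densityE _ hzw).
by rewrite mulr_le0_ge0// mulr_le0_ge0 ?sqr_ge0// ltW.
Qed.

Lemma density_ge0 N (u : unitary R N) : 0 <= density s u.
Proof.
by rewrite (densityE _ hzw) mulr_ge0// mulr_ge0 ?sqr_ge0// norm_const_ge0.
Qed.

Lemma integral_pi N (K : unitary R N -> \bar R) :
  measurable_fun setT K -> (forall u, 0 <= K u)%E ->
  (\int[mu]_x K (pi_ N x) = \int[haar N]_u (K u * (density s u)%:E))%E.
Proof.
move=> mK K0; have mp := @measurable_pi R N.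
transitivity (\int[pushforward mu (@pi_ R N)]_u K u)%E.
  by rewrite ge0_integral_pushforward//= preimage_setT.
apply: (integral_density (@measurable_density N) (@density_ge0 N)) => //.
by move=> A mA; exact: hmu.
Qed.

Definition wt N (x : V) : R := (normc (pf z w (pi_ N x)) ^+ 2)^-1.

Lemma wt_gt0 N x : 0 < wt N x.
Proof. by rewrite invr_gt0 exprn_gt0// normc_gt0// pf_neq0. Qed.

Lemma measurable_wt N : measurable_fun setT (wt N).
Proof.
apply: measurable_funVr; apply: (measurableT_comp (@measurable_sqr_pf N)).
exact: measurable_pi.
Qed.

Lemma measurable_wtE N : measurable_fun setT (fun x => (wt N x)%:E).
Proof. by apply/measurable_EFinP; exact: measurable_wt. Qed.

(* Multiplication by pf at level N maps L2 mu isometrically onto L2 (lam N) and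
   turns the representation of G(N) into translation of functions. *)
Definition lam N (A : set V) : \bar R := (\int[mu]_(x in A) (wt N x)%:E)%E.

Let lam0 N : lam N set0 = 0%E.
Proof. exact: integral_set0. Qed.

Let lam_ge0 N A : (0 <= lam N A)%E.
Proof. by apply: integral_ge0 => x _; rewrite lee_fin ltW// wt_gt0. Qed.

Let lam_sigma_additive N : semi_sigma_additive (lam N).
Proof.
move=> F mF tF mUF; rewrite [X in _ --> X](_ : _ = \sum_(0 <= i <oo) lam N (F i))%E.
  by apply: is_cvg_ereal_nneg_natsum => n _; exact: lam_ge0.
rewrite /lam ge0_integral_bigcup//.
- by apply: measurable_funTS; exact: measurable_wtE.
- by move=> x _; rewrite lee_fin ltW// wt_gt0.
Qed.

HB.instance Definition _ N := isMeasure.Build _ _ _ (lam N)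
  (lam0 N) (@lam_ge0 N) (@lam_sigma_additive N).

Lemma ae_haar_unitary' N : {ae haar N, forall u, @unitary' R N u}.
Proof.
exists (~` @unitary' R N); split => //.
  by apply: measurableC; exact: measurable_unitary'.
exact: haar_unitary'.
Qed.

(** At level k + N the weight is the square of [jac] divided by the modulus of [pf], while the
    density of [mu] carries the squared modulus of [pf]; only [jac] squared remains. The indicator
    of U(k + N)' in the density disappears because its complement is Haar null. *)
Lemma lam_cylinder N k (B : set (unitary R (k + N))) : measurable B ->
  lam N (@pi_ R (k + N) @^-1` B) =
  (\int[haar (k + N)]_u (\1_B u * (cst (k + N) * jac z w u ^+ 2))%:E)%E.
Proof.
move=> mB; set M := (k + N)%N.
pose q (u : unitary R M) := (jac z w u / normc (pf z w u)) ^+ 2.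
have pf0 (u : unitary R M) : normc (pf z w u) != 0 by rewrite gt_eqF// normc_gt0// pf_neq0.
have mq : measurable_fun setT q.
  apply: measurable_funX; apply: measurable_funM; first exact: measurable_jac.
  by apply: measurable_funVr; apply: measurable_normc; exact: cmeas_pf.
have mind : measurable_fun setT (\1_B : unitary R M -> R) by exact: measurable_indic.
have wq x : wt N x = q (pi_ M x).
  have p0 : normc (pf z w (pi_ N x)) != 0 by rewrite gt_eqF// normc_gt0// pf_neq0.
  have := pf0 (pi_ M x); rewrite /q /wt /M normc_pf_pi mulf_eq0 negb_or => /andP[j0 _].
  by field; rewrite p0 j0.
transitivity (\int[mu]_x (\1_B (pi_ M x) * q (pi_ M x))%:E)%E.
  rewrite /lam integral_mkcond; apply: eq_integral => x _; rewrite patchE wq.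
  rewrite indicE; have -> : (x \in pi_ M @^-1` B) = (pi_ M x \in B) by [].
  by case: ifP; rewrite ?mul1r ?mul0r.
rewrite (@integral_pi M (fun u => (\1_B u * q u)%:E)); last 2 first.
- by apply/measurable_EFinP; exact: measurable_funM.
- by move=> u; rewrite lee_fin mulr_ge0// sqr_ge0.
apply: ae_eq_integral => //.
- apply: emeasurable_funM; apply/measurable_EFinP; first exact: measurable_funM.
  exact: measurable_density.
- apply/measurable_EFinP; apply: measurable_funM => //; apply: measurable_funM => //.
  by apply: measurable_funX; exact: measurable_jac.
- apply: filterS (ae_haar_unitary' M) => u u' _; rewrite -EFinM; congr (_%:E).
  rewrite (densityE _ hzw) [\1_(@unitary' _ _) u]indicE mem_set// mulr1 /q.
  have := pf0 u; move: (normc _) (jac z w u) (\1_B u) (cst M) => b a i c b0.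
  by field.
Qed.

(** At level N itself, k = 0 and [jac] is 1, so the density with respect to Haar measure is
    constant. *)
Lemma lam_fin N : (lam N setT < +oo)%E.
Proof.
have := @lam_cylinder N 0 setT measurableT; rewrite preimage_setT => ->.
under eq_integral do rewrite /= expr1n indicT mul1r mulr1.
by rewrite integral_cst//= probability_setT mule1 ltry.
Qed.

Lemma preimage_pi_act N M (g : Ginf R) (B : set (unitary R M)) : (N <= M)%N ->
  in_levelG N g ->
  (fun x => act x g) @^-1` (@pi_ R M @^-1` B) = @pi_ R M @^-1` (Defs.shift g @^-1` B).
Proof.
move=> NM gN; by apply/funext => x; exact: (congr1 B (pi_act_shift x (in_levelG_leq NM gN))).
Qed.

Lemma lam_act N (g : Ginf R) (A : set V) : in_levelG N g -> measurable A ->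
  lam N ((fun x => act x g) @^-1` A) = lam N A.
Proof.
move=> gN mA; have ma := measurable_act g.
pose m1 : {measure set V -> \bar R} := pushforward (lam N) (fun x => act x g).
refine (@measure_unique _ _ _ (@virtual_cylinder R) (fun=> setT) _ _ _ _
  (m1 ma) (lam N) _ _ A mA).
- by [].
- exact: virtual_cylinder_setI.
- by move=> _; exists 0%N; exists setT.
- by rewrite bigcup_const//; exists 0%N.
- move=> _ [L [B' mB' ->]].
  (* The base is moved to level L + N, where g acts by a shift and [lam_cylinder] gives a density
     that the shift leaves unchanged. *)
  have [B mB ->] := cylinder_lift (leq_addr N L) mB'.
  have e := @preimage_pi_act N _ g B (leq_addl L N) gN.
  transitivity (lam N (@pi_ R (L + N) @^-1` (@Defs.shift R (L + N) g @^-1` B))).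
    exact: (congr1 (lam N) e).
  have msB : measurable (@Defs.shift R (L + N) g @^-1` B).
    by rewrite -[X in measurable X]setTI; exact: measurable_shift.
  apply: etrans (lam_cylinder msB) _; apply: etrans _ (esym (lam_cylinder mB)).
  set F := fun u => (\1_B u * (cst (L + N) * jac z w u ^+ 2))%:E.
  have mF : measurable_fun setT F.
    apply/measurable_EFinP; apply: measurable_funM; first exact: measurable_indic.
    by apply: measurable_funM => //; apply: measurable_funX; exact: measurable_jac.
  have F0 u : (0 <= F u)%E.
    by rewrite lee_fin mulr_ge0// mulr_ge0 ?sqr_ge0// norm_const_ge0.
  transitivity (\int[haar (L + N)]_u F (Defs.shift g u))%E.
    by apply: eq_integral => u _; rewrite /F jac_shift.
  have ms := @measurable_shift R (L + N) g.
  transitivity (\int[pushforward (haar (L + N)) (@Defs.shift R (L + N) g)]_u F u)%E.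
    by rewrite ge0_integral_pushforward//= preimage_setT.
  by apply: eq_measure_integral => C mC _; exact: hhaar.
- by move=> _; exact: lam_fin.
Qed.

Lemma integral_lam_act N (g : Ginf R) (K : V -> \bar R) : in_levelG N g ->
  measurable_fun setT K -> (forall x, 0 <= K x)%E ->
  (\int[lam N]_x K (act x g) = \int[lam N]_x K x)%E.
Proof.
move=> gN mK K0; have ma := measurable_act g.
transitivity (\int[pushforward (lam N) (fun x => act x g)]_x K x)%E.
  by rewrite ge0_integral_pushforward//= preimage_setT.
by apply: eq_measure_integral => A mA _; exact: lam_act.
Qed.

Lemma integral_lam N (K : V -> \bar R) :
  measurable_fun setT K -> (forall x, 0 <= K x)%E ->
  (\int[lam N]_x K x = \int[mu]_x (K x * (wt N x)%:E))%E.
Proof.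
move=> mK K0; apply: (@integral_density _ _ _ (lam N) mu (wt N)) => //; first exact: measurable_wt.
by move=> x; exact/ltW/wt_gt0.
Qed.

End Weighted.

(** * The multiplier *)

Section Multiplier.
Variable R : realType.
Local Notation V := (virtual_unitary R).
Implicit Types (x y : V) (g h : Ginf R) (z w : R[i]).

Lemma vseq_eq_large N x y : (forall M, (N <= M)%N -> pi_ M x = pi_ M y) -> x = y.
Proof.
move=> xy; apply: virtual_unitary_inj => M.
suff : forall d L, (N <= L + d)%N -> pi_ L x = pi_ L y.
  by apply; exact: leq_addl.
elim=> [|d IH] L; first by rewrite addn0; exact: xy.
by rewrite -addSnnS -(proj_pi L x) -(proj_pi L y) => /IH ->.
Qed.

Lemma in_levelG_max g h : in_levelG (maxn (levelG g) (levelG h)) g /\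
  in_levelG (maxn (levelG g) (levelG h)) h.
Proof. by split; apply/in_levelGE; rewrite ?leq_maxl ?leq_maxr. Qed.

Lemma in_levelGM N g h : in_levelG N g -> in_levelG N h -> in_levelG N (g * h)%g.
Proof. by move=> [g1 g2] [h1 h2]; split; exact: umul_level. Qed.

Lemma shiftM N g h (u : unitary R N) : in_levelG N g -> in_levelG N h ->
  Defs.shift (g * h)%g u = Defs.shift h (Defs.shift g u).
Proof.
move=> [g1 g2] [h1 h2]; rewrite /Defs.shift.
rewrite [ucorner N (g * h)%g.1](ucorner_umul g1 h1) [ucorner N (g * h)%g.2](ucorner_umul g2 h2).
by rewrite invgM !mulgA.
Qed.

Lemma actM x g h : act x (g * h)%g = act (act x g) h.
Proof.
have [gN hN] := in_levelG_max g h.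
apply: (@vseq_eq_large (maxn (levelG g) (levelG h))) => M NM.
have gM := in_levelG_leq NM gN; have hM := in_levelG_leq NM hN.
rewrite (pi_act_shift _ (in_levelGM gM hM)) (pi_act_shift _ hM) (pi_act_shift _ gM).
exact: shiftM.
Qed.

Lemma in_levelG1 N : in_levelG N (1%g : Ginf R).
Proof.
by split; rewrite [X in in_level _ X](_ : _ = uembed (1%g : unitary R N)); do ?exact: uoneE; exists 1%g.
Qed.

Lemma ucorner1 N : ucorner N (1%g : unitary_inf R) = 1%g.
Proof. by rewrite [1%g in LHS](uoneE R N) uembedK. Qed.

Lemma act1 x : act x 1%g = x.
Proof.
apply: (@vseq_eq_large 0) => M _; rewrite (pi_act_shift _ (in_levelG1 M)) /Defs.shift.
by rewrite ucorner1 invg1 mul1g mulg1.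
Qed.

Lemma virtual_unitary'P x : @virtual_unitary' R x <-> forall N, @unitary' R N (pi_ N x).
Proof. by split=> h N; [exact/set_mem/h|exact/mem_set/h]. Qed.

Definition mdom g : set V := [set x | @virtual_unitary' R x /\ @virtual_unitary' R (act x g)].

Lemma pf_ratio z w N k x g : in_levelG N g ->
  pf z w (pi_ (k + N) (act x g)) / pf z w (pi_ (k + N) x) =
  pf z w (pi_ N (act x g)) / pf z w (pi_ N x).
Proof.
move=> gN; elim: k => [//|k IH]; rewrite -IH.
have gM : in_levelG (k + N) g by apply: in_levelG_leq gN; exact: leq_addl.
have e : lastc (pi_ (k + N).+1 (act x g)) = lastc (pi_ (k + N).+1 x).
  by rewrite pi_act_shift ?lastc_shift//; exact: in_levelG_leq gM.
have pS y : pf z w (pi_ (k.+1 + N) y) =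
    cphi z w (lastc (pi_ (k + N).+1 y)) * pf z w (pi_ (k + N) y).
  by rewrite -(proj_pi (k + N) y).
rewrite !pS e.
by rewrite -mulf_div divff ?mul1r//; exact: cexp_neq0.
Qed.

(* Off the conull set mdom g the multiplier is 0. *)
Lemma multiplierE z w N x g : in_levelG N g -> multiplier z w x g =
  if `[< mdom g x >] then pf z w (pi_ N (act x g)) / pf z w (pi_ N x) else 0.
Proof.
move=> gN; rewrite /multiplier; case: asboolP => [[x' xg']|nd]; last first.
  by rewrite xgetPN// => c [? ? _]; exact: nd.
have rE M : (N <= M)%N -> multiplier_ratio z w x g M =
    pf z w (pi_ N (act x g)) / pf z w (pi_ N x).
  move=> NM; rewrite /multiplier_ratio.
  rewrite (f_zw_pf _ _ (proj1 (virtual_unitary'P _) xg' M)).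
  rewrite (f_zw_pf _ _ (proj1 (virtual_unitary'P _) x' M)).
  by rewrite -(subnK NM) pf_ratio.
apply: xget_unique => [|c [_ _ hc]].
  by split=> //; exists N => // M /= NM; exact: rE.
have [M [<- NM]] : exists M, multiplier_ratio z w x g M = c /\ (N <= M)%N.
  have [M0 _ h0] := hc; exists (maxn M0 N).
  by split; [apply: h0; exact: leq_maxl|exact: leq_maxr].
by rewrite rE.
Qed.

Lemma multiplier_mdom z w N x g : in_levelG N g -> mdom g x ->
  multiplier z w x g = pf z w (pi_ N (act x g)) / pf z w (pi_ N x).
Proof. by move=> gN xg; rewrite (multiplierE _ _ _ gN) (asboolT xg). Qed.

Lemma measurable_virtual_unitary' : measurable (@virtual_unitary' R).
Proof.
rewrite (_ : @virtual_unitary' R = \bigcap_N (@pi_ R N @^-1` @unitary' R N)).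
  apply: bigcap_measurable => [|N _]; first by exists 0%N.
  rewrite -[X in measurable X]setTI.
  by apply: measurable_pi => //; exact: measurable_unitary'.
apply/seteqP; split=> x; first by move=> /virtual_unitary'P h N _; exact: h.
by move=> h; apply/virtual_unitary'P => N; exact: (h N I).
Qed.

Lemma measurable_mdom g : measurable (mdom g).
Proof.
apply: measurableI; first exact: measurable_virtual_unitary'.
rewrite -[X in measurable X]setTI; apply: measurable_act => //.
exact: measurable_virtual_unitary'.
Qed.

Lemma cmeas_multiplier z w g : cmeas (fun x => multiplier z w x g).
Proof.
have gN : in_levelG (levelG g) g by exact/in_levelGE.
rewrite (_ : (fun x => _) = (fun x => if `[< mdom g x >] then
  pf z w (pi_ (levelG g) (act x g)) / pf z w (pi_ (levelG g) x) else 0)); last first.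
  by apply/funext => x; exact: multiplierE.
apply: cmeas_if; last exact: cmeas_cst.
  have := measurable_mdom g; congr measurable.
  by apply/seteqP; split=> x /=; [move=> ?; exact/asboolP|move/asboolP].
apply: cmeasM.
  by apply: (cmeas_comp _ (@cmeas_pf R z w (levelG g))); exact: measurable_pi_act.
apply: cmeasV; apply: (cmeas_comp _ (@cmeas_pf R z w (levelG g))).
exact: measurable_pi.
Qed.

(** At a level common to g and h the quotients telescope through the nonzero value of [pf] at
    [act x g]. This cocycle identity yields the homomorphism property. *)
Lemma multiplierM z w x g h : mdom g x -> mdom h (act x g) ->
  multiplier z w x (g * h)%g = multiplier z w (act x g) h * multiplier z w x g.
Proof.
have [gN hN] := in_levelG_max g h.
move=> dg dh; have d : mdom (g * h)%g x.
  by split; [exact: dg.1|rewrite actM; exact: dh.2].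
have e1 : multiplier z w x (g * h)%g = pf z w (pi_ (maxn (levelG g) (levelG h)) (act (act x g) h)) /
    pf z w (pi_ (maxn (levelG g) (levelG h)) x).
  by rewrite -actM; exact: multiplier_mdom (in_levelGM gN hN) d.
apply: etrans e1 _; apply: etrans _ (esym (congr2 *%R
  (multiplier_mdom z w hN dh) (multiplier_mdom z w gN dg))).
by rewrite mulrA divfK ?pf_neq0.
Qed.

(** The diagonal acts by conjugation. Conjugation invariance is not visible on the pivots, so [pf]
    is traded for [f_zw], which depends on the eigenvalues only. *)
Lemma multiplier_diag z w x (u : unitary_inf R) : mdom (u, u) x -> multiplier z w x (u, u) = 1.
Proof.
move=> d; have [x' xu'] := d; have uN : in_levelG (levelG (u, u)) (u, u) by exact/in_levelGE.
rewrite (multiplier_mdom _ _ uN d).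
rewrite -(f_zw_pf _ _ (proj1 (virtual_unitary'P _) xu' _)).
rewrite -(f_zw_pf _ _ (proj1 (virtual_unitary'P _) x' _)).
rewrite (pi_act_shift _ uN) /Defs.shift f_zw_conj divff//.
by rewrite (f_zw_pf _ _ (proj1 (virtual_unitary'P _) x' _)) pf_neq0.
Qed.

(** The squared multiplier is a ratio of weights, that is, the Radon-Nikodym factor relating [mu] to
    its translate once [lam] is known to be invariant. *)
Lemma sqr_multiplier z w N x g : in_levelG N g -> mdom g x ->
  normc (multiplier z w x g) ^+ 2 = (wt z w N (act x g))^-1 * wt z w N x.
Proof.
move=> gN xg; rewrite (multiplier_mdom _ _ gN xg) normcM normcV exprMn exprVn.
by rewrite /wt invrK.
Qed.

End Multiplier.

(** * The unitary operators *)

Section L2Extra.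
Context d (T : measurableType d) (R : realType) (mu : {measure set T -> \bar R}).
Implicit Types (f g : L2 mu) (u v : L2fun mu).

Lemma L2_fun_class u : {ae mu, forall x, L2_fun (L2_class u) x = val u x}.
Proof. by have /L2_classP := L2_classK (L2_class u). Qed.

Lemma L2_eqP f g : f = g <-> {ae mu, forall x, L2_fun f x = L2_fun g x}.
Proof. by rewrite -L2_classP !L2_classK. Qed.

Lemma L2_funL a f g :
  {ae mu, forall x, L2_fun (a *: f + g) x = a * L2_fun f x + L2_fun g x}.
Proof.
have -> : a *: f + g = L2_class (a *: (repr f : L2fun mu) + repr g).
  by rewrite L2_classD L2_classK -L2_scale_class L2_classK.
apply: filterS (L2_fun_class (a *: (repr f : L2fun mu) + repr g)) => x ->.
by rewrite linearP.
Qed.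

Lemma L2P f : cmeas (L2_fun f) /\ (\int[mu]_x (normc (L2_fun f x) ^+ 2)%:E < +oo)%E.
Proof. by have /asboolP[mr mi fin] := valP (repr f : L2fun mu). Qed.

Lemma L2funP u : cmeas (val u) /\ (\int[mu]_x (normc (val u x) ^+ 2)%:E < +oo)%E.
Proof. by have /asboolP[mr mi fin] := valP u. Qed.

Lemma aeI (P Q : T -> Prop) : {ae mu, forall x, P x} -> {ae mu, forall x, Q x} ->
  {ae mu, forall x, P x /\ Q x}.
Proof. by move=> p q; apply: filterS2 p q => x px qx; split. Qed.

End L2Extra.

Section Operator.
Variables (R : realType) (s z w : R[i]).
Hypothesis hzw : z + Num.conj w = s.
Variable haar : forall N : nat, probability (unitary R N) R.
Hypothesis hhaar : forall N : nat, is_haar (haar N).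
Variable mu : probability (virtual_unitary R) R.
Hypothesis hmu : is_mu_s haar s mu.
Local Notation V := (virtual_unitary R).
Local Notation lam := (lam z w mu).
Local Notation wt := (wt z w).
Implicit Types (g h : Ginf R).

Lemma ae_virtual_unitary' : {ae mu, forall x, @virtual_unitary' R x}.
Proof.
have h N : mu.-negligible (@pi_ R N @^-1` ~` @unitary' R N).
  have mU : measurable (~` @unitary' R N) by apply: measurableC; exact: measurable_unitary'.
  apply/negligibleP; first by rewrite -[X in measurable X]setTI; exact: measurable_pi.
  apply: etrans (hmu mU) _; rewrite /mu_N; under eq_integral => u.
    rewrite inE => u'; rewrite (densityE _ hzw) indicE memNset// mulr0.
    over.
  by rewrite integral0.
apply: negligibleS (negligible_bigcup h) => x /= nx.
apply: contrapT => nb; apply: nx; apply/virtual_unitary'P => N.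
by apply: contrapT => nN; apply: nb; exists N.
Qed.

Lemma lam0_mu0 N (A : set V) : measurable A -> lam N A = 0%E -> mu A = 0%E.
Proof.
move=> mA; rewrite /lam => h.
have /(ae_eq_integral_abs mu mA) : (\int[mu]_(x in A) `|(wt N x)%:E| = 0)%E.
  by under eq_integral do rewrite gee0_abs ?lee_fin ?ltW ?wt_gt0//.
have mw : measurable_fun A (fun x => (wt N x)%:E).
  by apply: measurable_funTS; exact: measurable_wtE.
move=> /(_ mw) [B [mB B0 AB]]; apply/negligibleP => //; exists B; split=> //.
move=> x Ax; apply: AB => /= /(_ Ax) /eqP.
by rewrite eqe gt_eqF// wt_gt0.
Qed.

Lemma mu0_lam0 N (A : set V) : measurable A -> mu A = 0%E -> lam N A = 0%E.
Proof.
move=> mA A0; rewrite /lam null_set_integral//.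
by apply: measurable_funTS; exact: measurable_wtE.
Qed.

(** Quasi-invariance: the weight is finite and positive, so [mu] and [lam] have the same null sets,
    and [lam] at the level of g is invariant under g. *)
Lemma ae_act g (P : V -> Prop) : {ae mu, forall x, P x} -> {ae mu, forall x, P (act x g)}.
Proof.
have gN : in_levelG (levelG g) g by exact/in_levelGE.
move=> [B [mB B0 PB]]; exists ((fun x => act x g) @^-1` B); split.
- by rewrite -[X in measurable X]setTI; exact: measurable_act.
- apply: (@lam0_mu0 (levelG g)).
    by rewrite -[X in measurable X]setTI; exact: measurable_act.
  by rewrite (lam_act hzw hhaar hmu gN mB); exact: mu0_lam0.
- by move=> x /= nP; exact: PB.
Qed.

Lemma ae_mdom g : {ae mu, forall x, mdom g x}.
Proof. by apply: aeI; [|apply: ae_act]; exact: ae_virtual_unitary'. Qed.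

Local Notation mult := (multiplier z w).

Lemma measurable_sqr_mult g : measurable_fun setT (fun x : V => normc (mult x g) ^+ 2).
Proof. by apply: measurable_funX; apply: measurable_normc; exact: cmeas_multiplier. Qed.

Lemma integral_act_mult g (K : V -> \bar R) :
  measurable_fun setT K -> (forall x, 0 <= K x)%E ->
  (\int[mu]_x (K (act x g) * (normc (mult x g) ^+ 2)%:E) = \int[mu]_x K x)%E.
Proof.
move=> mK K0; pose N := levelG g; have gN : in_levelG N g by exact/in_levelGE.
have ma := measurable_act g.
have wt0 x : (0 <= (wt N x)^-1)%R by rewrite invr_ge0 ltW// wt_gt0.
have mwV : measurable_fun setT (fun x : V => ((wt N x)^-1)%:E).
  by apply/measurable_EFinP; apply: measurable_funVr; exact: measurable_wt.
(* Dividing by the weight turns the integral of [K] against [mu] into that of [K'] against the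
   invariant measure; after translation the two weights combine to the squared multiplier. *)
pose K' x := (K x * ((wt N x)^-1)%:E)%E.
have mK' : measurable_fun setT K' by exact: emeasurable_funM.
have K'0 x : (0 <= K' x)%E by rewrite mule_ge0// lee_fin.
transitivity (\int[lam N]_x K' (act x g))%E; last first.
  rewrite (integral_lam_act hzw hhaar hmu gN mK' K'0) (integral_lam _ _ _ N mK' K'0).
  apply: eq_integral => x _; rewrite /K' -muleA -EFinM mulVf ?mule1//.
  by rewrite gt_eqF// wt_gt0.
have mKa : measurable_fun setT (fun x => K' (act x g)) by exact: measurableT_comp mK' ma.
rewrite (integral_lam _ _ _ N mKa)//.
apply: ae_eq_integral => //.
- apply: emeasurable_funM; first exact: measurableT_comp mK ma.
  by apply/measurable_EFinP; exact: measurable_sqr_mult.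
- by apply: emeasurable_funM => //; exact: measurable_wtE.
- apply: filterS (ae_mdom g) => x xg _.
  by rewrite (sqr_multiplier _ _ gN xg) /K' EFinM muleA.
Qed.

(** Positive and negative parts are transformed separately; the factor is nonnegative, so it
    commutes with taking them. *)
Lemma integral_act_mult_real g (H : V -> R) : measurable_fun setT H ->
  (\int[mu]_x (H (act x g) * normc (mult x g) ^+ 2)%:E = \int[mu]_x (H x)%:E)%E.
Proof.
move=> mH; have mHE : measurable_fun setT (EFin \o H) by exact/measurable_EFinP.
rewrite integralE [RHS]integralE; congr (_ - _)%E.
- rewrite -(integral_act_mult g (K := (EFin \o H)^\+%E)).
  + apply: eq_integral => x _; rewrite !funeposE /= EFinM.
    by rewrite maxeMl ?lee_fin ?sqr_ge0// mul0e.
  + exact: measurable_funepos.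
  + by move=> x; exact: funepos_ge0.
- rewrite -(integral_act_mult g (K := (EFin \o H)^\-%E)).
  + apply: eq_integral => x _; rewrite !funenegE /= -mulNr EFinM.
    by rewrite maxeMl ?lee_fin ?sqr_ge0// mul0e.
  + exact: measurable_funeneg.
  + by move=> x; exact: funeneg_ge0.
Qed.

Lemma op_subproof g (f : L2fun mu) :
  (fun x => val f (act x g) * mult x g) \in L2_pred mu.
Proof.
have [mf fin] := L2funP f.
have mfa : cmeas (fun x => val f (act x g)) by apply: cmeas_comp mf; exact: measurable_act.
have [mr mi] := cmeasM mfa (cmeas_multiplier z w g).
apply/asboolP; split=> //.
under eq_integral do rewrite normcM exprMn EFinM.
rewrite (integral_act_mult g (K := fun x => (normc (val f x) ^+ 2)%:E))//.
- by apply/measurable_EFinP; apply: measurable_funX; exact: measurable_normc.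
- by move=> x; rewrite lee_fin sqr_ge0.
Qed.

Definition op g (f : L2 mu) : L2 mu :=
  L2_class (exist (fun u : V -> R[i] => u \in L2_pred mu) _ (op_subproof g (repr f))).

Lemma op_fun g f : {ae mu, forall x, L2_fun (op g f) x = L2_fun f (act x g) * mult x g}.
Proof. exact: L2_fun_class. Qed.

(** Independence of the representative: the null set on which two representatives differ stays null
    when pulled back along g. *)
Lemma op_class g (f : L2fun mu) :
  {ae mu, forall x, L2_fun (op g (L2_class f)) x = val f (act x g) * mult x g}.
Proof.
apply: filterS2 (op_fun g (L2_class f)) (ae_act g (L2_fun_class f)) => x ->.
by move=> ->.
Qed.

Lemma op_linear g : linear (op g).
Proof.
move=> a f h; apply/L2_eqP.
apply: filterS (aeI (aeI (op_fun g (a *: f + h)) (ae_act g (L2_funL a f h)))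
  (aeI (L2_funL a (op g f) (op g h)) (aeI (op_fun g f) (op_fun g h)))).
by move=> x [[-> ->] [-> [-> ->]]]; rewrite mulrDl mulrA.
Qed.

Lemma op_dot g (f h : L2 mu) : L2_dot (op g f) (op g h) = L2_dot f h.
Proof.
have [mf _] := L2P f; have [mh _] := L2P h.
have [mopf _] := L2P (op g f); have [moph _] := L2P (op g h).
have [mr mi] := cmeasM mf (cmeasJ mh).
have [mopr mopi] := cmeasM mopf (cmeasJ moph).
have ma := measurable_act g.
have e : {ae mu, forall x, L2_fun (op g f) x * Num.conj (L2_fun (op g h) x) =
    L2_fun f (act x g) * Num.conj (L2_fun h (act x g)) * (normc (mult x g) ^+ 2)%:C}.
  apply: filterS (aeI (op_fun g f) (op_fun g h)) => x [-> ->].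
  rewrite rmorphM mulrACA; congr (_ * _).
  by rewrite Defs.sqr_normc; apply: eqC; rewrite ?ReM ?ImM ReJ ImJ /=; ring.
rewrite /L2_dot /cintegral; congr (_ +i* _); rewrite /Rintegral; congr fine.
- rewrite -(integral_act_mult_real g mr).
  apply: ae_eq_integral => //; first exact/measurable_EFinP.
    apply/measurable_EFinP; apply: measurable_funM; last exact: measurable_sqr_mult.
    exact: measurableT_comp mr ma.
  by apply: filterS e => x -> _; rewrite ReM /= mulr0 subr0.
- rewrite -(integral_act_mult_real g mi).
  apply: ae_eq_integral => //; first exact/measurable_EFinP.
    apply/measurable_EFinP; apply: measurable_funM; last exact: measurable_sqr_mult.
    exact: measurableT_comp mi ma.
  by apply: filterS e => x -> _; rewrite ImM /= mulr0 add0r.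
Qed.

Lemma opM g h f : op (g * h)%g f = op g (op h f).
Proof.
apply/L2_eqP.
apply: filterS (aeI (aeI (op_fun (g * h)%g f) (op_fun g (op h f)))
  (aeI (ae_act g (op_fun h f)) (aeI (ae_mdom g) (ae_act g (ae_mdom h))))).
move=> x [[e1 e2] [e3 [xg xgh]]].
rewrite e1 e2 e3 actM -mulrA; congr (_ * _).
exact: multiplierM.
Qed.

Lemma op_id f : op 1%g f = f.
Proof.
apply/L2_eqP; apply: filterS (aeI (op_fun 1%g f) (ae_mdom 1%g)) => x [-> d].
rewrite act1 [multiplier _ _ _ _](_ : _ = 1) ?mulr1//.
exact: (@multiplier_diag R z w x 1%g d).
Qed.

Lemma op_cst (u : unitary_inf R) c : op (u, u) (L2_cst mu c) = L2_cst mu c.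
Proof.
pose k : L2fun mu := exist (fun f : V -> R[i] => f \in L2_pred mu) _ (L2_cst_subproof mu c).
apply/L2_eqP.
apply: filterS (aeI (op_class (u, u) k) (aeI (L2_fun_class k) (ae_mdom (u, u)))).
move=> x [e1 [e2 d]]; apply: etrans e1 _; apply: etrans _ (esym e2).
by rewrite (multiplier_diag _ _ d) mulr1.
Qed.

Lemma op_unitary g : is_unitary_operator (op g).
Proof.
split=> [|f h|f]; [exact: op_linear|exact: op_dot|].
by exists (op g^-1%g f); rewrite -opM mulgV op_id.
Qed.

End Operator.

(** * Continuity of measure-preserving translations *)

Section ContinuityInMeasure.
Context d (T : measurableType d) (R : realType) (m : {measure set T -> \bar R}).
Hypothesis mfin : (m setT < +oo)%E.
Context (X : Type) (F : set_system X) {FF : Filter F} (tau : X -> T -> T).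
Hypothesis mtau : forall g, measurable_fun setT (tau g).
Hypothesis inv : forall g A, measurable A -> m (tau g @^-1` A) = m A.

Let mpre g A : measurable A -> measurable (tau g @^-1` A).
Proof. by move=> mA; rewrite -[X in measurable X]setTI; exact: mtau. Qed.

Let fin A : measurable A -> (m A \is a fin_num)%E.
Proof.
move=> mA; rewrite ge0_fin_numE//; apply: le_lt_trans mfin.
by rewrite le_measure ?inE.
Qed.

Lemma inv_integral g (K : T -> \bar R) :
  measurable_fun setT K -> (forall x, 0 <= K x)%E ->
  (\int[m]_x K (tau g x) = \int[m]_x K x)%E.
Proof.
move=> mK K0.
transitivity (\int[pushforward m (tau g)]_x K x)%E.
  by rewrite ge0_integral_pushforward//= preimage_setT.
by apply: eq_measure_integral => A mA _; exact: inv.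
Qed.

(** Both sides are the common finite measure of A and its preimage minus that of their intersection.
    This symmetry is what handles complements below. *)
Lemma measure_diff_sym g A : measurable A ->
  m (tau g @^-1` A `\` A) = m (A `\` tau g @^-1` A).
Proof.
move=> mA; have mgA := mpre g mA.
have finA : (m A < +oo)%E by rewrite -ge0_fin_numE//; exact: fin.
have fingA : (m (tau g @^-1` A) < +oo)%E by rewrite inv.
rewrite !measureD//; congr (_ - _)%E; [exact: inv|by rewrite setIC].
Qed.

Lemma decreasing_small (B : nat -> set T) (e : R) : (forall n, measurable (B n)) ->
  nonincreasing_seq B -> \bigcap_n B n = set0 -> 0 < e ->
  exists n, (m (B n) <= e%:E)%E.
Proof.
move=> mB nB B0 e0.
have : m \o B @ \oo --> m (\bigcap_n B n).
  apply: nonincreasing_cvg_mu => //; last by rewrite B0.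
  by rewrite -ge0_fin_numE//; exact: fin.
rewrite B0 measure0 => /fine_cvgP[_ /cvgrPdist_le/(_ _ e0)] [n _ /(_ n (leqnn _))] /=.
rewrite sub0r normrN ger0_norm; last exact: fine_ge0.
by exists n; rewrite -(fineK (fin (mB n))) lee_fin.
Qed.

(** The one-sided difference is enough, the opposite one having the same measure by invariance. *)
Definition cset (A : set T) : Prop := measurable A /\
  forall e : R, 0 < e -> \forall g \near F, (m (A `\` tau g @^-1` A) <= e%:E)%E.

Lemma csetU A B : cset A -> cset B -> cset (A `|` B).
Proof.
move=> [mA cA] [mB cB]; split=> [|e e0]; first exact: measurableU.
have e2 : 0 < e / 2 by rewrite divr_gt0.
apply: filterS2 (cA _ e2) (cB _ e2) => g gA gB.
rewrite (splitr e) EFinD; apply: le_trans (leeD gA gB).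
have ? := mpre g mA; have ? := mpre g mB.
apply: (@le_trans _ _ (m ((A `\` tau g @^-1` A) `|` (B `\` tau g @^-1` B)))).
  rewrite le_measure ?inE//.
  - by rewrite preimage_setU; apply: measurableD; exact: measurableU.
  - by apply: measurableU; exact: measurableD.
  move=> x [[Ax|Bx] /not_orP[nA nB]]; [left|right]; by split.
by apply: measureU2; exact: measurableD.
Qed.

Lemma cset_sigma_algebra : sigma_algebra setT cset.
Proof.
split.
- split=> // e e0; near=> g; by rewrite set0D measure0 lee_fin ltW.
- move=> A [mA cA]; split=> [|e e0]; first exact: measurableD.
  apply: filterS (cA _ e0) => g; rewrite -measure_diff_sym//; congr (m _ <= _)%E.
  apply/seteqP; split=> x /=; first by move=> [gA nA]; split=> // -[].
  by move=> [[_ nA] gA]; split=> //; apply: contrapT => n; apply: gA.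
move=> A cA; have mA n : measurable (A n) by case: (cA n).
pose B n := \bigcup_(k < n) A k; set U := \bigcup_n A n.
have mU : measurable U by exact: bigcupT_measurable.
have mB n : measurable (B n) by exact: bigcup_measurable.
have cB n : cset (B n).
  elim: n => [|n IH].
    rewrite /B bigcup0//; split=> // e e0; near=> g; by rewrite set0D measure0 lee_fin ltW.
  rewrite (_ : B n.+1 = B n `|` A n); first exact: csetU.
  apply/seteqP; split=> x.
    move=> [k /=]; rewrite ltnS leq_eqVlt => /orP[/eqP->|kn] Ax; first by right.
    by left; exists k.
  by move=> [[k /= kn Ax]|Ax]; [exists k => //=; exact: ltnW|exists n => /=].
split=> // e e0; have e2 : 0 < e / 2 by rewrite divr_gt0.
have [n Un] : exists n, (m (U `\` B n) <= (e / 2)%:E)%E.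
  apply: decreasing_small => //.
  - by move=> n; exact: measurableD.
  - move=> i j ij; apply/subsetPset => x [Ux nB]; split=> // -[k /= ki Ax].
    by apply: nB; exists k => //=; exact: leq_trans ij.
  - apply/seteqP; split=> // x h; have [[k _ Ax] _] := h 0%N I.
    by have [_] := h k.+1 I; apply; exists k => /=.
have [_ /(_ _ e2)] := cB n; apply: filterS => g gB.
rewrite (splitr e) EFinD; apply: le_trans (leeD Un gB).
have ? := mpre g mU; have ? := mpre g (mB n).
(* A point leaving U either lies outside the finite union [B n], a small set chosen before g, or
   leaves [B n]. *)
apply: (@le_trans _ _ (m ((U `\` B n) `|` (B n `\` tau g @^-1` B n)))).
  rewrite le_measure ?inE//.
  - exact: measurableD.
  - by apply: measurableU; exact: measurableD.
  move=> x [Ux nU]; have [Bx|nB] := pselect (B n x); [right|left] => //.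
  by split=> // -[k _ Ax]; apply: nU; exists k.
by apply: measureU2; exact: measurableD.
Unshelve. all: by end_near. Qed.

Definition cfun (G : T -> R) : Prop := measurable_fun setT G /\
  forall e : R, 0 < e ->
    \forall g \near F, (\int[m]_x `|G (tau g x) - G x|%:E <= e%:E)%E.

Let mdist (G H : T -> R) g : measurable_fun setT G -> measurable_fun setT H ->
  measurable_fun setT (fun x => `|G (tau g x) - H x|%:E : \bar R).
Proof.
move=> mG mH; apply/measurable_EFinP; apply: measurableT_comp => //.
by apply: measurable_funB => //; exact: measurableT_comp.
Qed.

Lemma cfun_indic A : cset A -> cfun (\1_A).
Proof.
move=> [mA cA]; split=> [|e e0]; first exact: measurable_indic.
have e2 : 0 < e / 2 by rewrite divr_gt0.
apply: filterS (cA _ e2) => g gA; have mgA := mpre g mA.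
rewrite (_ : (\int[m]_x _)%E = m ((A `\` tau g @^-1` A) `|` (tau g @^-1` A `\` A))).
  rewrite measureU//; [|exact: measurableD|exact: measurableD|].
    rewrite (splitr e) EFinD; apply: leeD => //; apply: le_trans gA.
    by rewrite le_eqVlt; apply/orP; left; apply/eqP; exact: measure_diff_sym.
  by apply/seteqP; split=> // x [[Ax _] [_ nA]].
set S := (_ `|` _); have mS : measurable S by apply: measurableU; exact: measurableD.
have <- : (\int[m]_x (\1_S x)%:E = m S)%E by rewrite integral_indic// setIT.
rewrite /S; apply: eq_integral => x _; congr (_%:E); rewrite !indicE.
have -> : (x \in (A `\` tau g @^-1` A) `|` (tau g @^-1` A `\` A)) =
    (x \in A) (+) (tau g x \in A).
  rewrite in_setU !in_setD; have -> : (x \in tau g @^-1` A) = (tau g x \in A) by [].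
  by case: (x \in A); case: (tau g x \in A).
by case: (x \in A); case: (tau g x \in A); rewrite /= ?subrr ?subr0 ?sub0r ?normrN ?normr0 ?normr1.
Qed.

Lemma cfunZ (a : R) G : cfun G -> cfun (fun x => a * G x).
Proof.
move=> [mG cG]; split=> [|e e0]; first exact: measurable_funM.
(* Adding 1 allows division also when a = 0. *)
have a1 : 0 < `|a| + 1 by rewrite ltr_pwDr.
have ea : 0 < e / (`|a| + 1) by rewrite divr_gt0.
apply: filterS (cG _ ea) => g gG.
under eq_integral do rewrite -mulrBr normrM EFinM.
rewrite ge0_integralZl//; last exact: mdist.
apply: (@le_trans _ _ ((`|a| + 1)%:E * (e / (`|a| + 1))%:E)%E).
  apply: lee_pmul => //; first by apply: integral_ge0 => x _; rewrite lee_fin.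
  by rewrite lee_fin lerDl.
by rewrite -EFinM mulrC divfK ?gt_eqF.
Qed.

Lemma le_integral_triangle (p q r : T -> R) (e1 e2 : R) :
  measurable_fun setT p -> measurable_fun setT q -> measurable_fun setT r ->
  (forall x, 0 <= q x) -> (forall x, 0 <= r x) -> (forall x, 0 <= p x <= q x + r x) ->
  (\int[m]_x (q x)%:E <= e1%:E)%E -> (\int[m]_x (r x)%:E <= e2%:E)%E ->
  (\int[m]_x (p x)%:E <= (e1 + e2)%:E)%E.
Proof.
move=> mp mq mr q0 r0 pqr qe re; rewrite EFinD; apply: le_trans (leeD qe re).
rewrite -ge0_integralD//; do ?[by move=> x _; rewrite lee_fin | exact/measurable_EFinP].
apply: ge0_le_integral => //.
- by move=> x _; rewrite lee_fin; have /andP[] := pqr x.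
- exact/measurable_EFinP.
- by apply: emeasurable_funD; exact/measurable_EFinP.
- by move=> x _; rewrite -EFinD lee_fin; have /andP[] := pqr x.
Qed.

Lemma cfunD G H : cfun G -> cfun H -> cfun (fun x => G x + H x).
Proof.
move=> [mG cG] [mH cH]; split=> [|e e0]; first exact: measurable_funD.
have e2 : 0 < e / 2 by rewrite divr_gt0.
apply: filterS2 (cG _ e2) (cH _ e2) => g gG gH; rewrite (splitr e).
apply: (le_integral_triangle _ _ _ _ _ _ gG gH); do ?[exact/measurable_EFinP/mdist|by []].
  by apply/measurable_EFinP/(@mdist (fun x => G x + H x) (fun x => G x + H x) g); exact: measurable_funD.
move=> x; rewrite normr_ge0/=; apply: le_trans (ler_normD _ _).
by rewrite opprD addrACA.
Qed.

Lemma cfun_sum (J : Type) (r : seq J) (G : J -> T -> R) :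
  (forall j, cfun (G j)) -> cfun (fun x => \sum_(j <- r) G j x).
Proof.
move=> cG; elim: r => [|j r IH].
  under eq_fun do rewrite big_nil; split=> // e e0; near=> g.
  by under eq_integral do rewrite subrr normr0; rewrite integral0 lee_fin ltW.
by under eq_fun do rewrite big_cons; exact: cfunD.
Unshelve. all: by end_near. Qed.

Hypothesis allc : forall A, measurable A -> cset A.

(** A three-term estimate through a simple approximation: by invariance the translated approximation
    error has the same integral as the error itself, so one approximation serves all g. *)
Lemma cfun_integrable (G : T -> R) : m.-integrable setT (EFin \o G) -> cfun G.
Proof.
move=> iG; have mGE := measurable_int m iG; have mG := (measurable_EFinP _ _).1 mGE.
split=> // e e0; have e3 : 0 < e / 3 by rewrite divr_gt0.
have [h [ih _ hG]] := approximation_sfun_integrable measurableT iG.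
have [n hn] : exists n, (\int[m]_x `|(G x)%:E - (h n x)%:E| <= (e / 3)%:E)%E.
  move/fine_cvgP : hG => [[k1 _ f1] /cvgrPdist_le/(_ _ e3)] [k2 _ f2].
  exists (maxn k1 k2); have {}f1 := f1 _ (leq_maxl k1 k2); have := f2 _ (leq_maxr k1 k2).
  rewrite /= sub0r normrN ger0_norm; last by apply: fine_ge0; exact: integral_ge0.
  by rewrite -(fineK f1) lee_fin.
have mh : measurable_fun setT (h n) by exact/measurable_EFinP/(measurable_int m (ih n)).
have {}hn : (\int[m]_x `|G x - h n x|%:E <= (e / 3)%:E)%E by [].
have [_ /(_ _ e3)] : cfun (h n).
  have [r ->] : exists r : seq R,
      (h n : T -> R) = fun x => \sum_(y <- r) y * \1_(h n @^-1` [set y]) x.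
    by eexists; apply/funext => x; rewrite fimfunE fsbig_finite.
  apply: cfun_sum => i; apply: cfunZ; apply: cfun_indic; apply: allc.
  by rewrite -[X in measurable X]setTI; exact: mh.
apply: filterS => g gh.
have hng : (\int[m]_x `|G (tau g x) - h n (tau g x)|%:E <= (e / 3)%:E)%E.
  rewrite (inv_integral g (K := fun x => `|G x - h n x|%:E))//.
  by apply/measurable_EFinP; apply: measurableT_comp => //; exact: measurable_funB.
have mGh : measurable_fun setT (fun x => `|G x - h n x|).
  by apply: measurableT_comp => //; exact: measurable_funB.
have mhh : measurable_fun setT (fun x => `|h n (tau g x) - h n x|).
  exact/measurable_EFinP/mdist.
have mGhg : measurable_fun setT (fun x => `|G (tau g x) - h n (tau g x)|).
  exact: measurableT_comp mGh (mtau g).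
have -> : e = e / 3 + (e / 3 + e / 3) by field.
apply: (le_integral_triangle (q := fun x => `|G (tau g x) - h n (tau g x)|)
  (r := fun x => `|h n (tau g x) - h n x| + `|G x - h n x|) _ _ _ _ _ _ hng) => //.
- exact/measurable_EFinP/mdist.
- exact: measurable_funD.
- move=> x; rewrite normr_ge0/= (_ : G (tau g x) - G x = (G (tau g x) - h n (tau g x)) +
    ((h n (tau g x) - h n x) + - (G x - h n x))); last by ring.
  apply: le_trans (ler_normD _ _) _; rewrite lerD2l.
  by apply: le_trans (ler_normD _ _) _; rewrite normrN.
apply: (le_integral_triangle _ _ _ _ _ _ gh hn) => //; first exact: measurable_funD.
by move=> x /=; rewrite addr_ge0/=.
Qed.

(** The square is given a sign so that a and -a stay apart. For equal signs (a - b)^2 <= |a - b| |a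
    + b|; for opposite signs (a - b)^2 <= 2 (a^2 + b^2), whence the factor 2. *)
Lemma sqr_dist_le (a b : R) : (a - b) ^+ 2 <= 2 * `|a * `|a| - b * `|b| |.
Proof.
have key (x y : R) : 0 <= x -> 0 <= y -> (x - y) ^+ 2 <= `|x * x - y * y|.
  move=> x0 y0; rewrite -!expr2 subr_sqr normrM [`|x + y|]ger0_norm ?addr_ge0//.
  by rewrite -[leLHS]ger0_norm ?sqr_ge0// normrX expr2 ler_wpM2l// ler_norml; apply/andP; split; lra.
have le2 (x y : R) : x <= `|y| -> x <= 2 * `|y|.
  by move=> h; apply: le_trans h _; rewrite ler_peMl// ler1n.
case: (ger0P a) => a0; case: (ger0P b) => b0.
- by apply: le2; exact: key.
- rewrite mulrN opprK ger0_norm; first by have := sqr_ge0 (a + b); nra.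
  by rewrite -!expr2 addr_ge0 ?sqr_ge0.
- rewrite mulrN -opprD normrN ger0_norm; first by have := sqr_ge0 (a + b); nra.
  by rewrite -!expr2 addr_ge0 ?sqr_ge0.
- have -> : a * - a - b * - b = - (- a * - a - - b * - b) by ring.
  have -> : (a - b) ^+ 2 = (- a - - b) ^+ 2 by ring.
  by rewrite normrN; apply: le2; apply: key; rewrite oppr_ge0 ltW.
Qed.

(* By sqr_dist_le it is enough to have L1 continuity of the signed squares of the
   real and imaginary parts. *)
Lemma L2_continuity (G : T -> R[i]) : cmeas G ->
  (\int[m]_x (normc (G x) ^+ 2)%:E < +oo)%E -> forall e : R, 0 < e ->
  \forall g \near F, (\int[m]_x (normc (G (tau g x) - G x) ^+ 2)%:E <= e%:E)%E.
Proof.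
move=> mG Gfin e e0; have [mr mi] := mG.
pose P x := Re (G x) * `|Re (G x)|; pose Q x := Im (G x) * `|Im (G x)|.
have mP : measurable_fun setT P by apply: measurable_funM => //; exact: measurableT_comp.
have mQ : measurable_fun setT Q by apply: measurable_funM => //; exact: measurableT_comp.
have int (H : T -> R) : measurable_fun setT H -> (forall x, `|H x| <= normc (G x) ^+ 2) ->
    m.-integrable setT (EFin \o H).
  move=> mH HG; apply/integrableP; split; first exact/measurable_EFinP.
  apply: le_lt_trans Gfin; apply: ge0_le_integral => //.
  - by apply/measurable_EFinP; exact: measurableT_comp.
  - by apply/measurable_EFinP; apply: measurable_funX; exact: measurable_normc.
  - by move=> x _; rewrite lee_fin.
have [_ cP] : cfun P.
  apply/cfun_integrable/int => // x; rewrite /P normrM normr_id -expr2 Defs.sqr_normc.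
  by rewrite -normrX ger0_norm ?sqr_ge0// lerDl sqr_ge0.
have [_ cQ] : cfun Q.
  apply/cfun_integrable/int => // x; rewrite /Q normrM normr_id -expr2 Defs.sqr_normc.
  by rewrite -normrX ger0_norm ?sqr_ge0// lerDr sqr_ge0.
(* A quarter for each of the two real components, on account of the factor 2 in [sqr_dist_le]. *)
have e4 : 0 < e / 4 by rewrite divr_gt0.
have scale (H : T -> R) g : measurable_fun setT H ->
   (\int[m]_x `|H (tau g x) - H x|%:E <= (e / 4)%:E)%E ->
   (\int[m]_x (2 * `|H (tau g x) - H x|)%:E <= (e / 2)%:E)%E.
  move=> mH h; under eq_integral do rewrite EFinM.
  rewrite ge0_integralZl//; last exact: mdist.
  by rewrite (_ : e / 2 = 2 * (e / 4)) ?EFinM ?lee_wpmul2l ?lee_fin//; field.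
apply: filterS2 (cP _ e4) (cQ _ e4) => g /(scale _ _ mP) gP /(scale _ _ mQ) gQ.
have m2 (H : T -> R) : measurable_fun setT H ->
    measurable_fun setT (fun x => 2 * `|H (tau g x) - H x|).
  by move=> mH; apply: measurable_funM => //; exact/measurable_EFinP/mdist.
rewrite (splitr e); apply: (le_integral_triangle _ _ _ _ _ _ gP gQ).
- apply: measurable_funX; apply: measurable_normc; apply: cmeasD; last exact: cmeasN.
  exact: cmeas_comp (mtau g) mG.
- exact: m2.
- exact: m2.
- by move=> x; rewrite mulr_ge0.
- by move=> x; rewrite mulr_ge0.
move=> x; rewrite sqr_ge0/= Defs.sqr_normc ReD ImD ReN ImN.
by apply: lerD; exact: sqr_dist_le.
Qed.

End ContinuityInMeasure.

(** * Strong continuity *)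

Section NearIdentity.
Variable R : realType.

Lemma normc_sum (I : Type) (r : seq I) (F : I -> R[i]) :
  normc (\sum_(i <- r) F i) <= \sum_(i <- r) normc (F i).
Proof.
elim: r => [|i r IH]; first by rewrite !big_nil normc0.
by rewrite !big_cons; apply: le_trans (normc_triangle _ _) _; rewrite lerD2l.
Qed.

Lemma normc_unitary_le1 M (u : unitary R M) i j : normc (val u i j) <= 1.
Proof.
have /matrixP/(_ i i) := unitarymxP (valP u); rewrite !mxE eqxx => /(congr1 (@Re R)).
rewrite Re_sum /= => h; rewrite -(@expr_le1 _ 2)// ?normc_ge0// -h (bigD1 j)//=.
rewrite !mxE Defs.sqr_normc ReM ReJ ImJ mulrN opprK -!expr2 lerDl.
by apply: sumr_ge0 => k _; rewrite !mxE ReM ReJ ImJ mulrN opprK -!expr2 addr_ge0// sqr_ge0.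
Qed.

Lemma normc_mulmx_le M (A B : 'M[R[i]]_M) (e : R) i j :
  (forall i j, normc (A i j) <= 1) -> (forall i j, normc (B i j) <= e) ->
  normc ((A *m B) i j) <= M%:R * e /\ normc ((B *m A) i j) <= M%:R * e.
Proof.
move=> A1 Be; split; rewrite mxE; apply: le_trans (normc_sum _ _) _;
  rewrite mulr_natl -[in X in _ <= X](card_ord M) -sumr_const;
  apply: ler_sum => k _; rewrite normcM.
- by rewrite -[e]mul1r ler_pM ?normc_ge0.
- by rewrite -[e]mulr1 ler_pM ?normc_ge0.
Qed.

Lemma ucorner_near N M (a : unitary R N) (e : R) i j : (N <= M)%N -> 0 < e ->
  ubox 1%g e a -> normc ((1%:M - val (ucorner M (uembed a))) i j) <= e.
Proof.
move=> NM e0 ae; rewrite val_ucorner// !mxE /stab.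
have d0 : normc ((i == j)%:R - ((i : nat) == j)%:R : R[i]) <= e by rewrite subrr normc0 ltW.
case: insubP => [i' _ ii'|_]; last by [].
case: insubP => [j' _ jj'|_]; last by [].
have := ae i' j'; rewrite !mxE => /ltW.
by rewrite -(inj_eq val_inj) /= ii' jj'.
Qed.

Definition emb N (ab : unitary R N * unitary R N) : Ginf R := (uembed ab.1, uembed ab.2).

Lemma in_levelG_emb N ab : in_levelG N (@emb N ab).
Proof. by split; eexists. Qed.

Lemma nbhs_unitary_ubox N (u : unitary R N) e : 0 < e -> nbhs u (ubox u e).
Proof.
move=> e0; apply: open_nbhs_nbhs; split; first exact: open_ubox.
by move=> i j; rewrite subrr normc0.
Qed.

(** The estimate is uniform in u because u - b^-1 u a = u (1 - a) + (1 - b^-1) u a and entries of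
    unitary matrices have modulus at most 1. *)
Lemma shift_near N M (e : R) : (N <= M)%N -> 0 < e ->
  \forall ab \near nbhs ((1%g, 1%g) : unitary R N * unitary R N),
    forall u : unitary R M, ubox u e (Defs.shift (emb ab) u).
Proof.
(* Each of the two products contributes at most M d; the extra 1 makes the final bound strict and
   the denominator positive. *)
move=> NM e0; pose d := e / (M%:R *+ 2 + 1).
have M0 : 0 < (M%:R *+ 2 + 1 : R) by rewrite ltr_pwDr// mulrn_wge0.
have d0 : 0 < d by rewrite divr_gt0.
exists (ubox 1%g d, ubox 1%g d); first by split; exact: nbhs_unitary_ubox.
move=> [a b] [/= ad bd] u i j.
set A := val (ucorner M (uembed a)); set B := (val (ucorner M (uembed b)))^t*.
have Ad k l : normc ((1%:M - A) k l) <= d by exact: ucorner_near.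
have Bd k l : normc ((1%:M - B) k l) <= d.
  have := ucorner_near l k NM d0 bd; rewrite -normcJ !mxE rmorphB/= conjC_nat.
  by rewrite eq_sym.
have -> : val u i j - val (Defs.shift (emb (a, b)) u) i j =
    (val u *m (1%:M - A)) i j + ((1%:M - B) *m (val u *m A)) i j.
  rewrite mulmxBr mulmx1 mulmxBl mul1mx mulmxA.
  rewrite [X in _ = X + _]mxE [X in _ = _ + X]mxE [X in _ + X + _]mxE [X in _ + (_ + X)]mxE.
  by rewrite -/A -/B /Defs.shift !val_unitaryM; ring.
apply: le_lt_trans (normc_triangle _ _) _.
have [h1 _] := @normc_mulmx_le M (val u) (1%:M - A) d i j (normc_unitary_le1 u) Ad.
have [_ h2] := @normc_mulmx_le M (val u *m A) (1%:M - B) d i j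
  (normc_unitary_le1 (u * ucorner M (uembed a))%g) Bd.
apply: le_lt_trans (lerD h1 h2) _.
rewrite -mulrDl -mulr2n /d mulrCA -[ltRHS]mulr1 ltr_pM2l// ltr_pdivrMr// mul1r.
by rewrite ltrDl.
Qed.

End NearIdentity.

(** * Borel sets under small translations *)

Section CylinderSets.
Variables (R : realType) (s z w : R[i]).
Hypothesis hzw : z + Num.conj w = s.
Variable haar : forall N : nat, probability (unitary R N) R.
Hypothesis hhaar : forall N : nat, is_haar (haar N).
Variable mu : probability (virtual_unitary R) R.
Hypothesis hmu : is_mu_s haar s mu.
Variable N : nat.
Local Notation V := (virtual_unitary R).
Local Notation lam := (lam z w mu).
Local Notation F := (nbhs ((1%g, 1%g) : unitary R N * unitary R N)).

Definition tau (ab : unitary R N * unitary R N) (x : V) : V := act x (emb ab).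

Lemma measurable_tau ab : measurable_fun setT (tau ab).
Proof. exact: measurable_act. Qed.

Lemma lam_tau ab A : measurable A -> lam N (tau ab @^-1` A) = lam N A.
Proof. by move=> mA; apply: (lam_act hzw hhaar hmu _ mA); exact: in_levelG_emb. Qed.

Let lamfin : (lam N setT < +oo)%E. Proof. exact: (lam_fin hzw hhaar hmu). Qed.

(* The points of O moved out of O by a small translation lie close to the
   boundary of O, in a set of small measure. *)
Lemma cset_open M (O : set (unitary R M)) : (N <= M)%N -> open O ->
  cset (lam N) F tau (@pi_ R M @^-1` O).
Proof.
move=> NM oO; have mpi B : measurable B -> measurable (@pi_ R M @^-1` B).
  by move=> mB; rewrite -[X in measurable X]setTI; exact: measurable_pi.
have mO : measurable O by exact: measurable_open_unitary.
split=> [|e e0]; first exact: mpi.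
pose r n : R := n.+1%:R^-1.
have r0 n : 0 < r n by rewrite invr_gt0.
pose D n := [set u | ubox u (r n) `<=` O].
(* The complement of [D n] is open: a point outside O in the strict box around u remains in the
   boxes around matrices close to u. *)
have mD n : measurable (D n).
  rewrite -[D n]setCK; apply: measurableC; apply: measurable_open_unitary.
  apply/open_unitaryP => u /= /existsNP[v /not_implyP[uv nv]].
  have vu : ubox v (r n) u by move=> i j; rewrite -opprB normcN; exact: uv.
  have [d d0 dv] := ubox_triangle vu; exists d => // u' /dv vu' h; apply: nv; apply: h.
  by move=> i j; rewrite -opprB normcN; exact: vu'.
have [n hn] : exists n, (lam N (@pi_ R M @^-1` (O `\` D n)) <= e%:E)%E.
  apply: (decreasing_small lamfin) => //.
  - by move=> n; apply: mpi; exact: measurableD.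
  - move=> i j ij; apply/subsetPset => x /= [Ox nD]; split=> // Di; apply: nD.
    apply: subset_trans Di => v uv k l; apply: lt_le_trans (uv k l) _.
    by rewrite lef_pV2 ?posrE// ler_nat.
  - apply/seteqP; split=> // x h; have [Ox _] := h 0%N I.
    have [d d0 dO] := (open_unitaryP O).1 oO _ Ox.
    have [k kd] : exists k : nat, r k < d.
      near \oo => k; exists k; near: k; exact: near_infty_natSinv_lt (PosNum d0).
    have [_] := h k I; apply; apply: subset_trans dO => v uv i j.
    exact: lt_trans (uv i j) kd.
apply: filterS (shift_near NM (r0 n)) => ab hab; apply: le_trans hn.
have mt : measurable (tau ab @^-1` (@pi_ R M @^-1` O)).
  by rewrite -[X in measurable X]setTI; apply: measurable_tau => //; exact: mpi.
rewrite le_measure ?inE//; [by apply: measurableD => //; exact: mpi|by apply: mpi; exact: measurableD|].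
move=> x [Ox nO]; split=> // Dx; apply: nO.
have e1 : pi_ M (tau ab x) = Defs.shift (emb ab) (pi_ M x).
  by apply: pi_act_shift; apply: in_levelG_leq NM _; exact: in_levelG_emb.
suff : O (pi_ M (tau ab x)) by [].
by rewrite e1; apply: Dx; exact: hab.
Unshelve. all: by end_near. Qed.

(** Generation is used twice: cylinders generate the sigma-algebra of virtual unitary matrices, and
    open sets generate that of the bases at a fixed level. *)
Lemma cset_measurable A : measurable A -> cset (lam N) F tau A.
Proof.
have sA : sigma_algebra setT (cset (lam N) F tau).
  exact: (cset_sigma_algebra lamfin measurable_tau lam_tau).
apply: (@smallest_sub _ (sigma_algebra setT)); first exact: sA.
move=> _ [L [B' mB' ->]].
(* The level is raised to at least N, as [cset_open] requires. *)
have [B mB ->] := cylinder_lift (leq_maxr N L) mB'.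
move: B mB; apply: (@smallest_sub _ (sigma_algebra setT) _
   [set B | cset (lam N) F tau (@pi_ R (maxn N L) @^-1` B)]).
  have [s0 sD sU] := sA; split=> [|B cB|B cB] /=.
  - by rewrite preimage_set0.
  - by have := sD _ cB; rewrite !setTD.
  - by rewrite preimage_bigcup; exact: sU.
by move=> O oO; apply: cset_open => //; exact: leq_maxl.
Qed.

End CylinderSets.

(** * The norm of L2 and its triangle inequality *)

Section L2Norm.
Context d (T : measurableType d) (R : realType) (mu : {measure set T -> \bar R}).
Implicit Types f g : L2 mu.

Lemma L2_normE f :
  L2_norm f = Num.sqrt (fine (\int[mu]_x (normc (L2_fun f x) ^+ 2)%:E)).
Proof.
rewrite /L2_norm /L2_dot /cintegral /=; congr (Num.sqrt (fine _)).
apply: eq_integral => x _; congr (_%:E).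
by rewrite Defs.sqr_normc -/(Num.conj _) ReM ReJ ImJ; ring.
Qed.

Lemma L2_norm_ge0 f : 0 <= L2_norm f.
Proof. exact: sqrtr_ge0. Qed.

Lemma integral_L2_norm f :
  (\int[mu]_x (normc (L2_fun f x) ^+ 2)%:E = (L2_norm f ^+ 2)%:E)%E.
Proof.
have [_ fin] := L2P f.
have I0 : (0 <= \int[mu]_x (normc (L2_fun f x) ^+ 2)%:E)%E.
  by apply: integral_ge0 => x _; rewrite lee_fin sqr_ge0.
by rewrite L2_normE sqr_sqrtr ?fine_ge0// fineK// ge0_fin_numE.
Qed.

Lemma L2_norm_le f e : 0 <= e ->
  (\int[mu]_x (normc (L2_fun f x) ^+ 2)%:E <= (e ^+ 2)%:E)%E -> L2_norm f <= e.
Proof.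
move=> e0; rewrite integral_L2_norm lee_fin => h.
by rewrite -(@ler_pXn2r _ 2)// nnegrE ?L2_norm_ge0.
Qed.

Lemma L2_norm0 : L2_norm (0 : L2 mu) = 0.
Proof.
have h : {ae mu, forall x, L2_fun (0 : L2 mu) x = 0}.
  apply: filterS (L2_funL (-1) (0 : L2 mu) 0) => x.
  by rewrite scaler0 addr0 mulN1r addNr.
rewrite L2_normE (_ : (\int[mu]_x _)%E = 0%E) ?sqrtr0//.
rewrite -[RHS](integral0 mu setT); have [m0 _] := L2P (0 : L2 mu).
apply: ae_eq_integral => //.
  by apply/measurable_EFinP; apply: measurable_funX; exact: measurable_normc.
by apply: filterS h => x -> _; rewrite normc0 expr0n.
Qed.

Lemma L2_funB f g : {ae mu, forall x, L2_fun (f - g) x = L2_fun f x - L2_fun g x}.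
Proof.
rewrite -scaleN1r addrC; apply: filterS (L2_funL (-1) g f) => x ->.
by rewrite mulN1r addrC.
Qed.

Lemma sqr_normc_add_le (x y : R[i]) (t : R) : 0 < t ->
  normc (x + y) ^+ 2 <= (1 + t) * normc x ^+ 2 + (1 + t^-1) * normc y ^+ 2.
Proof.
move=> t0; rewrite !Defs.sqr_normc ReD ImD.
have key (a b : R) : (a + b) ^+ 2 <= (1 + t) * a ^+ 2 + (1 + t^-1) * b ^+ 2.
  have : 0 <= t * (a - t^-1 * b) ^+ 2 by rewrite mulr_ge0 ?sqr_ge0// ltW.
  have -> : t * (a - t^-1 * b) ^+ 2 = t * a ^+ 2 - 2 * a * b + t^-1 * b ^+ 2.
    by field; exact: lt0r_neq0.
  move: (t^-1 * b ^+ 2) (mulrDl 1 t^-1 (b ^+ 2)) => c ->; nra.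
have := lerD (key (Re x) (Re y)) (key (Im x) (Im y)); lra.
Qed.

(** Integrates a pointwise bound with a free parameter, so that only squared moduli occur;
    optimising t takes the place of the Cauchy-Schwarz inequality. *)
Lemma L2_norm_sqr_add f g (t : R) : 0 < t ->
  L2_norm (f + g) ^+ 2 <= (1 + t) * L2_norm f ^+ 2 + (1 + t^-1) * L2_norm g ^+ 2.
Proof.
move=> t0; have t1 : 0 <= 1 + t by rewrite addr_ge0// ltW.
have t2 : 0 <= 1 + t^-1 by rewrite addr_ge0// invr_ge0 ltW.
have [mf _] := L2P f; have [mg _] := L2P g; have [mfg _] := L2P (f + g).
have ms (u : T -> R[i]) : cmeas u -> measurable_fun setT (fun x => normc (u x) ^+ 2).
  by move=> mu'; apply: measurable_funX; exact: measurable_normc.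
suff : ((L2_norm (f + g) ^+ 2)%:E <= (1 + t)%:E * (L2_norm f ^+ 2)%:E +
    (1 + t^-1)%:E * (L2_norm g ^+ 2)%:E)%E by rewrite -!EFinM -EFinD lee_fin.
rewrite -!integral_L2_norm.
rewrite -!ge0_integralZl//; do ?[exact/measurable_EFinP/ms | by move=> x _; rewrite lee_fin sqr_ge0].
rewrite -ge0_integralD//; last 4 first.
- by move=> x _; rewrite -EFinM lee_fin mulr_ge0// sqr_ge0.
- by apply: emeasurable_funM => //; exact/measurable_EFinP/ms.
- by move=> x _; rewrite -EFinM lee_fin mulr_ge0// sqr_ge0.
- by apply: emeasurable_funM => //; exact/measurable_EFinP/ms.
apply: ae_ge0_le_integral => //.
- by move=> x _; rewrite lee_fin sqr_ge0.
- exact/measurable_EFinP/ms.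
- by move=> x _; rewrite -!EFinM -EFinD lee_fin addr_ge0// mulr_ge0// sqr_ge0.
- by apply: emeasurable_funD; apply: emeasurable_funM => //; exact/measurable_EFinP/ms.
apply: filterS (L2_funL 1 f g) => x e _; move: e; rewrite scale1r mul1r => ->.
by rewrite -!EFinM -EFinD lee_fin; exact: sqr_normc_add_le.
Qed.

Lemma L2_norm_triangle f g : L2_norm (f + g) <= L2_norm f + L2_norm g.
Proof.
apply/ler_addgt0Pr => e e0.
set a := L2_norm f; set b := L2_norm g.
have a0 : 0 <= a by exact: L2_norm_ge0.
have b0 : 0 <= b by exact: L2_norm_ge0.
(* Both norms are enlarged so that the optimal ratio t = q / p is positive even when one of them
   vanishes; at this t the bound becomes (p + q)^2. *)
pose p := a + e / 2; pose q := b + e / 2.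
have p0 : 0 < p by rewrite /p; lra.
have q0 : 0 < q by rewrite /q; lra.
have -> : a + b + e = p + q by rewrite /p /q; lra.
have pq0 : 0 <= p + q by rewrite addr_ge0// ltW.
rewrite -(@ler_pXn2r _ 2)// ?nnegrE ?L2_norm_ge0//.
apply: le_trans (L2_norm_sqr_add f g (divr_gt0 q0 p0)) _; rewrite -/a -/b.
have -> : (p + q) ^+ 2 = (1 + q / p) * p ^+ 2 + (1 + (q / p)^-1) * q ^+ 2.
  by field; rewrite !gt_eqF.
have h1 : 0 <= 1 + q / p by rewrite addr_ge0// divr_ge0// ltW.
have h2 : 0 <= 1 + (q / p)^-1 by rewrite addr_ge0// invr_ge0 divr_ge0// ltW.
apply: lerD; rewrite ler_wpM2l// ler_pXn2r// ?nnegrE ?(ltW p0) ?(ltW q0)// /p /q; lra.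
Qed.

End L2Norm.

(** * Continuity in the topology of G *)

Section StrongContinuity.
Variables (R : realType) (s z w : R[i]).
Hypothesis hzw : z + Num.conj w = s.
Variable haar : forall N : nat, probability (unitary R N) R.
Hypothesis hhaar : forall N : nat, is_haar (haar N).
Variable mu : probability (virtual_unitary R) R.
Hypothesis hmu : is_mu_s haar s mu.
Local Notation V := (virtual_unitary R).
Local Notation op := (op hzw hhaar hmu).
Implicit Types (f h k : L2 mu) (u v : unitary_inf R).

Lemma op_norm (g : Ginf R) f : L2_norm (op g f) = L2_norm f.
Proof. by rewrite /L2_norm op_dot. Qed.

Lemma opB (g : Ginf R) f h : op g (f - h) = op g f - op g h.
Proof.
by rewrite -scaleN1r addrC (op_linear hzw hhaar hmu g (-1) h f) scaleN1r addrC.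
Qed.

Lemma op_near N f (e : R) : 0 < e ->
  \forall ab \near nbhs ((1%g, 1%g) : unitary R N * unitary R N),
    L2_norm (op (emb ab) f - f) < e.
Proof.
move=> e0; have e2 : 0 < e / 2 by rewrite divr_gt0.
pose G (x : V) := L2_fun f x * pf z w (pi_ N x).
have [mf fin] := L2P f.
have mpfN : cmeas (fun x : V => pf z w (pi_ N x)).
  by apply: (cmeas_comp _ (@cmeas_pf R z w N)); exact: measurable_pi.
have mG : cmeas G by exact: cmeasM.
have sq (c : R[i]) x : normc (c * pf z w (pi_ N x)) ^+ 2 * wt z w N x = normc c ^+ 2.
  rewrite normcM exprMn /wt mulfK// expf_neq0// gt_eqF// normc_gt0//.
  exact: pf_neq0.
have mGs (H : V -> R[i]) : cmeas H -> measurable_fun setT (fun x => (normc (H x) ^+ 2)%:E).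
  by move=> mH; apply/measurable_EFinP; apply: measurable_funX; exact: measurable_normc.
have Gfin : (\int[lam z w mu N]_x (normc (G x) ^+ 2)%:E < +oo)%E.
  rewrite (integral_lam z w mu N (mGs _ mG)); last by move=> x; rewrite lee_fin sqr_ge0.
  by under eq_integral do rewrite -EFinM sq.
have : \forall ab \near nbhs ((1%g, 1%g) : unitary R N * unitary R N),
    (\int[lam z w mu N]_x (normc (G (tau ab x) - G x) ^+ 2)%:E <= ((e / 2) ^+ 2)%:E)%E.
  apply: (L2_continuity (lam_fin hzw hhaar hmu N) (@measurable_tau R N)
    (@lam_tau R s z w hzw haar hhaar mu hmu N)
    (@cset_measurable R s z w hzw haar hhaar mu hmu N) mG Gfin).
  exact: exprn_gt0.
apply: filterS => ab hab; apply: (@le_lt_trans _ _ (e / 2)); last first.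
  by rewrite ltr_pdivrMr// ltr_pMr// ltr1n.
apply: L2_norm_le; first exact: ltW.
apply: le_trans hab; rewrite le_eqVlt; apply/orP; left; apply/eqP.
have mGt : cmeas (fun x => G (tau ab x) - G x).
  by apply: cmeasD; [exact: cmeas_comp (measurable_tau ab) mG|exact: cmeasN].
rewrite (integral_lam z w mu N (mGs _ mGt)); last by move=> x; rewrite lee_fin sqr_ge0.
have [md _] := L2P (op (emb ab) f - f).
apply: ae_eq_integral => //; first exact: mGs.
  by apply: emeasurable_funM; [exact: mGs|exact: measurable_wtE].
apply: filterS (aeI (L2_funB (op (emb ab) f) f)
  (aeI (op_fun hzw hhaar hmu (emb ab) f) (ae_mdom hzw hhaar hmu (emb ab)))).
move=> x [-> [-> d]] _; rewrite -EFinM -(sq _ x); congr ((normc _ ^+ 2 * _)%:E).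
(* At level N the denominator of the multiplier cancels against the factor [pf] at x, leaving [G] at
   the translated point. *)
rewrite (multiplier_mdom z w (in_levelG_emb ab) d) /G /tau mulrBl; congr (_ - _).
by rewrite -mulrA divfK// pf_neq0.
Qed.

Lemma nbhs_ubox N (a : unitary R N) (S : set (unitary R N)) : nbhs a S ->
  exists2 e : R, 0 < e & ubox a e `<=` S.
Proof.
rewrite nbhsE => -[U [oU Ua] US]; have [e e0 eU] := (open_unitaryP U).1 oU _ Ua.
by exists e => //; exact: subset_trans US.
Qed.

(** 1 - a^-1 b = a^-1 (a - b), where the entries of a^-1 have modulus at most 1; N + 1 instead of N
    makes the bound strict and keeps the radius positive at N = 0. *)
Lemma ubox_div N (a : unitary R N) (e : R) : 0 < e ->
  exists2 d : R, 0 < d & forall b, ubox a d b -> ubox 1%g e (a^-1 * b)%g.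
Proof.
move=> e0; have N0 : 0 < (N%:R + 1 : R) by rewrite ltr_pwDr.
exists (e / (N%:R + 1)) => [|b ab i j]; first by rewrite divr_gt0.
have -> : val (1%g : unitary R N) i j - val (a^-1 * b)%g i j =
    (val a^-1%g *m (val a - val b)) i j.
  by rewrite mulmxBr -!val_unitaryM mulVg [RHS]mxE; congr (_ + _); rewrite [RHS]mxE.
have [|+ _] := @normc_mulmx_le R N (val a^-1%g) (val a - val b) (e / (N%:R + 1)) i j
  (normc_unitary_le1 a^-1%g).
  by move=> k l; rewrite !mxE ltW//; exact: ab.
move=> /le_lt_trans; apply.
by rewrite mulrCA -[ltRHS]mulr1 ltr_pM2l// ltr_pdivrMr// mul1r ltrDl.
Qed.

Section OneParameter.
Variable iota : unitary_inf R -> Ginf R.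
Hypothesis iotaM : forall u v, iota (u * v)%g = (iota u * iota v)%g.
Hypothesis iota_near : forall N h (e : R), 0 < e ->
  \forall a \near nbhs (1%g : unitary R N), L2_norm (op (iota (uembed a)) h - h) < e.

(** Openness is tested on each U(N). As the operator at a is an isometry, moving from a to b
    displaces the image of h by the norm of op (a^-1 b) h - h, so continuity at 1 suffices. *)
Lemma open_op_ball h k (e : R) : open [set u | L2_norm (op (iota u) h - k) < e].
Proof.
suff : @uinf_open R [set u | L2_norm (op (iota u) h - k) < e] by [].
move=> N; apply/open_unitaryP => a /= ha.
have r0 : 0 < e - L2_norm (op (iota (uembed a)) h - k) by rewrite subr_gt0.
have [d d0 dS] := nbhs_ubox (iota_near N h r0).
have [d' d'0 hd'] := ubox_div a d0; exists d' => // b /hd' /dS /= hb.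
have -> : op (iota (uembed b)) h - k =
    op (iota (uembed a)) (op (iota (uembed (a^-1 * b)%g)) h - h) +
    (op (iota (uembed a)) h - k).
  rewrite opB -opM -iotaM; have -> : (uembed a * uembed (a^-1 * b)%g)%g = uembed b.
    have aN : in_level N (uembed a) by exists a.
    have bN : in_level N (uembed (a^-1 * b)%g) by eexists.
    by apply: etrans (umulE aN bN) _; rewrite !uembedK mulgA mulgV mul1g.
  by rewrite addrA subrK.
apply: le_lt_trans (L2_norm_triangle _ _) _.
by rewrite op_norm -ltrBrDr.
Qed.

End OneParameter.

Lemma op_pair u v f : op (u, v) f = op (u, 1%g) (op (1%g, v) f).
Proof.
rewrite -opM; congr (op _ f).
by apply: injective_projections; rewrite /= ?mulg1 ?mul1g.
Qed.

(* A set is open in U(infinity) if its trace on each U(N) is open; the product with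
   itself is treated by factoring (u, v) as (u, 1) (1, v). *)
Lemma op_strongly_continuous f (g0 : Ginf R) :
  L2_norm (op g f - op g0 f) @[g --> g0] --> (0 : R).
Proof.
have emb1 N (a : unitary R N) : ((uembed a, 1%g) : Ginf R) = emb (a, 1%g).
  by congr (_, _); exact: uoneE.
have emb2 N (a : unitary R N) : ((1%g, uembed a) : Ginf R) = emb (1%g, a).
  by congr (_, _); exact: uoneE.
have near1 N h (e : R) : 0 < e -> \forall a \near nbhs (1%g : unitary R N),
    L2_norm (op (uembed a, 1%g) h - h) < e.
  move=> e0; have [[A B] [/= A1 B1] AB] := op_near N h e0.
  apply: filterS A1 => a Aa; rewrite emb1; apply: (AB (a, 1%g)); split=> //=.
  exact: nbhs_singleton B1.
have near2 N h (e : R) : 0 < e -> \forall a \near nbhs (1%g : unitary R N),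
    L2_norm (op (1%g, uembed a) h - h) < e.
  move=> e0; have [[A B] [/= A1 B1] AB] := op_near N h e0.
  apply: filterS B1 => a Ba; rewrite emb2; apply: (AB (1%g, a)); split=> //=.
  exact: nbhs_singleton A1.
have M1 u v : ((u * v, 1) : Ginf R)%g = ((u, 1) * (v, 1))%g.
  by apply: injective_projections; rewrite /= ?mulg1.
have M2 u v : ((1, u * v) : Ginf R)%g = ((1, u) * (1, v))%g.
  by apply: injective_projections; rewrite /= ?mulg1.
case: g0 => u0 v0; apply/cvgrPdist_lt => e e0.
have e2 : 0 < e / 2 by rewrite divr_gt0.
pose h := op (1%g, v0) f.
pose A := [set u | L2_norm (op (u, 1%g) h - op (u0, 1%g) h) < e / 2].
pose B := [set v | L2_norm (op (1%g, v) f - op (1%g, v0) f) < e / 2].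
have n0 k : L2_norm (k - k) = 0 by rewrite subrr L2_norm0.
have oA : open A by exact: (open_op_ball (iota := fun u => (u, 1%g)) M1 near1).
have oB : open B by exact: (open_op_ball (iota := fun u => (1%g, u)) M2 near2).
exists (A, B).
  by split; apply: open_nbhs_nbhs; split => //; rewrite /A /B /= n0.
move=> [u v] [/= Au Bv].
rewrite sub0r normrN ger0_norm ?L2_norm_ge0//.
(* The operator at (u, 1) is an isometry, so the norm of the first term depends on v only and the
   two terms are controlled separately. *)
have -> : op (u, v) f - op (u0, v0) f =
    op (u, 1%g) (op (1%g, v) f - h) + (op (u, 1%g) h - op (u0, 1%g) h).
  by rewrite opB (op_pair u v) (op_pair u0 v0) addrA subrK.
apply: le_lt_trans (L2_norm_triangle _ _) _; rewrite op_norm (splitr e).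
exact: ltrD.
Qed.

End StrongContinuity.

Lemma L2_norm_cst d (T : measurableType d) (R : realType) (mu : probability T R) (c : R[i]) :
  L2_norm (L2_cst mu c) = normc c.
Proof.
pose k : L2fun mu := exist (fun f : T -> R[i] => f \in L2_pred mu) _ (L2_cst_subproof mu c).
have [m _] := L2P (L2_cst mu c).
rewrite L2_normE (_ : (\int[mu]_x _)%E = (normc c ^+ 2)%:E).
  by rewrite /= sqrtr_sqr ger0_norm ?normc_ge0.
transitivity (\int[mu]_x (normc c ^+ 2)%:E)%E; last first.
  by rewrite integral_cst//= probability_setT mule1.
apply: ae_eq_integral => //.
  by apply/measurable_EFinP; apply: measurable_funX; exact: measurable_normc.
by apply: filterS (L2_fun_class k) => x e _; congr ((normc _ ^+ 2)%:E).
Qed.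

Theorem theorem4p11 (R : realType) (s z w : R[i])
  (hs : - 2^-1 < complex.Re s) (hzw : z + w^* = s)
  (haar : forall N : nat, probability (unitary R N) R)
  (hhaar : forall N : nat, is_haar (haar N))
  (mu : probability (virtual_unitary R) R) (hmu : is_mu_s haar s mu) :
  exists T : Ginf R -> L2 mu -> L2 mu,
    [/\ is_unitary_representation T,
        forall (g : Ginf R) (f : L2fun mu),
          {ae mu, forall x : virtual_unitary R,
            L2_fun (T g (L2_class f)) x = val f (act x g) * multiplier z w x g},
        L2_norm (L2_cst mu 1) = 1
      & forall u : unitary_inf R, T (u, u) (L2_cst mu 1) = L2_cst mu 1].
Proof.
exists (op hzw hhaar hmu); split.
- split; [exact: op_unitary|exact: op_id|exact: opM|exact: op_strongly_continuous].
- exact: op_class.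
- by rewrite L2_norm_cst normc1.
- by move=> u; exact: op_cst.
Qed.
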